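(* Let $\mathcal{D}\subseteq\mathbb{Z}_{\geq 0}$ contain at least two integers, let $r=\min(\mathcal{D})$ and $p=\gcd\{d_1-d_2 \mid d_1,d_2\in\mathcal{D}\}$ (with $\max(\mathcal{D})=+\infty$ if $\mathcal{D}$ is infinite). Let $m,n$ be integers tending to infinity such that $2m/n$ stays in a fixed compact interval of the open interval $]r,\max(\mathcal{D})[$ and $p$ divides $2m-rn$. Then the number of simple graphs in $\operatorname{SG}^{(\mathcal{D})}_{n,m}$ is \[ \frac{(2m)!}{2^m m!}\,\frac{\operatorname{Set}_{\mathcal{D}}(\zeta)^n}{\zeta^{2m}}\,\frac{p}{\sqrt{2\pi n\zeta\phi'(\zeta)}}\,e^{-W_{\frac{n}{m}}(\zeta)^2-W_{\frac{n}{m}}(\zeta)}\,(1+O(n^{-1})), \] where $\phi(x)=\frac{x\operatorname{Set}_{\mathcal{D}-1}(x)}{\operatorname{Set}_{\mathcal{D}}(x)}$, $\zeta$ is the unique positive solution of $\phi(\zeta)=\frac{2m}{n}$, and $W_{\frac{n}{m}}(x)=\frac{n}{4m}\frac{x^2\operatorname{Set}_{\mathcal{D}-2}(x)}{\operatorname{Set}_{\mathcal{D}}(x)}$. Moreover, if $p$ does not divide $2m-rn$, or if $2m/n<r$, or if $2m/n>\max(\mathcal{D})$, then $\operatorname{SG}^{(\mathcal{D})}_{n,m}$ is empty.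
   Context: A simple graph on the labelled vertex set $\{1,\dots,n\}$ has a set of edges, each an unordered pair of distinct vertices; the degree of a vertex is the number of edges containing it. $\operatorname{SG}^{(\mathcal{D})}_{n,m}$ denotes the set of simple graphs with vertex set $\{1,\dots,n\}$, exactly $m$ edges, and every vertex degree in $\mathcal{D}$. For a set $\mathcal{D}$ of nonnegative integers, $\operatorname{Set}_{\mathcal{D}}(x)=\sum_{d\in\mathcal{D}}\frac{x^d}{d!}$, and for a natural number $i$, $\mathcal{D}-i=\{d-i \mid d\in\mathcal{D},\ d-i\geq 0\}$. The error term $O(n^{-1})$ is uniform over $2m/n$ in the fixed compact interval. *)

(* Defs.v *)
From HB Require Import structures.
From mathcomp Require Export all_boot all_order all_algebra.
From mathcomp Require Export finmap.
From mathcomp Require Export all_classical all_reals all_analysis.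

Set Implicit Arguments.
Unset Strict Implicit.
Unset Printing Implicit Defensive.

Export Order.TTheory GRing.Theory Num.Theory.
Export numFieldNormedType.Exports.

Local Open Scope classical_set_scope.
Local Open Scope ring_scope.

(* The vertex set is 'I_n = {0, ..., n-1} instead of {1, ..., n}; a graph is
   identified with its set of edges, and an edge with its set of endpoints. *)
Definition degree n (E : {set {set 'I_n}}) (v : 'I_n) : nat :=
  #|[set e : {set 'I_n} in E | v \in e]%SET|.

Definition SG (D : set nat) (n m : nat) : {set {set {set 'I_n}}} :=
  [set E : {set {set 'I_n}} | [&& [forall e in E, #|e| == 2%N],
    #|E| == m & [forall v, degree E v \in D]]]%SET.

Definition is_min (D : set nat) (r : nat) : Prop := D r /\ lbound D r.

(* D may be infinite, so the gcd of its differences is characterised as the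
   nonnegative common divisor that every common divisor divides. *)
Definition is_gcd_diff (D : set nat) (p : nat) : Prop :=
  (forall d1 d2 : nat, D d1 -> D d2 -> (p%:Z %| d1%:Z - d2%:Z)%Z) /\
  (forall q : nat,
    (forall d1 d2 : nat, D d1 -> D d2 -> (q%:Z %| d1%:Z - d2%:Z)%Z) ->
    (q %| p)%N).

Definition set_sub (D : set nat) (i : nat) : set nat :=
  [set (d - i)%N | d in D `&` [set d | (i <= d)%N]].

Section RealDefs.
Variable R : realType.
Implicit Types (D : set nat) (x : R).

Definition maxD D : \bar R :=
  if `[< finite_set D >] then (\max_(d <- fset_set D) d)%:R%:E else +oo%E.

(* The series is dominated by that of the exponential, so the limit exists at
   every x. *)
Definition SetD D x : R :=
  limn (pseries (fun d => (d \in D)%:R / d`!%:R) x).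

Definition phi D x : R := x * SetD (set_sub D 1) x / SetD D x.

Definition W D (n m : nat) x : R :=
  n%:R / (4 * m)%:R * (x ^+ 2 * SetD (set_sub D 2) x / SetD D x).

Definition main_term D (p n m : nat) x : R :=
  ((2 * m)`!)%:R / (2 ^ m * m`!)%:R
  * (SetD D x ^+ n / x ^+ (2 * m))
  * (p%:R / Num.sqrt (2 * pi * n%:R * x * derive1 (phi D) x))
  * expR (- W D n m x ^+ 2 - W D n m x).

End RealDefs.

Arguments maxD R D : clear implicits.

(* Main.v *)
(* The number of graphs is the image of the coefficient of w^m in the product of
   the 1 + w x_i x_j, i < j, under the linear functional replacing each x_v^d by
   1 if d is in D and by 0 otherwise.  Write 1 + y = e^y . (1 + y) e^{-y} and
   complete the sum of the x_i x_j to half the square of the sum of the x_v,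
   paying a factor e^{-w x_v^2 / 2} (a loop) for each vertex.  Expanding the
   factors (1 + y) e^{-y} and e^{-y / 2} gives an exact formula: a signed sum over
   "patches" (multiplicities on edges and loops) of (2m)!/(2^m m!) Z^n / zeta^{2m}
   times the coefficient of s^{2m} in a product of n generating functions of the
   factorial moments of the law with weights proportional to zeta^d / d! on D.

   At the saddle point this law has mean 2m/n and variance zeta phi'(zeta), and
   Fourier inversion on [-pi/p, pi/p] gives the Gaussian value of that
   coefficient with relative error O(1/n) for each fixed patch.  The sum over
   patches converges absolutely, uniformly in n; the patches in which some vertex
   has degree other than 0 and 2 contribute O(1/n), and the Gaussian values of
   the others sum up to a product over edges and loops, which tends to
   e^{-W^2 - W}. *)

Require Import Defs.
From mathcomp Require Import ring lra zify.
From mathcomp Require Import complex.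

Set Implicit Arguments.
Unset Strict Implicit.
Unset Printing Implicit Defensive.

Local Open Scope classical_set_scope.
Local Open Scope ring_scope.

(** * Gaussian integrals and Fourier inversion *)

Section GaussianIntegrals.
Context {R : realType}.
Local Notation mu := (@lebesgue_measure R).

(** The factor [e^y] is split off because [(1 + y) e^{-y}] has no linear term. The weight [w] of one
    unit of multiplicity is of order [1/n]; a linear term on some [n^2] edges would make the
    absolute sum exponential in [n], while [n^2 w^2] for edges and [n w] for loops stay bounded.
    Half the square of a linear form then lets the functional factor over the vertices. Every patch
    needs a bound, which forces three regimes. For sizes [h] below a multiple of [n] and no bad
    vertex, the local limit theorem applies, with errors growing geometrically in [h]. Bad patches
    of such sizes only get the order [n^{-1/2}] of the coefficient. For larger [h] the ratio of
    double factorials, at most [1/h!], takes over. A relative error [1/n] instead of [n^{-1/2}]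
    requires seeing that the cubic term of the characteristic function is imaginary, so real parts
    and moduli are estimated separately. All constants depend only on [D] and the interval, through
    bounds [z1 <= zeta <= z2]. Laws are cut at degree [2 m], with an error [n^{-2}] because it is
    repeated up to [n] times. *)

Definition gaussE (a t : R) : R := expR (- a * t ^+ 2).

Lemma gaussE_pdf (a : R) : 0 < a ->
  gaussE a = (fun t => Num.sqrt (pi / a) * normal_pdf 0 (Num.sqrt (2 * a))^-1 t).
Proof.
move=> a0; apply/funext => t.
have s0 : Num.sqrt (2 * a) != 0 by rewrite gt_eqF// sqrtr_gt0 mulr_gt0.
rewrite normal_pdfE ?invr_neq0// /normal_peak /normal_fun subr0.
have -> : (Num.sqrt (2 * a))^-1 ^+ 2 = (2 * a)^-1.
  by rewrite exprVn sqr_sqrtr// mulr_ge0// ltW.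
have -> : (2 * a)^-1 * pi *+ 2 = pi / a by field; rewrite gt_eqF.
rewrite mulrA divff ?mul1r; last by rewrite gt_eqF// sqrtr_gt0 divr_gt0// pi_gt0.
rewrite /gaussE; congr expR; field; by rewrite gt_eqF.
Qed.

Lemma integrable_gaussE (a : R) : 0 < a -> mu.-integrable setT (EFin \o gaussE a).
Proof.
move=> a0; rewrite gaussE_pdf//.
exact: (integrableZl _ _ (integrable_normal_pdf _ _)).
Qed.

Lemma Rintegral_gaussE (a : R) : 0 < a ->
  \int[mu]_(t in setT) gaussE a t = Num.sqrt (pi / a).
Proof.
move=> a0; rewrite gaussE_pdf// RintegralZl//; last exact: integrable_normal_pdf.
by rewrite /Rintegral integral_normal_pdf mulr1.
Qed.

Lemma continuous_gaussE (a : R) : continuous (gaussE a).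
Proof.
move=> t; apply: continuous_comp; last exact: continuous_expR.
by apply: cvgM; [exact: cvg_cst|exact: exprn_continuous].
Qed.

Lemma gaussE_ge0 (a t : R) : 0 <= gaussE a t. Proof. exact: expR_ge0. Qed.

Lemma continuous_integrable_itv (f : R -> R) (a b : R) : continuous f ->
  mu.-integrable `[a, b] (EFin \o f).
Proof.
move=> cf; apply: continuous_compact_integrable; first exact: segment_compact.
exact: continuous_subspaceT.
Qed.

Lemma continuous_normr (f : R -> R) : continuous f ->
  continuous (fun t => `|f t|).
Proof. by move=> cf t; apply: cvg_norm; exact: cf. Qed.

Lemma Rintegral_gaussE_itv_le (a L : R) : 0 < a ->
  \int[mu]_(t in `[- L, L]) gaussE a t <= Num.sqrt (pi / a).
Proof.
move=> a0; rewrite -Rintegral_gaussE//.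
rewrite [X in X <= _]Rintegral_mkcond; apply: le_Rintegral => //.
- rewrite -restrict_EFin; apply/integrable_restrict => //=.
  by rewrite setTI; exact/continuous_integrable_itv/continuous_gaussE.
- exact: integrable_gaussE.
- move=> t _; rewrite patchE; case: ifP => // _; exact: gaussE_ge0.
Qed.

(** Outside [[-L, L]] one has [t^2 >= L^2], so half of the exponent becomes the factor
    [exp (- a L^2 / 2)] and the other half a Gaussian integrable over the whole line. *)
Lemma Rintegral_gaussE_itv_ge (a L : R) : 0 < a -> 0 <= L ->
  Num.sqrt (pi / a) - expR (- (a / 2) * L ^+ 2) * Num.sqrt (pi / (a / 2)) <=
  \int[mu]_(t in `[- L, L]) gaussE a t.
Proof.
move=> a0 L0; have a20 : 0 < a / 2 by rewrite divr_gt0.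
rewrite lerBlDr -!Rintegral_gaussE// -RintegralZl//; last exact: integrable_gaussE.
rewrite [X in _ <= X + _]Rintegral_mkcond.
have I1 : mu.-integrable setT (EFin \o (gaussE a \_ `[- L, L])).
  rewrite -restrict_EFin; apply/integrable_restrict => //=.
  by rewrite setTI; exact/continuous_integrable_itv/continuous_gaussE.
have I2 : mu.-integrable setT
    (EFin \o (fun t => expR (- (a / 2) * L ^+ 2) * gaussE (a / 2) t)).
    exact: (integrableZl measurableT _ (integrable_gaussE a20)).
rewrite -RintegralD//; apply: le_Rintegral => //.
- exact: integrable_gaussE.
- exact: (integrableD _ I1 I2).
- move=> t _; rewrite patchE; case: ifPn => [_|].
    by rewrite lerDl mulr_ge0// ?expR_ge0.
  rewrite notin_setE /= in_itv/= => /negP tL; rewrite add0r /gaussE -expRD ler_expR.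
  have : L ^+ 2 <= t ^+ 2.
    rewrite -(real_normK (num_real t)) ler_sqr ?nnegrE//.
    by rewrite leNgt; apply: contra tL; rewrite ltr_norml => /andP[/ltW -> /ltW ->].
  move: a0; clear; move=> a0 h; nra.
Qed.

End GaussianIntegrals.

(** * Coefficients recovered from a cosine transform on a short window *)

Section Fourier.
Context {R : realType}.
Local Notation mu := (@lebesgue_measure R).
Implicit Types (F : {poly R}) (K t : R).

(** The real part of [F(e^{it}) e^{-iKt}]. The imaginary part is odd in [t], so over a symmetric
    window the cosines carry the whole Fourier integral. *)
Definition costr F K t : R := \sum_(j < size F) F`_j * cos ((j%:R - K) * t).

Lemma continuous_cosM (c : R) : continuous (fun t : R => cos (c * t)).
Proof.
move=> t; apply: (@continuous_comp _ _ _ (fun t => c * t) cos).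
  by apply: cvgM; [exact: cvg_cst|exact: cvg_id].
exact: continuous_cos.
Qed.

Lemma continuous_sum n (f : 'I_n -> R -> R) : (forall i, continuous (f i)) ->
  continuous (fun t => \sum_(i < n) f i t).
Proof.
elim: n f => [|n IH] f cf t.
  by under eq_fun do rewrite big_ord0; exact: cvg_cst.
under eq_fun do rewrite big_ord_recl.
by apply: cvgD; [exact: cf|apply: IH => i; exact: cf].
Qed.

Lemma continuous_costr F K : continuous (costr F K).
Proof.
apply: continuous_sum => i t.
by apply: cvgM; [exact: cvg_cst|exact: continuous_cosM].
Qed.

Lemma sin_natpi (k : nat) : sin (k%:R * pi) = 0 :> R.
Proof.
elim: k => [|k IH]; first by rewrite mul0r sin0.
by rewrite -natr1 mulrDl mul1r sinDpi IH oppr0.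
Qed.

Lemma Rintegral_cosM (c L : R) : c != 0 -> 0 < L ->
  \int[mu]_(t in `[- L, L]) cos (c * t) = 2 * sin (c * L) / c.
Proof.
move=> c0 L0.
have dF (x : R) : is_derive x 1 (fun t : R => c^-1 * sin (c * t)) (cos (c * x)).
  apply: is_derive_eq.
  by rewrite /GRing.scale/=; field.
rewrite /Rintegral (@continuous_FTC2 _ _ (fun t => c^-1 * sin (c * t))).
- by rewrite -EFinB /= mulrN sinN; field.
- by rewrite -subr_gt0 opprK addr_gt0.
- exact/continuous_subspaceT/continuous_cosM.
- have cF (x : R) : {for x, continuous (fun t : R => c^-1 * sin (c * t))}.
    by apply: differentiable_continuous; apply/derivable1_diffP/(@ex_derive _ _ _ _ _ _ _ (dF x)).
  split.
  + by move=> x _; exact: (@ex_derive _ _ _ _ _ _ _ (dF x)).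
  + by apply: cvg_at_right_filter; exact: cF.
  + by apply: cvg_at_left_filter; exact: cF.
- by move=> x _; rewrite derive1E (@derive_val _ _ _ _ _ _ _ (dF x)).
Qed.

Lemma Rintegral_sum_itv (a b : R) n (f : 'I_n -> R -> R) :
  (forall i, continuous (f i)) ->
  \int[mu]_(t in `[a, b]) (\sum_(i < n) f i t) =
  \sum_(i < n) \int[mu]_(t in `[a, b]) f i t.
Proof.
elim: n f => [|n IH] f cf.
  under eq_Rintegral do rewrite big_ord0.
  by rewrite big_ord0 Rintegral_cst// mul0r.
under eq_Rintegral do rewrite big_ord_recl.
rewrite big_ord_recl RintegralD//.
- by rewrite IH.
- exact: continuous_integrable_itv.
- by apply: continuous_integrable_itv; exact: continuous_sum.
Qed.

(** When [j] and [k] are congruent modulo [p], [(j - k) pi / p] is a multiple of [pi], so a window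
    of length [2 pi / p] already makes the frequencies orthogonal. The factor [p] of the asymptotic
    formula originates here. *)
Lemma fourier_coef F (k p : nat) : (0 < p)%N ->
  (forall j, F`_j != 0 -> j = k %[mod p]) ->
  \int[mu]_(t in `[- (pi / p%:R), pi / p%:R]) costr F k%:R t = 2 * pi / p%:R * F`_k.
Proof.
move=> p0 Fp; have p0' : p%:R != 0 :> R by rewrite pnatr_eq0 -lt0n.
have L0 : 0 < pi / p%:R :> R by rewrite divr_gt0 ?pi_gt0 ?ltr0n.
rewrite Rintegral_sum_itv; last first.
  move=> i t; by apply: cvgM; [exact: cvg_cst|exact: continuous_cosM].
have E (j : nat) : \int[mu]_(t in `[- (pi / p%:R), pi / p%:R])
    (F`_j * cos ((j%:R - k%:R) * t)) = if j == k then 2 * pi / p%:R * F`_k else 0.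
  rewrite RintegralZl//; last exact/continuous_integrable_itv/continuous_cosM.
  have [->|jk] := eqVneq j k.
    under eq_Rintegral do rewrite subrr mul0r cos0.
    rewrite Rintegral_cst//= lebesgue_measure_itv /= lte_fin gtrN// -EFinB/=.
    by field.
  have [->|/Fp jkp] := eqVneq F`_j 0; first by rewrite mul0r.
  rewrite Rintegral_cosM//; last by rewrite subr_eq0 eqr_nat.
  have [lejk|ltkj] := leqP j k.
    have /dvdnP[q qE] : (p %| k - j)%N by rewrite -eqn_mod_dvd// jkp.
    have -> : j%:R - k%:R = - (q * p)%:R :> R by rewrite -qE natrB// opprB.
    have -> : - (q * p)%:R * (pi / p%:R) = - (q%:R * pi) :> R by rewrite natrM; field.
    by rewrite sinN sin_natpi oppr0 mulr0 mul0r mulr0.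
  have /dvdnP[q qE] : (p %| j - k)%N by rewrite -eqn_mod_dvd ?(ltnW ltkj)// jkp.
  have -> : j%:R - k%:R = (q * p)%:R :> R by rewrite -qE natrB// ltnW.
  have -> : (q * p)%:R * (pi / p%:R) = q%:R * pi :> R by rewrite natrM; field.
  by rewrite sin_natpi mulr0 mul0r mulr0.
under eq_bigr do rewrite E.
have [ks|ks] := ltnP k (size F).
  by rewrite (bigD1 (Ordinal ks))//= eqxx big1 ?addr0// => i /negPf; rewrite -val_eqE/= => ->.
rewrite nth_default// mulr0 big1// => i _; case: eqP => // ik.
Qed.

Let mulf_cancel2 (P q x : R) : P != 0 -> q != 0 ->
  x = q / (2 * P) * (2 * P / q * x).
Proof. by move=> P0 q0; field; rewrite ?P0 ?q0. Qed.

Lemma fourier_coef_le F (k p : nat) (eps c : R) : (0 < p)%N ->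
  (forall j, F`_j != 0 -> j = k %[mod p]) -> 0 < c ->
  (forall t, `|t| <= pi / p%:R -> `|costr F k%:R t| <= eps * gaussE c t) ->
  `|F`_k| <= p%:R / (2 * pi) * (eps * Num.sqrt (pi / c)).
Proof.
move=> p0 Fp c0 H; have p0' : 0 < p%:R :> R by rewrite ltr0n.
have pi0 := pi_gt0 R.
have -> : F`_k = p%:R / (2 * pi) *
    \int[mu]_(t in `[- (pi / p%:R), pi / p%:R]) costr F k%:R t.
  by rewrite fourier_coef//; apply: mulf_cancel2; rewrite gt_eqF.
have e0 : 0 <= eps.
  have := le_trans (normr_ge0 _) (H 0 _); rewrite /gaussE expr0n/= mulr0 expR0 mulr1; apply.
  by rewrite normr0 divr_ge0 ?ltW.
have q0 : 0 <= p%:R / (2 * pi) :> R by rewrite divr_ge0 ?mulr_ge0 ?ltW.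
rewrite normrM (ger0_norm q0); apply: ler_wpM2l => //.
rewrite (le_trans (le_normr_Rintegral _ _))//.
  exact/continuous_integrable_itv/continuous_costr.
apply: (@le_trans _ _ (\int[mu]_(t in `[- (pi / p%:R), pi / p%:R]) (eps * gaussE c t))).
  apply: le_Rintegral => //.
  - apply: continuous_integrable_itv; apply: continuous_normr.
    exact: continuous_costr.
  - apply: continuous_integrable_itv => t.
    by apply: cvgM; [exact: cvg_cst|exact: continuous_gaussE].
  - by move=> t /=; rewrite in_itv/= -ler_norml; exact: H.
rewrite RintegralZl//; last exact/continuous_integrable_itv/continuous_gaussE.
by rewrite ler_wpM2l// Rintegral_gaussE_itv_le.
Qed.

(** Two errors add up: the pointwise one, integrated against [gaussE c], and the Gaussian tail
    outside the window, since the main integral is explicit only over the whole line. *)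
Lemma fourier_coef_gauss F (k p : nat) (B a eps c : R) : (0 < p)%N ->
  (forall j, F`_j != 0 -> j = k %[mod p]) -> 0 < c -> 0 < a ->
  (forall t, `|t| <= pi / p%:R ->
    `|costr F k%:R t - B * gaussE a t| <= eps * gaussE c t) ->
  `|F`_k - B * (p%:R / (2 * pi) * Num.sqrt (pi / a))| <=
  p%:R / (2 * pi) * (eps * Num.sqrt (pi / c) +
    `|B| * (expR (- (a / 2) * (pi / p%:R) ^+ 2) * Num.sqrt (pi / (a / 2)))).
Proof.
move=> p0 Fp c0 a0 H; have p0' : 0 < p%:R :> R by rewrite ltr0n.
have pi0 := pi_gt0 R.
have L0 : 0 <= pi / p%:R :> R by rewrite divr_ge0 ?ltW.
have e0 : 0 <= eps.
  have := le_trans (normr_ge0 _) (H 0 _); rewrite /gaussE expr0n/= !mulr0 expR0 !mulr1; apply.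
  by rewrite normr0.
have Icos := @continuous_integrable_itv R _ (- (pi / p%:R)) (pi / p%:R) (@continuous_costr F k%:R).
have IB : mu.-integrable `[- (pi / p%:R), pi / p%:R] (EFin \o (fun t => B * gaussE a t)).
  apply: continuous_integrable_itv => t.
  by apply: cvgM; [exact: cvg_cst|exact: continuous_gaussE].
have -> : F`_k = p%:R / (2 * pi) *
    \int[mu]_(t in `[- (pi / p%:R), pi / p%:R]) costr F k%:R t.
  by rewrite fourier_coef//; apply: mulf_cancel2; rewrite gt_eqF.
have q0 : 0 <= p%:R / (2 * pi) :> R by rewrite divr_ge0 ?mulr_ge0 ?ltW.
rewrite mulrCA -mulrBr normrM (ger0_norm q0); apply: ler_wpM2l => //.
set I := (X in `|X - _|).
set G := \int[mu]_(t in `[- (pi / p%:R), pi / p%:R]) gaussE a t.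
have h1 : `|I - B * G| <= eps * Num.sqrt (pi / c).
  rewrite /I /G -RintegralZl//; last exact/continuous_integrable_itv/continuous_gaussE.
  rewrite -RintegralB//.
  have cf : continuous (fun t => costr F k%:R t - B * gaussE a t).
    move=> t; apply: cvgB; first exact: continuous_costr.
    by apply: cvgM; [exact: cvg_cst|exact: continuous_gaussE].
  rewrite (le_trans (le_normr_Rintegral _ _))//.
    exact/continuous_integrable_itv.
  apply: (@le_trans _ _ (\int[mu]_(t in `[- (pi / p%:R), pi / p%:R]) (eps * gaussE c t))).
    apply: le_Rintegral => //.
    - apply: continuous_integrable_itv; apply: continuous_normr.
      exact: cf.
    - apply: continuous_integrable_itv => t.
      by apply: cvgM; [exact: cvg_cst|exact: continuous_gaussE].
    - by move=> t /=; rewrite in_itv/= -ler_norml; exact: H.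
  rewrite RintegralZl//; last exact/continuous_integrable_itv/continuous_gaussE.
  by rewrite ler_wpM2l// Rintegral_gaussE_itv_le.
have h2 : `|B * G - B * Num.sqrt (pi / a)| <=
    `|B| * (expR (- (a / 2) * (pi / p%:R) ^+ 2) * Num.sqrt (pi / (a / 2))).
  rewrite -mulrBr normrM ler_wpM2l// distrC ger0_norm; last first.
    by rewrite subr_ge0 Rintegral_gaussE_itv_le.
  by rewrite lerBlDl -lerBlDr Rintegral_gaussE_itv_ge.
have -> : I - B * Num.sqrt (pi / a) = (I - B * G) + (B * G - B * Num.sqrt (pi / a)) by ring.
by rewrite (le_trans (ler_normD _ _))// lerD.
Qed.

End Fourier.

(** * Powers of complex numbers *)

Section ComplexModulus.
Context {R : realType}.
Implicit Types (u v z w : R[i]) (x t K : R).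

Local Notation nrm := (@Normc.normc R).
Local Notation ReR := (@complex.Re R).
Local Notation ImR := (@complex.Im R).

Lemma normc_sqr z : nrm z ^+ 2 = ReR z ^+ 2 + ImR z ^+ 2.
Proof. by case: z => a b; rewrite /Normc.normc sqr_sqrtr ?addr_ge0 ?sqr_ge0. Qed.

Lemma normc_ge0 z : 0 <= nrm z.
Proof. by case: z => a b; rewrite /Normc.normc sqrtr_ge0. Qed.

Lemma normc_exp z n : nrm (z ^+ n) = nrm z ^+ n.
Proof.
elim: n => [|n IH]; first by rewrite !expr0 Normc.normc1.
by rewrite !exprS Normc.normcM IH.
Qed.

Lemma normcD_le z w : nrm (z + w) <= nrm z + nrm w.
Proof. exact: le_normcD. Qed.

Lemma Re_normc_le z : `|ReR z| <= nrm z.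
Proof.
rewrite -(@ler_pXn2r _ 2) ?nnegrE ?normc_ge0// normc_sqr real_normK ?num_real//.
by rewrite lerDl sqr_ge0.
Qed.

Lemma Im_normc_le z : `|ImR z| <= nrm z.
Proof.
rewrite -(@ler_pXn2r _ 2) ?nnegrE ?normc_ge0// normc_sqr real_normK ?num_real//.
by rewrite lerDr sqr_ge0.
Qed.

Lemma normc_le_ReIm z : nrm z <= `|ReR z| + `|ImR z|.
Proof.
rewrite -(@ler_pXn2r _ 2) ?nnegrE ?normc_ge0 ?addr_ge0// normc_sqr sqrrD.
rewrite !real_normK ?num_real// -addrA lerD2l lerDr mulrn_wge0// mulr_ge0//.
Qed.

Lemma normc_real x : nrm x%:C%C = `|x|.
Proof. by rewrite /Normc.normc /= expr0n/= addr0 sqrtr_sqr. Qed.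

Lemma ReM z w : ReR (z * w) = ReR z * ReR w - ImR z * ImR w.
Proof. by case: z w => a b []. Qed.

Lemma ImM z w : ImR (z * w) = ReR z * ImR w + ImR z * ReR w.
Proof. by case: z w => a b []. Qed.

Lemma ReD z w : ReR (z + w) = ReR z + ReR w. Proof. by case: z w => a b []. Qed.
Lemma ImD z w : ImR (z + w) = ImR z + ImR w. Proof. by case: z w => a b []. Qed.
Lemma ReB z w : ReR (z - w) = ReR z - ReR w. Proof. by case: z w => a b []. Qed.
Lemma ImB z w : ImR (z - w) = ImR z - ImR w. Proof. by case: z w => a b []. Qed.
Lemma ReZ x z : ReR (x%:C%C * z) = x * ReR z.
Proof. by case: z => a b; rewrite ReM/= mul0r subr0. Qed.
Lemma ImZ x z : ImR (x%:C%C * z) = x * ImR z.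
Proof. by case: z => a b; rewrite ImM/= mul0r addr0. Qed.
Lemma Re_sum n (f : 'I_n -> R[i]) : ReR (\sum_(i < n) f i) = \sum_(i < n) ReR (f i).
Proof. by elim/big_ind2: _ => // a b c d <- <-; rewrite ReD. Qed.
Lemma Im_sum n (f : 'I_n -> R[i]) : ImR (\sum_(i < n) f i) = \sum_(i < n) ImR (f i).
Proof. by elim/big_ind2: _ => // a b c d <- <-; rewrite ImD. Qed.

(** Telescoping. The factor [M] on the left stands for an exponent [N - 1] on the right, so that
    [N = 0] fits too. *)
Lemma normc_powB (u v : R[i]) (M : R) N : nrm u <= M -> nrm v <= M -> 0 < M ->
  nrm (u ^+ N - v ^+ N) * M <= N%:R * M ^+ N * nrm (u - v).
Proof.
move=> uM vM M0; elim: N => [|N IH].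
  by rewrite !expr0 subrr Normc.normc0 !mul0r.
have -> : u ^+ N.+1 - v ^+ N.+1 = u * (u ^+ N - v ^+ N) + v ^+ N * (u - v).
  by rewrite !exprS; ring.
have h1 : nrm (u * (u ^+ N - v ^+ N)) * M <= M * (N%:R * M ^+ N * nrm (u - v)).
  rewrite Normc.normcM -mulrA; apply: ler_pM => //; rewrite ?normc_ge0//.
  by rewrite mulr_ge0 ?normc_ge0// ltW.
have h2 : nrm (v ^+ N * (u - v)) * M <= M * (M ^+ N * nrm (u - v)).
  rewrite Normc.normcM mulrC ler_pM2l// ler_wpM2r ?normc_ge0// normc_exp.
  by rewrite lerXn2r ?nnegrE ?normc_ge0// ltW.
apply: (@le_trans _ _ ((nrm (u * (u ^+ N - v ^+ N)) + nrm (v ^+ N * (u - v))) * M)).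
  by rewrite ler_pM2r// normcD_le.
by rewrite mulrDl (le_trans (lerD h1 h2))// -natr1 exprS le_eqVlt; apply/orP; left; apply/eqP; ring.
Qed.

(** The linear term is kept apart because, for [v] real, its real part only involves [Re (u - v)],
    which in the application is much smaller than the modulus of [u - v]. *)
Lemma normc_powB2 (u v : R[i]) (M : R) N : nrm u <= M -> nrm v <= M -> 0 < M ->
  nrm (u ^+ N - v ^+ N - N%:R * v ^+ N.-1 * (u - v)) * M ^+ 2 <=
  N%:R ^+ 2 * M ^+ N * nrm (u - v) ^+ 2.
Proof.
move=> uM vM M0; elim: N => [|N IH].
  by rewrite !expr0 subrr !mul0r subrr Normc.normc0 expr0n !mul0r.
case: N IH => [_|N IH].
  rewrite !expr1 expr0 !mul1r subrr Normc.normc0 mul0r.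
  by rewrite mulr_ge0 ?sqr_ge0// expr1n mul1r ltW.
set d := u - v in IH *.
have -> : u ^+ N.+2 - v ^+ N.+2 - N.+2%:R * v ^+ N.+2.-1 * d =
   u * (u ^+ N.+1 - v ^+ N.+1 - N.+1%:R * v ^+ N.+1.-1 * d) + N.+1%:R * (v ^+ N * (d * d)).
  rewrite /= -(natr1 N.+1) !exprS /d; ring.
set E := (_ - _ - _ : R[i]) in IH *.
have h1 : nrm (u * E) * M ^+ 2 <= M * (N.+1%:R ^+ 2 * M ^+ N.+1 * nrm d ^+ 2).
  rewrite Normc.normcM -mulrA; apply: ler_pM => //; rewrite ?normc_ge0//.
  by rewrite mulr_ge0 ?normc_ge0// sqr_ge0.
have h2 : nrm (N.+1%:R * (v ^+ N * (d * d))) * M ^+ 2 <= N.+1%:R * (M ^+ N.+2 * nrm d ^+ 2).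
  rewrite !Normc.normcM normc_exp.
  have -> : nrm N.+1%:R = N.+1%:R by rewrite -[N.+1%:R](rmorph_nat (real_complex R)) normc_real normr_nat.
  have -> : N.+1%:R * (nrm v ^+ N * (nrm d * nrm d)) * M ^+ 2 =
    N.+1%:R * (nrm v ^+ N * (nrm d * nrm d * M ^+ 2)) by ring.
  have -> : M ^+ N.+2 * nrm d ^+ 2 = M ^+ N * (nrm d * nrm d * M ^+ 2).
    by rewrite 2!exprS; ring.
  apply: ler_wpM2l => //; apply: ler_wpM2r; last first.
    by rewrite lerXn2r ?nnegrE ?normc_ge0// ltW.
  by rewrite !mulr_ge0 ?normc_ge0 ?(ltW M0).
apply: (@le_trans _ _ ((nrm (u * E) + nrm (N.+1%:R * (v ^+ N * (d * d)))) * M ^+ 2)).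
  by rewrite ler_wpM2r ?sqr_ge0// normcD_le.
rewrite mulrDl (le_trans (lerD h1 h2))// [M ^+ N.+2]exprS -(natr1 N.+1).
have := exprn_ge0 N.+1 (ltW M0); have : 0 <= N.+1%:R :> R by [].
have := normc_ge0 d; move: (nrm d) (M ^+ N.+1) (N.+1%:R : R) => a b c a0 c0 b0.
rewrite -subr_ge0.
have -> : (c + 1) ^+ 2 * (M * b) * a ^+ 2 - (M * (c ^+ 2 * b * a ^+ 2) + c * (M * b * a ^+ 2))
  = (c + 1) * (M * b * (a ^+ 2)) by ring.
by rewrite !mulr_ge0 ?sqr_ge0 ?addr_ge0// ltW.
Qed.

(* [ImR w] is only of order [t], but the real part of [w ^+ h] sees it
   quadratically. *)
Lemma ReIm_exp_approx (w : R[i]) (A b X Y : R) h : nrm w <= A -> `|b| <= A ->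
  `|ReR w - b| <= X -> `|ImR w| <= Y -> 1 <= A ->
  `|ImR (w ^+ h)| <= h%:R * A ^+ h * Y /\
  `|ReR (w ^+ h) - b ^+ h| <= A ^+ h * (h%:R * X + h%:R ^+ 2 * Y ^+ 2).
Proof.
move=> wA bA wX wY A1; elim: h => [|h [IH1 IH2]].
  by rewrite !expr0 /= normr0 subrr normr0 !mul0r mul1r expr0n !mul0r addr0.
have A0 : 0 <= A by rewrite (le_trans _ A1).
have X0 : 0 <= X by rewrite (le_trans _ wX).
have Y0 : 0 <= Y by rewrite (le_trans _ wY).
have wh : nrm (w ^+ h) <= A ^+ h by rewrite normc_exp lerXn2r ?nnegrE ?normc_ge0.
have Ah0 : 0 <= A ^+ h by rewrite exprn_ge0.
have Rw := le_trans (Re_normc_le w) wA.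
have Rwh := le_trans (Re_normc_le (w ^+ h)) wh.
have bh : `|b ^+ h| <= A ^+ h by rewrite normrX lerXn2r ?nnegrE.
split.
  rewrite [w ^+ h.+1]exprS ImM (le_trans (ler_normD _ _))// !normrM exprS -natr1.
  apply: (@le_trans _ _ (A * (h%:R * A ^+ h * Y) + Y * A ^+ h)).
    by apply: lerD; apply: ler_pM.
  have -> : (h%:R + 1) * (A * A ^+ h) * Y = A * (h%:R * A ^+ h * Y) + A * (Y * A ^+ h) by ring.
  by rewrite lerD2l ler_peMl// mulr_ge0.
have -> : ReR (w ^+ h.+1) - b ^+ h.+1 = ReR w * (ReR (w ^+ h) - b ^+ h)
    + b ^+ h * (ReR w - b) - ImR w * ImR (w ^+ h).
  by rewrite [w ^+ h.+1]exprS ReM exprS; ring.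
apply: (@le_trans _ _ (A * (A ^+ h * (h%:R * X + h%:R ^+ 2 * Y ^+ 2)) + A ^+ h * X +
    Y * (h%:R * A ^+ h * Y))).
  rewrite (le_trans (ler_normB _ _))// lerD//; last by rewrite normrM; apply: ler_pM.
  by rewrite (le_trans (ler_normD _ _))// lerD// normrM; apply: ler_pM.
rewrite [A ^+ h.+1]exprS -natr1.
have h0 : 0 <= h%:R :> R by [].
move: (A ^+ h) (h%:R : R) Ah0 h0 => a c a0 c0.
rewrite -subr_ge0.
have -> : A * a * ((c + 1) * X + (c + 1) ^+ 2 * Y ^+ 2) -
  (A * (a * (c * X + c ^+ 2 * Y ^+ 2)) + a * X + Y * (c * a * Y)) =
  (A - 1) * (a * X) + (A - 1) * (a * c * Y ^+ 2) + A * a * ((c + 1) * Y ^+ 2) by ring.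
by rewrite !addr_ge0// !mulr_ge0 ?subr_ge0 ?sqr_ge0 ?addr_ge0.
Qed.

(** [a] bounds the real part of [u - v] and [d] its modulus; [d] only enters squared or multiplied
    by an imaginary part. In the application [a] has order [t^4] and [d] order [|t|^3], so at
    [t^2 ~ 1/N] a plain [N d] would leave [N^{-1/2}], whereas all terms here have order [1/N]. *)
Lemma Re_pow_mul_approx (u w : R[i]) (v M A b a d X Y : R) N h :
  nrm u <= M -> 0 <= v <= M -> 0 < M <= 1 ->
  nrm w <= A -> `|b| <= A -> 1 <= A ->
  `|ReR w - b| <= X -> `|ImR w| <= Y ->
  `|ReR u - v| <= a -> nrm (u - v%:C%C) <= d ->
  `|ReR (w ^+ h * u ^+ N) - b ^+ h * v ^+ N| * M ^+ 2 <=
  A ^+ h * M ^+ N * (N%:R * a + N%:R ^+ 2 * d ^+ 2 + (h%:R * X + h%:R ^+ 2 * Y ^+ 2)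
    + N%:R * d * (h%:R * Y)).
Proof.
move=> uM /andP[v0 vM] /andP[M0 M1] wA bA A1 wX wY ua ud.
have [hI hR] := ReIm_exp_approx h wA bA wX wY A1.
have A0 : 0 <= A by rewrite (le_trans _ A1).
have X0 : 0 <= X by rewrite (le_trans _ wX).
have Y0 : 0 <= Y by rewrite (le_trans _ wY).
have a0 : 0 <= a by rewrite (le_trans _ ua).
have d0 : 0 <= d by rewrite (le_trans _ ud)// normc_ge0.
have vM' : nrm v%:C%C <= M by rewrite normc_real ger0_norm.
have vN : v%:C%C ^+ N = (v ^+ N)%:C%C :> R[i] by rewrite rmorphXn.
have Ah0 : 0 <= A ^+ h by rewrite exprn_ge0.
have MN0 : 0 <= M ^+ N by rewrite exprn_ge0// ltW.
have M2 : M ^+ 2 <= M by rewrite expr2 ger_pMl.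
have M20 : 0 <= M ^+ 2 by rewrite sqr_ge0.
have vN1 : v ^+ N <= M ^+ N by rewrite lerXn2r ?nnegrE// ltW.
have wh : nrm (w ^+ h) <= A ^+ h by rewrite normc_exp lerXn2r ?nnegrE ?normc_ge0.
have Rwh := le_trans (Re_normc_le (w ^+ h)) wh.
have h1 : `|ImR (u ^+ N)| * M ^+ 2 <= M ^+ N * (N%:R * d).
  have -> : ImR (u ^+ N) = ImR (u ^+ N - v%:C%C ^+ N) by rewrite ImB vN /= subr0.
  apply: (@le_trans _ _ (nrm (u ^+ N - v%:C%C ^+ N) * M)).
    by apply: ler_pM => //; exact: Im_normc_le.
  rewrite (le_trans (normc_powB N uM vM' M0))// [N%:R * _]mulrC -mulrA.
  by rewrite ler_wpM2l// ler_wpM2l.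
have h2 : `|ReR (u ^+ N) - v ^+ N| * M ^+ 2 <= M ^+ N * (N%:R * a + N%:R ^+ 2 * d ^+ 2).
  have -> : ReR (u ^+ N) - v ^+ N = ReR (u ^+ N - v%:C%C ^+ N - N%:R * v%:C%C ^+ N.-1 * (u - v%:C%C))
      + N%:R * v ^+ N.-1 * (ReR u - v).
    rewrite !ReB vN -mulrA.
    have -> : (N%:R : R[i]) = (N%:R)%:C%C by rewrite rmorph_nat.
    have -> : v%:C%C ^+ N.-1 = (v ^+ N.-1)%:C%C :> R[i] by rewrite rmorphXn.
    by rewrite !ReZ ReB /=; ring.
  apply: (@le_trans _ _ (N%:R ^+ 2 * M ^+ N * d ^+ 2 + M ^+ N * (N%:R * a))); last first.
    by rewrite le_eqVlt; apply/orP; left; apply/eqP; ring.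
  set E := u ^+ N - _ - _.
  apply: (@le_trans _ _ ((nrm E + `|N%:R * v ^+ N.-1 * (ReR u - v)|) * M ^+ 2)).
    by rewrite ler_wpM2r// (le_trans (ler_normD _ _))// lerD2r Re_normc_le.
  rewrite mulrDl lerD//.
    apply: (le_trans (normc_powB2 N uM vM' M0)).
    by rewrite ler_wpM2l ?mulr_ge0 ?sqr_ge0// lerXn2r ?nnegrE ?normc_ge0.
  have [->|N0] := posnP N; first by rewrite !mul0r normr0 !mul0r mulr0.
  rewrite 2!normrM normr_nat (ger0_norm (exprn_ge0 _ v0)).
  have -> : N%:R * v ^+ N.-1 * `|ReR u - v| * M ^+ 2 =
    N%:R * ((v ^+ N.-1 * M) * (`|ReR u - v| * M)) by ring.
  rewrite [leRHS]mulrCA; apply: ler_wpM2l => //; apply: ler_pM.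
  - by rewrite mulr_ge0 ?exprn_ge0// ltW.
  - by rewrite mulr_ge0// ltW.
  - rewrite -[in leRHS](prednK N0) exprSr ler_pM2r//.
    by rewrite lerXn2r ?nnegrE// ltW.
  - rewrite -[leRHS]mulr1; apply: ler_pM => //; exact: ltW.
have -> : ReR (w ^+ h * u ^+ N) - b ^+ h * v ^+ N = ReR (w ^+ h) * (ReR (u ^+ N) - v ^+ N)
   + (ReR (w ^+ h) - b ^+ h) * v ^+ N - ImR (w ^+ h) * ImR (u ^+ N).
  by rewrite ReM; ring.
apply: (@le_trans _ _ ((`|ReR (w ^+ h) * (ReR (u ^+ N) - v ^+ N)| +
   `|(ReR (w ^+ h) - b ^+ h) * v ^+ N| + `|ImR (w ^+ h) * ImR (u ^+ N)|) * M ^+ 2)).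
  by rewrite ler_wpM2r// (le_trans (ler_normB _ _))// lerD2r ler_normD.
set z1 := N%:R * a + _ in h2 *; set z2 := h%:R * X + _ in hR *.
apply: (@le_trans _ _ (A ^+ h * (M ^+ N * z1) + A ^+ h * z2 * M ^+ N +
   h%:R * A ^+ h * Y * (M ^+ N * (N%:R * d)))); last first.
  by rewrite le_eqVlt; apply/orP; left; apply/eqP; ring.
have M0' := ltW M0; rewrite 2!mulrDl !normrM; apply: lerD; first apply: lerD.
- by rewrite -[leLHS]mulrA; apply: ler_pM; rewrite ?mulr_ge0.
- rewrite -[leLHS]mulrA; apply: ler_pM; rewrite ?mulr_ge0 ?exprn_ge0//.
  rewrite (ger0_norm (exprn_ge0 _ v0)) -[leRHS]mulr1; apply: ler_pM => //.
    by rewrite exprn_ge0.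
  by rewrite (le_trans M2).
- by rewrite -[leLHS]mulrA; apply: ler_pM; rewrite ?mulr_ge0.
Qed.

Lemma pow_le_expR (x : R) k : 0 <= x -> x ^+ k <= k`!%:R * expR x.
Proof.
move=> x0; have f0 : 0 < (k`!)%:R :> R by rewrite ltr0n fact_gt0.
case: k f0 => [|k] f0; first by rewrite mul1r (le_trans _ (expR_ge1Dx x))// lerDl.
by rewrite mulrC -ler_pdivrMr// (le_trans _ (expR_ge1Dxn k x0))// lerDr.
Qed.

(** The denominator is the least value of [exp (- c t^2)^2] for [|t| <= 4] and repays the factor
    [M ^+ 2] of [Re_pow_mul_approx]. The bracket comes from [y^j <= j! (2/c)^j exp (c y / 2)]
    applied to [8 + 2 y + 2 y^2 + 2 y^3]. *)
Definition llt_const (c C : R) : R := C ^+ 2 *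
  (8 + 2 * (2 / c) + 2 * (2 * (2 / c) ^+ 2) + 2 * (6 * (2 / c) ^+ 3)) / expR (- c * 16) ^+ 2.

Lemma poly_le_expR (c y : R) : 0 < c -> 0 <= y ->
  8 + 2 * y + 2 * y ^+ 2 + 2 * y ^+ 3 <=
  (8 + 2 * (2 / c) + 2 * (2 * (2 / c) ^+ 2) + 2 * (6 * (2 / c) ^+ 3)) * expR (c / 2 * y).
Proof.
move=> c0 y0; set x := c / 2 * y.
have x0 : 0 <= x by rewrite mulr_ge0// divr_ge0// ltW.
have -> : y = 2 / c * x by rewrite /x; field; rewrite gt_eqF.
have k0 : 0 <= 2 / c by rewrite divr_ge0// ltW.
have h0 := pow_le_expR 0 x0; have h1 := pow_le_expR 1 x0.
have h2 := pow_le_expR 2 x0; have h3 := pow_le_expR 3 x0.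
rewrite expr0 mul1r in h0; rewrite expr1 mul1r in h1.
move: (2 / c) (expR x) k0 h0 h1 h2 h3 => k e k0 h0 h1 h2 h3; clear -x0 k0 h0 h1 h2 h3.
rewrite -subr_ge0.
have -> : (8 + 2 * k + 2 * (2 * k ^+ 2) + 2 * (6 * k ^+ 3)) * e -
  (8 + 2 * (k * x) + 2 * (k * x) ^+ 2 + 2 * (k * x) ^+ 3) =
  8 * (e - 1) + 2 * (k * (e - x)) + 2 * (k ^+ 2 * (2 * e - x ^+ 2)) +
  2 * (k ^+ 3 * (6 * e - x ^+ 3)) by ring.
have p2 : 0 <= k ^+ 2 by rewrite exprn_ge0.
have p3 : 0 <= k ^+ 3 by rewrite exprn_ge0.
by rewrite !addr_ge0// mulr_ge0// ?subr_ge0// mulr_ge0// subr_ge0.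
Qed.

(* With [y = N t^2], every error term of [Re_pow_mul_approx] is [1 / N] times a
   polynomial in [y], which half of the Gaussian factor absorbs. *)
Lemma Re_pow_mul_gauss (u w : R[i]) (c C v A b t : R) N h :
  0 < c -> 1 <= C -> 1 <= A -> (0 < N)%N -> `|t| <= 4 ->
  nrm u <= expR (- c * t ^+ 2) -> 0 <= v <= expR (- c * t ^+ 2) ->
  nrm w <= A -> `|b| <= A ->
  `|ReR w - b| <= C * (t ^+ 2 + N%:R^-1 ^+ 2) -> `|ImR w| <= C * `|t| ->
  `|ReR u - v| <= C * (t ^+ 4 + N%:R^-1 ^+ 2) ->
  nrm (u - v%:C%C) <= C * (`|t| ^+ 3 + N%:R^-1 ^+ 2) ->
  `|ReR (w ^+ h * u ^+ N) - b ^+ h * v ^+ N| <=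
  llt_const c C * A ^+ h * (1 + h%:R ^+ 2) / N%:R * expR (- (c / 2 * N%:R) * t ^+ 2).
Proof.
move=> c0 C1 A1 N0 t4 uM vM wA bA wX wY ua ud.
set M := expR (- c * t ^+ 2) in uM vM.
have M01 : 0 < M <= 1.
  rewrite expR_gt0 -expR0 ler_expR mulNr oppr_le0 mulr_ge0 ?sqr_ge0// ltW//.
have := Re_pow_mul_approx N h uM vM M01 wA bA A1 wX wY ua ud.
set G := (X in _ <= _ * X).
set s := `|t| in t4 wY ud G *.
have s0 : 0 <= s by rewrite /s.
have t2 : t ^+ 2 = s ^+ 2 by rewrite /s real_normK ?num_real.
have t4' : t ^+ 4 = s ^+ 4 by rewrite -[4%N]/(2 * 2)%N !exprM t2.
have n0 : 0 < N%:R :> R by rewrite ltr0n.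
set y := N%:R * s ^+ 2.
have y0 : 0 <= y by rewrite mulr_ge0 ?sqr_ge0// ltW.
have Gle : G <= C ^+ 2 * (1 + h%:R ^+ 2) / N%:R * (8 + 2 * y + 2 * y ^+ 2 + 2 * y ^+ 3).
  rewrite /G t2 t4'.
  have k1 : 1 <= N%:R :> R by rewrite ler1n.
  have h2 : h%:R <= h%:R ^+ 2 :> R by case: (h) => [|k]; rewrite ?expr0n// expr2 ler_peMr// ler1n.
  have h0 : 0 <= h%:R :> R by [].
  move: (h%:R : R) h0 h2 => H H0 HH.
  pose e : R := N%:R^-1.
  have e0 : 0 < e by rewrite invr_gt0.
  have e1 : e <= 1 by rewrite invf_le1.
  have eE : N%:R * e = 1 by rewrite divff// gt_eqF.
  rewrite -/e /y; move: (N%:R : R) (e) eE n0 k1 e0 e1 => k f kf k0 k1 f0 f1.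
  have CC : C <= C ^+ 2 by rewrite expr2 ler_peMr// (le_trans _ C1).
  have C0 : 0 <= C by rewrite (le_trans _ C1).
  have -> : C ^+ 2 * (1 + H ^+ 2) * f * (8 + 2 * (k * s ^+ 2) + 2 * (k * s ^+ 2) ^+ 2 + 2 * (k * s ^+ 2) ^+ 3)
    = C ^+ 2 * (1 + H ^+ 2) * (8 * f + 2 * ((k * f) * s ^+ 2) + 2 * ((k * f) * k * s ^+ 4)
       + 2 * ((k * f) * k ^+ 2 * s ^+ 6)) by ring.
  rewrite kf !mul1r.
  have T1 : k * (C * (s ^+ 4 + f ^+ 2)) <= C ^+ 2 * (1 + H ^+ 2) * (k * s ^+ 4 + f).
    have -> : k * (C * (s ^+ 4 + f ^+ 2)) = C * (k * s ^+ 4 + (k * f) * f) by ring.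
    rewrite kf mul1r; apply: ler_wpM2r; first by rewrite addr_ge0 ?mulr_ge0 ?exprn_ge0// ltW.
    by rewrite (le_trans CC)// ler_peMr ?sqr_ge0// lerDl sqr_ge0.
  have T2 : k ^+ 2 * (C * (s ^+ 3 + f ^+ 2)) ^+ 2 <=
      C ^+ 2 * (1 + H ^+ 2) * (2 * (k ^+ 2 * s ^+ 6) + 2 * f).
    apply: (@le_trans _ _ (C ^+ 2 * (2 * (k ^+ 2 * s ^+ 6) + 2 * f))); last first.
      apply: ler_wpM2r; first by rewrite addr_ge0 ?mulr_ge0 ?exprn_ge0// ltW.
      by rewrite ler_peMr ?sqr_ge0// lerDl sqr_ge0.
    have -> : k ^+ 2 * (C * (s ^+ 3 + f ^+ 2)) ^+ 2 =
      C ^+ 2 * (k ^+ 2 * (s ^+ 3 + f ^+ 2) ^+ 2) by ring.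
    apply: ler_wpM2l; first exact: sqr_ge0.
    have : (s ^+ 3 + f ^+ 2) ^+ 2 <= 2 * s ^+ 6 + 2 * f ^+ 4.
      rewrite -subr_ge0 (_ : _ - _ = (s ^+ 3 - f ^+ 2) ^+ 2) ?sqr_ge0//; ring.
    move=> /(ler_wpM2l (sqr_ge0 k)) /le_trans; apply.
    have -> : k ^+ 2 * (2 * s ^+ 6 + 2 * f ^+ 4) =
       2 * (k ^+ 2 * s ^+ 6) + 2 * ((k * f) ^+ 2 * (f * f)) by ring.
    by rewrite kf expr1n mul1r lerD2l ler_pM2l// ger_pMl.
  have T3 : H * (C * (s ^+ 2 + f ^+ 2)) + H ^+ 2 * (C * s) ^+ 2 <=
      C ^+ 2 * (1 + H ^+ 2) * (2 * s ^+ 2 + f).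
    have a1 : H * (C * (s ^+ 2 + f ^+ 2)) <= C ^+ 2 * (1 + H ^+ 2) * (s ^+ 2 + f).
      rewrite mulrA; apply: ler_pM => //.
      - by rewrite mulr_ge0.
      - by rewrite addr_ge0 ?sqr_ge0.
      - by rewrite mulrC; apply: ler_pM => //; rewrite (le_trans HH)// lerDr.
      - by rewrite lerD2l expr2 ger_pMl.
    have a2 : H ^+ 2 * (C * s) ^+ 2 <= C ^+ 2 * (1 + H ^+ 2) * s ^+ 2.
      rewrite exprMn mulrA; apply: ler_wpM2r; first exact: sqr_ge0.
      by rewrite mulrC ler_wpM2l ?sqr_ge0// lerDr.
    apply: (le_trans (lerD a1 a2)); rewrite -mulrDr.
    by rewrite le_eqVlt; apply/orP; left; apply/eqP; ring.
  have T4 : k * (C * (s ^+ 3 + f ^+ 2)) * (H * (C * s)) <=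
      C ^+ 2 * (1 + H ^+ 2) * (k * s ^+ 4 + 4 * f).
    have -> : k * (C * (s ^+ 3 + f ^+ 2)) * (H * (C * s)) =
      C ^+ 2 * H * (k * s ^+ 4 + s * ((k * f) * f)) by ring.
    rewrite kf mul1r; apply: ler_pM.
    - by rewrite mulr_ge0 ?sqr_ge0.
    - by rewrite addr_ge0 ?mulr_ge0 ?exprn_ge0// ltW.
    - by rewrite ler_wpM2l ?sqr_ge0// (le_trans HH)// lerDr.
    - by rewrite lerD2l ler_pM2r.
  apply: (le_trans (lerD (lerD (lerD T1 T2) T3) T4)).
  rewrite -!mulrDr; apply: ler_wpM2l.
    by rewrite mulr_ge0 ?sqr_ge0// addr_ge0 ?sqr_ge0.
  by rewrite le_eqVlt; apply/orP; left; apply/eqP; ring.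
move=> main.
have M2 : expR (- c * 16) ^+ 2 <= M ^+ 2.
  rewrite lerXn2r ?nnegrE ?expR_ge0// ler_expR !mulNr lerN2 ler_wpM2l ?(ltW c0)//.
  by rewrite t2 (_ : 16 = 4 ^+ 2) ?lerXn2r ?nnegrE// -natrX.
rewrite -(@ler_pM2r _ (expR (- c * 16) ^+ 2)) ?exprn_gt0 ?expR_gt0//.
apply: (@le_trans _ _ (A ^+ h * M ^+ N * G)).
  by apply: le_trans main; rewrite ler_wpM2l.
have A0 : 0 <= A by rewrite (le_trans _ A1).
have P0 : 0 <= A ^+ h * M ^+ N by rewrite mulr_ge0 ?exprn_ge0// ltW// expR_gt0.
apply: (le_trans (ler_wpM2l P0 Gle)).
have MN : M ^+ N = expR (- (c / 2 * N%:R) * t ^+ 2) * expR (- (c / 2 * y)).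
  by rewrite /M -expRM_natl -expRD /y t2; congr expR; field.
rewrite /llt_const MN.
have := poly_le_expR c0 y0.
set Q := (_ + 2 * (6 * _)); set q := (8 + _ + _ + _); move=> qQ.
have E0 : 0 <= C ^+ 2 * (1 + h%:R ^+ 2) / N%:R * (A ^+ h * expR (- (c / 2 * N%:R) * t ^+ 2)).
  by rewrite !mulr_ge0 ?addr_ge0 ?invr_ge0 ?expR_ge0 ?exprn_ge0 ?sqr_ge0 ?(le_trans ler01 C1).
have q2 : q * expR (- (c / 2 * y)) <= Q.
  by rewrite expRN ler_pdivrMr ?expR_gt0.
move: (ler_wpM2l E0 q2) => /le_trans.
have -> : A ^+ h * (expR (- (c / 2 * N%:R) * t ^+ 2) * expR (- (c / 2 * y))) *
  (C ^+ 2 * (1 + h%:R ^+ 2) / N%:R * q) = C ^+ 2 * (1 + h%:R ^+ 2) / N%:R *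
  (A ^+ h * expR (- (c / 2 * N%:R) * t ^+ 2)) * (q * expR (- (c / 2 * y))) by ring.
apply; rewrite le_eqVlt; apply/orP; left; apply/eqP.
by field; rewrite !gt_eqF ?expR_gt0.
Qed.

End ComplexModulus.

(** * Elementary bounds for sine, cosine and the exponential *)

Section TrigBounds.
Context {R : realType}.
Implicit Types (x t : R).

(** The mean value theorem loses the factor [1 / (k + 1)] of an integration, but it can be iterated:
    from [|cos| <= 1] it yields in turn the Taylor bounds of sine and cosine below. *)
Lemma MVT_pow_bound (f df : R -> R) (C : R) k :
  (forall x : R, is_derive x 1 f (df x)) -> f 0 = 0 ->
  (forall x, `|df x| <= C * `|x| ^+ k) -> forall x, `|f x| <= C * `|x| ^+ k.+1.
Proof.
move=> fdf f0 dfC x.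
have cf : continuous f.
  move=> y; apply: differentiable_continuous; apply/derivable1_diffP.
  exact: (@ex_derive _ _ _ _ _ _ _ (fdf y)).
have C0 : 0 <= C.
  by have := le_trans (normr_ge0 _) (dfC 1); rewrite normr1 expr1n mulr1.
have step c : `|c| <= `|x| -> `|df c * x| <= C * `|x| ^+ k.+1.
  move=> cx; rewrite normrM exprSr mulrA ler_wpM2r// (le_trans (dfC c))//.
  by rewrite ler_wpM2l// lerXn2r ?nnegrE.
have [x0|x0] := leP 0 x.
  have [c] := MVT_segment x0 (fun y _ => fdf y) (continuous_subspaceT cf).
  rewrite in_itv/= => /andP[c0 cx]; rewrite f0 !subr0 => ->.
  by apply: step; rewrite !ger0_norm.
have [c] := MVT_segment (ltW x0) (fun y _ => fdf y) (continuous_subspaceT cf).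
rewrite in_itv/= => /andP[c0 cx]; rewrite f0 !sub0r => fx.
rewrite -normrN fx mulrN normrN; apply: step.
by rewrite !ler0_norm ?lerN2// ltW.
Qed.

Lemma sin_le_norm x : `|sin x| <= `|x|.
Proof.
have := @MVT_pow_bound sin cos 1 0 (fun x => is_derive_sin x) (sin0 R).
move=> /(_ _ x); rewrite mul1r expr1; apply => y.
by rewrite expr0 mulr1 cos_max.
Qed.

Lemma cos_sub1_le x : `|cos x - 1| <= x ^+ 2.
Proof.
have := @MVT_pow_bound (fun y => cos y - 1) (fun y => - sin y) 1 1.
move=> /(_ _ _ _ x); rewrite mul1r real_normK ?num_real//; apply.
- by move=> y; apply: is_derive_eq; rewrite subr0.
- by rewrite cos0 subrr.
- by move=> y; rewrite normrN mul1r expr1 sin_le_norm.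
Qed.

Lemma sin_subid_le x : `|sin x - x| <= `|x| ^+ 3.
Proof.
have := @MVT_pow_bound (fun y => sin y - y) (fun y => cos y - 1) 1 2.
move=> /(_ _ _ _ x); rewrite mul1r; apply.
- by rewrite sin0 subrr.
- by move=> y; rewrite mul1r real_normK ?num_real// cos_sub1_le.
Qed.

Lemma cos_taylor2_le x : `|cos x - (1 - x ^+ 2 / 2)| <= x ^+ 4.
Proof.
have := @MVT_pow_bound (fun y => cos y - 1 + y * y * 2^-1) (fun y => y - sin y) 1 3.
move=> /(_ _ _ _ x); rewrite mul1r.
have -> : `|x| ^+ 4 = x ^+ 4 by rewrite -[4%N]/(2 * 2)%N !exprM real_normK ?num_real.
have -> : cos x - 1 + x * x * 2^-1 = cos x - (1 - x ^+ 2 / 2) by field.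
apply.
- by move=> y; apply: is_derive_eq; rewrite /GRing.scale/=; field.
- by rewrite cos0 subrr mulr0 mul0r addr0.
- by move=> y; rewrite mul1r distrC sin_subid_le.
Qed.

(** From [1 - x <= exp (- x) <= 1 / (1 + x)], whose outer members differ by [x^2 / (1 + x)]. *)
Lemma expRN_taylor1 x : 0 <= x -> `|expR (- x) - (1 - x)| <= x ^+ 2.
Proof.
move=> x0; have h := expR_ge1Dx (- x).
rewrite ger0_norm ?subr_ge0//.
rewrite expRN lerBlDr; apply: (@le_trans _ _ (1 + x)^-1).
  by rewrite lef_pV2 ?posrE ?expR_gt0 ?expR_ge1Dx// ltr_wpDr.
rewrite -(@ler_pM2r _ (1 + x)) ?mulVf ?gt_eqF//; last 2 first.
- by rewrite ltr_wpDr.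
- by rewrite ltr_wpDr.
rewrite -subr_ge0 (_ : _ - _ = x ^+ 3) ?exprn_ge0//; ring.
Qed.

Lemma pi_le4 : pi <= 4 :> R.
Proof. by have [/andP[_]] := @pihalf_02_cos_pihalf R; rewrite ler_pdivrMr// -natrM. Qed.

(** On [[0, 1/2]] the bound [x - x^3] gives slope [3/4]. Beyond, sine increases, hence is at least
    [sin (1/2) >= 3/8], while [x / 6 <= 1/3] because [pi <= 4]. *)
Lemma sin_ge_linear x : 0 <= x <= pi / 2 -> x / 6 <= sin x.
Proof.
move=> /andP[x0 xpi].
have small (y : R) : 0 <= y <= 1 / 2 -> 3 / 4 * y <= sin y.
  move=> /andP[y0 y1]; have := sin_subid_le y; rewrite ler_norml => /andP[+ _].
  rewrite ger0_norm// => h.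
  have : y ^+ 3 <= y / 4.
    rewrite exprSr mulrC ler_wpM2l// (_ : 4^-1 = (1 / 2) ^+ 2); last by field.
    by rewrite lerXn2r ?nnegrE.
  by move: h => /= h h'; lra.
have [x1|x1] := leP x (1 / 2).
  have := small x; rewrite x0 x1 => /(_ isT); lra.
have p4 := pi_le4.
have h2 : sin (1 / 2) <= sin x :> R.
  apply/ltW; rewrite ltr_sin// in_itv/=; apply/andP; split; lra.
have := small (1 / 2); rewrite lexx divr_ge0// => /(_ isT); lra.
Qed.

End TrigBounds.

(** * Characteristic functions of polynomials *)

Section CharacteristicFunctions.
Context {R : realType}.
Implicit Types (F G : {poly R}) (K t x : R).

Definition cis x : R[i] := (cos x +i* sin x)%C.

Lemma cisD x y : cis (x + y) = cis x * cis y.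
Proof. by apply/eqP; rewrite eq_complex /= cosD sinD eqxx /=; apply/eqP; ring. Qed.

Lemma cis_natM k x : cis (k%:R * x) = cis x ^+ k.
Proof.
elim: k => [|k IH]; first by rewrite mul0r /cis cos0 sin0.
by rewrite -natr1 mulrDl mul1r cisD IH exprSr.
Qed.

Lemma normc_cis x : Normc.normc (cis x) = 1.
Proof. by rewrite /Normc.normc/= cos2Dsin2 sqrtr1. Qed.

Definition charf F K t : R[i] :=
  \sum_(j < size F) (F`_j)%:C%C * cis ((j%:R - K) * t).

Lemma Re_charf F K t : complex.Re (charf F K t) = costr F K t.
Proof. by rewrite Re_sum; apply: eq_bigr => j _; rewrite ReZ. Qed.

Lemma charfE F K t : charf F K t =
  (map_poly (real_complex R) F).[cis t] * cis (- K * t).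
Proof.
rewrite horner_coef size_map_poly mulr_suml; apply: eq_bigr => j _.
by rewrite coef_map/= mulrDl cisD cis_natM mulrA.
Qed.

Lemma charfM F G K L t : charf (F * G) (K + L) t = charf F K t * charf G L t.
Proof.
rewrite !charfE rmorphM hornerM opprD mulrDl cisD.
by rewrite mulrACA.
Qed.

Lemma charfX F K t N : charf (F ^+ N) (N%:R * K) t = charf F K t ^+ N.
Proof.
elim: N => [|N IH].
  rewrite expr0 mul0r expr0 charfE rmorph1 hornerC mul1r oppr0 mul0r.
  by rewrite /cis cos0 sin0.
by rewrite !exprS -IH -charfM -natr1 mulrDl mul1r [K + _]addrC.
Qed.

Lemma charf_poly T (g : nat -> R) K t : charf (\poly_(d < T) g d) K t =
  \sum_(d < T) (g d)%:C%C * cis ((d%:R - K) * t).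
Proof.
rewrite /charf.
have := size_poly T g; set P := \poly_(d < T) g d => sP.
rewrite [RHS](eq_bigr (fun d : 'I_T => (P`_d)%:C%C * cis ((d%:R - K) * t))); last first.
  by move=> d _; rewrite coef_poly ltn_ord.
rewrite (big_ord_widen T (fun d => (P`_d)%:C%C * cis ((d%:R - K) * t)) sP).
rewrite big_mkcond/=; apply: eq_bigr => d _; case: ltnP => // sd.
by rewrite nth_default// mul0r.
Qed.

End CharacteristicFunctions.

(** * Local limit theorem *)

Section LocalLimit.
Context {R : realType}.
Implicit Types (p : nat -> R) (t : R).

(** [s^k] times the [k]-th derivative of the truncated generating function of [p]: the contribution
    of a vertex of patch degree [k]. *)
Definition facpoly p T k : {poly R} := \poly_(d < T) ((d ^_ k)%:R * p d).

(* A truncated lattice law on the class of [r] modulo [q], of variance [s2] and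
   second factorial moment [be], with truncation errors of order [n^-2]; the
   constants [c], [E] and [A] are meant to be uniform in [n]. *)
Record lattice_law (r q : nat) (c E A : R) (n : nat) p T (mu s2 be : R) : Prop :=
  LatticeLaw {
  law_ge0 : forall d, 0 <= p d;
  law_supp : forall d, p d != 0 -> d = r %[mod q];
  law_mom3 : \sum_(d < T) p d * `|d%:R - mu| ^+ 3 <= E;
  law_mom4 : \sum_(d < T) p d * (d%:R - mu) ^+ 4 <= E;
  law_fmom1 : \sum_(d < T) (d ^_ 2)%:R * p d * `|d%:R - mu| <= E;
  law_fmom2 : \sum_(d < T) (d ^_ 2)%:R * p d * (d%:R - mu) ^+ 2 <= E;
  law_fac : forall k, \sum_(d < T) (d ^_ k)%:R * p d <= A ^+ k;
  law_tail0 : `|\sum_(d < T) p d - 1| <= E * n%:R^-1 ^+ 2;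
  law_tail1 : `|\sum_(d < T) p d * (d%:R - mu)| <= E * n%:R^-1 ^+ 2;
  law_tail2 : `|\sum_(d < T) p d * (d%:R - mu) ^+ 2 - s2| <= E * n%:R^-1 ^+ 2;
  law_tailf : `|\sum_(d < T) (d ^_ 2)%:R * p d - be| <= E * n%:R^-1 ^+ 2;
  law_be : 0 <= be <= A ^+ 2;
  law_s2 : 2 * c <= s2 <= E;
  law_decay : forall t, `|t| <= pi / q%:R ->
    Normc.normc (charf (facpoly p T 0) mu t) ^+ 2 <= 1 - 2 * c * t ^+ 2 }.

Lemma facpoly0 p T : facpoly p T 0 = \poly_(d < T) p d.
Proof. by apply/polyP => d; rewrite !coef_poly ffactn0 mul1r. Qed.

Definition coef_class (q r : nat) (F : {poly R}) :=
  forall j, F`_j != 0 -> j = r %[mod q].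

Lemma coef_classM q a b F G : coef_class q a F -> coef_class q b G ->
  coef_class q (a + b) (F * G).
Proof.
move=> Fa Gb j; rewrite coefM => /eqP H.
have [i Hi] : exists i : 'I_j.+1, F`_i * G`_(j - i) != 0.
  apply/existsP; apply: contra_notT H; rewrite negb_exists => /forallP H.
  by apply: big1 => i _; apply/eqP; move: (H i); rewrite negbK.
move: Hi; rewrite mulf_eq0 negb_or => /andP[/Fa Fi /Gb Gi].
by rewrite -(subnKC (leq_ord i)) -modnDm Fi Gi modnDm.
Qed.

Lemma coef_classX q a F N : coef_class q a F -> coef_class q (N * a) (F ^+ N).
Proof.
move=> Fa; elim: N => [|N IH].
  by move=> j; rewrite expr0 coef1 pnatr_eq0 eqb0 negbK => /eqP ->.
by rewrite exprS mulSn; exact: coef_classM.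
Qed.

Lemma normc_sum_le n (f : 'I_n -> R[i]) :
  Normc.normc (\sum_(i < n) f i) <= \sum_(i < n) Normc.normc (f i).
Proof.
elim/big_ind2: _ => // [|a b x y xa yb]; first by rewrite Normc.normc0.
by rewrite (le_trans (normcD_le _ _))// lerD.
Qed.

Lemma gaussEM (a : R) N t : gaussE a t ^+ N = gaussE (a * N%:R) t.
Proof. by rewrite /gaussE -expRM_natl; congr expR; ring. Qed.

Section FixedLaw.
Variables (r q : nat) (c E A : R) (n : nat) (p : nat -> R) (T : nat) (mu s2 be : R).
Hypothesis (c0 : 0 < c) (E1 : 1 <= E) (A1 : 1 <= A) (q0 : (0 < q)%N).
Hypothesis (L : lattice_law r q c E A n p T mu s2 be).

Local Notation B := (facpoly p T).
Local Notation u t := (charf (B 0) mu t).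
Local Notation w t := (charf (B 2) mu t).
Local Notation nrm := (@Normc.normc R).

Let E0 : 0 <= E. Proof. exact: le_trans E1. Qed.
Let s20 : 0 < s2.
Proof. by case/andP: (law_s2 L) => h _; apply: lt_le_trans h; rewrite mulr_gt0. Qed.

Lemma facpoly_class k : coef_class q r (B k).
Proof.
move=> j; rewrite coef_poly; case: ifP => // _; last by rewrite eqxx.
by rewrite mulf_eq0 negb_or => /andP[_ /(law_supp L)].
Qed.

Lemma charf0_le t : `|t| <= pi / q%:R -> nrm (u t) <= gaussE c t.
Proof.
move=> tq; rewrite -(@ler_pXn2r _ 2) ?nnegrE ?normc_ge0 ?expR_ge0//.
rewrite (le_trans (law_decay L tq))// gaussEM /gaussE.
by rewrite (le_trans _ (expR_ge1Dx _))// lerD2l; lra.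
Qed.

Lemma small_arg t : `|t| <= pi / q%:R -> `|t| <= 4.
Proof.
move/le_trans; apply; rewrite ler_pdivrMr ?ltr0n//.
by rewrite (le_trans pi_le4)// ler_peMr// ler1n.
Qed.

(** The cubic term of the exponential is imaginary, so the real part is accurate to order [t^4]. In
    the proof [9] is [1 + 8], with [t^2 / 2 <= 8] on the window. *)
Lemma charf0_Re t : `|t| <= pi / q%:R ->
  `|complex.Re (u t) - gaussE (s2 / 2) t| <= (11 * E ^+ 2) * (t ^+ 4 + n%:R^-1 ^+ 2).
Proof.
move=> /small_arg t4; have p0 := law_ge0 L.
set e := n%:R^-1 ^+ 2; have e0 : 0 <= e by rewrite sqr_ge0.
have t2 : t ^+ 2 <= 16.
  by rewrite -(real_normK (num_real t)) (_ : 16 = 4 ^+ 2 :> R) ?lerXn2r ?nnegrE// -natrX.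
have t40 : 0 <= t ^+ 4 by rewrite (_ : t ^+ 4 = (t ^+ 2) ^+ 2) ?sqr_ge0// -exprM.
rewrite facpoly0 charf_poly Re_sum.
under eq_bigr do rewrite ReZ /=.
set S := \sum_(d < T) _.
pose S0 := \sum_(d < T) p d; pose S2 := \sum_(d < T) p d * (d%:R - mu) ^+ 2.
have h1 : `|S - (S0 - S2 * (t ^+ 2 / 2))| <= E * t ^+ 4.
  rewrite /S /S0 /S2 mulr_suml -!sumrB.
  apply: (@le_trans _ _ (\sum_(d < T) p d * (d%:R - mu) ^+ 4 * t ^+ 4)); last first.
    by rewrite -mulr_suml ler_wpM2r// (law_mom4 L).
  rewrite (le_trans (ler_norm_sum _ _ _))// ler_sum// => d _.
  have -> : p d * cos ((d%:R - mu) * t) - (p d - p d * (d%:R - mu) ^+ 2 * (t ^+ 2 / 2)) =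
    p d * (cos ((d%:R - mu) * t) - (1 - ((d%:R - mu) * t) ^+ 2 / 2)) by field.
  by rewrite normrM ger0_norm// -mulrA ler_wpM2l// -exprMn cos_taylor2_le.
have h2 : `|S0 - S2 * (t ^+ 2 / 2) - (1 - s2 * t ^+ 2 / 2)| <= 9 * E * e.
  have -> : S0 - S2 * (t ^+ 2 / 2) - (1 - s2 * t ^+ 2 / 2) =
     (S0 - 1) - (S2 - s2) * (t ^+ 2 / 2) by field.
  rewrite (le_trans (ler_normB _ _))//.
  have a1 := law_tail0 L; have a2 := law_tail2 L.
  have -> : 9 * E * e = E * e + E * e * 8 by ring.
  apply: lerD => //; rewrite normrM; apply: ler_pM => //.
  rewrite ger0_norm ?divr_ge0 ?sqr_ge0//; lra.
have h3 : `|gaussE (s2 / 2) t - (1 - s2 * t ^+ 2 / 2)| <= E ^+ 2 * t ^+ 4.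
  have := @expRN_taylor1 R (s2 / 2 * t ^+ 2).
  rewrite mulr_ge0 ?divr_ge0 ?sqr_ge0 ?(ltW s20)// => /(_ isT).
  rewrite /gaussE mulNr (_ : s2 / 2 * t ^+ 2 = s2 * t ^+ 2 / 2); last by field.
  move/le_trans; apply.
  have -> : (s2 * t ^+ 2 / 2) ^+ 2 = (s2 / 2) ^+ 2 * t ^+ 4 by field.
  rewrite ler_wpM2r// lerXn2r ?nnegrE ?divr_ge0 ?(ltW s20)//.
  by case/andP: (law_s2 L) => _; move: s20; lra.
have -> : S - gaussE (s2 / 2) t = (S - (S0 - S2 * (t ^+ 2 / 2))) +
  (S0 - S2 * (t ^+ 2 / 2) - (1 - s2 * t ^+ 2 / 2)) - (gaussE (s2 / 2) t - (1 - s2 * t ^+ 2 / 2)) by ring.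
apply: (le_trans (ler_normB _ _)); apply: (le_trans (lerD (ler_normD _ _) (lexx _))).
apply: (le_trans (lerD (lerD h1 h2) h3)).
have EE : E <= E ^+ 2 by rewrite expr2 ler_peMr.
have := ler_wpM2r t40 EE; have := ler_wpM2r e0 EE.
have : 0 <= E ^+ 2 * t ^+ 4 by rewrite mulr_ge0 ?sqr_ge0.
have : 0 <= E ^+ 2 * e by rewrite mulr_ge0 ?sqr_ge0.
lra.
Qed.

Lemma charf0_Im t : `|t| <= pi / q%:R ->
  `|complex.Im (u t)| <= (4 * E) * (`|t| ^+ 3 + n%:R^-1 ^+ 2).
Proof.
move=> /small_arg t4; have p0 := law_ge0 L.
set e := n%:R^-1 ^+ 2; have e0 : 0 <= e by rewrite sqr_ge0.
rewrite facpoly0 charf_poly Im_sum.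
under eq_bigr do rewrite ImZ /=.
set S := \sum_(d < T) _; pose S1 := \sum_(d < T) p d * (d%:R - mu).
have h1 : `|S - S1 * t| <= E * `|t| ^+ 3.
  rewrite /S /S1 mulr_suml -!sumrB.
  apply: (@le_trans _ _ (\sum_(d < T) p d * `|d%:R - mu| ^+ 3 * `|t| ^+ 3)); last first.
    by rewrite -mulr_suml ler_wpM2r ?exprn_ge0// (law_mom3 L).
  rewrite (le_trans (ler_norm_sum _ _ _))// ler_sum// => d _.
  have -> : p d * sin ((d%:R - mu) * t) - p d * (d%:R - mu) * t =
    p d * (sin ((d%:R - mu) * t) - (d%:R - mu) * t) by ring.
  by rewrite normrM ger0_norm// -[leRHS]mulrA ler_wpM2l// -exprMn -normrM sin_subid_le.
have h2 : `|S1 * t| <= E * e * 4.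
  by rewrite normrM; apply: ler_pM => //; exact: (law_tail1 L).
rewrite -[S](subrK (S1 * t)) (le_trans (ler_normD _ _))// (le_trans (lerD h1 h2))//.
have : 0 <= E * `|t| ^+ 3 by rewrite mulr_ge0 ?exprn_ge0.
lra.
Qed.

Lemma charf0_approx t : `|t| <= pi / q%:R ->
  nrm (u t - (gaussE (s2 / 2) t)%:C%C) <= (48 * E ^+ 2) * (`|t| ^+ 3 + n%:R^-1 ^+ 2).
Proof.
move=> tq; apply: (le_trans (normc_le_ReIm _)).
rewrite ReB ImB /= subr0.
apply: (le_trans (lerD (charf0_Re tq) (charf0_Im tq))).
have t4 := small_arg tq.
set e := n%:R^-1 ^+ 2; have e0 : 0 <= e by rewrite sqr_ge0.
have EE : E <= E ^+ 2 by rewrite expr2 ler_peMr.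
have t3 : 0 <= `|t| ^+ 3 by rewrite exprn_ge0.
have tt : t ^+ 4 <= 4 * `|t| ^+ 3.
  have -> : t ^+ 4 = `|t| * `|t| ^+ 3.
    by rewrite -exprS -[4%N]/(2 * 2)%N !exprM real_normK ?num_real.
  by rewrite ler_wpM2r.
have EE0 : 0 <= E ^+ 2 by rewrite sqr_ge0.
have := ler_wpM2l EE0 tt; have := ler_wpM2r t3 EE; have := ler_wpM2r e0 EE.
have : 0 <= E ^+ 2 * e by rewrite mulr_ge0.
lra.
Qed.

Lemma charf2_Re t : `|complex.Re (w t) - be| <= E * (t ^+ 2 + n%:R^-1 ^+ 2).
Proof.
have p0 := law_ge0 L.
rewrite charf_poly Re_sum.
under eq_bigr do rewrite ReZ /=.
set S := \sum_(d < T) _; pose S0 := \sum_(d < T) (d ^_ 2)%:R * p d.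
have h1 : `|S - S0| <= E * t ^+ 2.
  rewrite /S /S0 -!sumrB.
  apply: (@le_trans _ _ (\sum_(d < T) (d ^_ 2)%:R * p d * (d%:R - mu) ^+ 2 * t ^+ 2)); last first.
    by rewrite -mulr_suml ler_wpM2r ?sqr_ge0// (law_fmom2 L).
  rewrite (le_trans (ler_norm_sum _ _ _))// ler_sum// => d _.
  rewrite -{2}[(d ^_ 2)%:R * p d]mulr1 -mulrBr normrM ger0_norm ?mulr_ge0//.
  by rewrite -[leRHS]mulrA ler_wpM2l ?mulr_ge0// -exprMn cos_sub1_le.
rewrite -[S](subrK S0) -addrA (le_trans (ler_normD _ _))// mulrDr lerD//.
exact: (law_tailf L).
Qed.

Lemma charf2_Im t : `|complex.Im (w t)| <= E * `|t|.
Proof.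
have p0 := law_ge0 L.
rewrite charf_poly Im_sum.
under eq_bigr do rewrite ImZ /=.
apply: (@le_trans _ _ (\sum_(d < T) (d ^_ 2)%:R * p d * `|d%:R - mu| * `|t|)); last first.
  by rewrite -mulr_suml ler_wpM2r// (law_fmom1 L).
rewrite (le_trans (ler_norm_sum _ _ _))// ler_sum// => d _.
rewrite normrM ger0_norm ?mulr_ge0// -[leRHS]mulrA ler_wpM2l ?mulr_ge0//.
by rewrite -normrM sin_le_norm.
Qed.

Lemma charf2_le t : nrm (w t) <= A ^+ 2.
Proof.
have p0 := law_ge0 L.
rewrite charf_poly (le_trans (normc_sum_le _))// (le_trans _ (law_fac L 2))//.
apply: ler_sum => d _; rewrite Normc.normcM normc_cis mulr1 normc_real ger0_norm//.
by rewrite mulr_ge0.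
Qed.

Lemma costr_pow_gauss t N h : (0 < N)%N -> (N <= n)%N -> `|t| <= pi / q%:R ->
  `|costr (B 2 ^+ h * B 0 ^+ N) (h%:R * mu + N%:R * mu) t
    - be ^+ h * gaussE (s2 / 2 * N%:R) t| <=
  llt_const c (48 * E ^+ 2) * (A ^+ 2) ^+ h * (1 + h%:R ^+ 2) / N%:R *
    gaussE (c / 2 * N%:R) t.
Proof.
move=> N0 Nn tq; rewrite -Re_charf charfM !charfX -gaussEM.
have EE : E <= E ^+ 2 by rewrite expr2 ler_peMr.
have E2 : 1 <= E ^+ 2 by rewrite (le_trans E1).
have C1 : 1 <= 48 * E ^+ 2 by lra.
have nN : n%:R^-1 ^+ 2 <= N%:R^-1 ^+ 2 :> R.
  rewrite lerXn2r ?nnegrE ?invr_ge0// lef_pV2 ?posrE ?ltr0n ?ler_nat//.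
  exact: leq_trans Nn.
have mon (C a : R) x : 0 <= a -> 0 <= C -> C <= 48 * E ^+ 2 -> x <= C * (a + n%:R^-1 ^+ 2) ->
    x <= 48 * E ^+ 2 * (a + N%:R^-1 ^+ 2).
  move=> a0 C0 CE /le_trans; apply; apply: ler_pM => //.
    by rewrite addr_ge0// sqr_ge0.
  by rewrite lerD2l.
apply: Re_pow_mul_gauss => //.
- by rewrite -[leLHS](expr1n _ 2) lerXn2r ?nnegrE// (le_trans _ A1).
- exact: small_arg tq.
- exact: charf0_le.
- rewrite expR_ge0/= ler_expR ler_wpM2r ?sqr_ge0// lerN2.
  by case/andP: (law_s2 L); lra.
- exact: charf2_le.
- by case/andP: (law_be L) => b0 bA; rewrite ger0_norm.
- by apply: mon (charf2_Re t) => //; [exact: sqr_ge0|lra].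
- by rewrite (le_trans (charf2_Im t))// ler_wpM2r//; lra.
- have t40 : 0 <= t ^+ 4 by rewrite (_ : t ^+ 4 = (t ^+ 2) ^+ 2) ?sqr_ge0// -exprM.
  by apply: mon (charf0_Re tq) => //; lra.
- by apply: mon (charf0_approx tq) => //; rewrite ?exprn_ge0//; lra.
Qed.

(** Recentring multiplies the characteristic function by a number of modulus one, so its decay can
    be used with centre [k / N] for every [k]. Unless the coefficient vanishes, [k] lies in the
    residue class of the exponents, as Fourier inversion demands. *)
Lemma coef_pow_le N k : (0 < N)%N ->
  `|(B 0 ^+ N)`_k| <= q%:R / (2 * pi) * Num.sqrt (pi / c) / Num.sqrt N%:R.
Proof.
move=> N0; have n0 : 0 < N%:R :> R by rewrite ltr0n.
have C0 : 0 <= q%:R / (2 * pi) * Num.sqrt (pi / c) / Num.sqrt N%:R.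
  by rewrite !mulr_ge0 ?invr_ge0 ?mulr_ge0 ?pi_ge0.
have cl : coef_class q (N * r) (B 0 ^+ N) by apply: coef_classX; exact: facpoly_class.
have [->|Fk] := eqVneq (B 0 ^+ N)`_k 0; first by rewrite normr0.
have := @fourier_coef_le R (B 0 ^+ N) k q 1 (c * N%:R) q0.
move=> /(_ _ (mulr_gt0 c0 n0)); rewrite mul1r.
have -> : pi / (c * N%:R) = pi / c / N%:R by rewrite invfM mulrA.
rewrite sqrtrM ?divr_ge0 ?pi_ge0 ?(ltW c0)// sqrtrV ?(ltW n0)// mulrA; apply.
  by move=> j /cl ->; rewrite (cl k Fk).
move=> t tq; rewrite mul1r -Re_charf.
have -> : k%:R = N%:R * (k%:R / N%:R) :> R by field; rewrite gt_eqF.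
rewrite charfX (le_trans (Re_normc_le _))// normc_exp -gaussEM lerXn2r ?nnegrE ?normc_ge0 ?expR_ge0//.
have -> : nrm (charf (B 0) (k%:R / N%:R) t) = nrm (u t); last exact: charf0_le.
by rewrite !charfE !Normc.normcM !normc_cis.
Qed.

(** The three summands account for the pointwise error, the Gaussian tail outside the window
    (through [exp (- x) <= 1 / x]), and the passage from [N = n - h] to [n] under the square
    root. *)
Definition llt_error : R := q%:R / (2 * pi) * Num.sqrt (2 * pi / c) *
  (llt_const c (48 * E ^+ 2) + 2 * q%:R ^+ 2 / (c * pi ^+ 2) + 1).

Let scaled_sqrt (x y : R) N : (0 < N)%N -> 0 < y -> 0 <= x ->
  Num.sqrt (x / (y * N%:R)) = Num.sqrt (x / y) / Num.sqrt N%:R.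
Proof.
move=> N0 y0 x0; rewrite invfM mulrA sqrtrM ?divr_ge0// ?(ltW y0)//.
by rewrite sqrtrV.
Qed.

(** The [h] factors [B 2] only contribute the constant [be] near [t = 0]; the Gaussian comes from
    the other [N]. Since [h <= N] gives [n <= 2 N], writing the error in terms of [n] costs the
    factor [4]. *)
Lemma coef_pow_gauss N h K : (0 < N)%N -> (h + N)%N = n -> (h <= N)%N ->
  K%:R = n%:R * mu -> K = n * r %[mod q] ->
  `|(B 2 ^+ h * B 0 ^+ N)`_K - be ^+ h * (q%:R / (2 * pi) * Num.sqrt (2 * pi / (s2 * n%:R)))|
  <= 4 * llt_error * (A ^+ 2) ^+ h * (1 + h%:R ^+ 2) / (n%:R * Num.sqrt n%:R).
Proof.
move=> N0 hNn hN Kmu Kcl.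
have pi0 := pi_gt0 R; have pi0' := ltW pi0.
have Nr : 0 < N%:R :> R by rewrite ltr0n.
have n0 : (0 < n)%N by rewrite -hNn addn_gt0 N0 orbT.
have nr : 0 < n%:R :> R by rewrite ltr0n.
have Nn : (N <= n)%N by rewrite -hNn leq_addl.
have qr : 0 < q%:R :> R by rewrite ltr0n.
case/andP: (law_s2 L) => s2c s2E.
case/andP: (law_be L) => be0 beA.
have c0' := c0; have cs2 : c <= s2 by lra.
have cl : forall j, (B 2 ^+ h * B 0 ^+ N)`_j != 0 -> j = K %[mod q].
  have cl1 : coef_class q (h * r + N * r) (B 2 ^+ h * B 0 ^+ N).
    by apply: coef_classM; apply: coef_classX; exact: facpoly_class.
  by move=> j /cl1 ->; rewrite -mulnDl hNn Kcl.
have Hc : 0 < c / 2 * N%:R by rewrite mulr_gt0// divr_gt0.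
have Ha : 0 < s2 / 2 * N%:R by rewrite mulr_gt0// divr_gt0.
set Ah := (A ^+ 2) ^+ h; set H := 1 + h%:R ^+ 2 : R.
set l := llt_const c (48 * E ^+ 2).
have := fourier_coef_gauss q0 cl Hc Ha (B := be ^+ h) (eps := l * Ah * H / N%:R).
have -> : K%:R = h%:R * mu + N%:R * mu by rewrite Kmu -hNn natrD mulrDl.
move=> /(_ (fun t tq => costr_pow_gauss h N0 Nn tq)).
rewrite scaled_sqrt ?divr_gt0//.
have -> : s2 / 2 * N%:R / 2 = s2 / 4 * N%:R by field.
rewrite !scaled_sqrt ?divr_gt0//; last by rewrite mulr_ge0.
set sN := Num.sqrt N%:R; set sn := Num.sqrt n%:R.
have sN0 : 0 < sN by rewrite sqrtr_gt0.
have sn0 : 0 < sn by rewrite sqrtr_gt0.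
have sNN : sN ^+ 2 = N%:R by rewrite sqr_sqrtr// ltW.
have snn : sn ^+ 2 = n%:R by rewrite sqr_sqrtr// ltW.
have -> : pi / (s2 / 2) = 2 * pi / s2 by rewrite invfM invrK; ring.
have -> : pi / (c / 2) = 2 * pi / c by rewrite invfM invrK; ring.
set Q := q%:R / (2 * pi); have Q0 : 0 < Q by rewrite divr_gt0// mulr_gt0.
set sc := Num.sqrt (2 * pi / c).
have sc0 : 0 <= sc by exact: sqrtr_ge0.
have l0 : 0 <= l.
  have k0 : 0 <= 2 / c by rewrite divr_ge0// ltW.
  rewrite /l /llt_const divr_ge0 ?sqr_ge0// mulr_ge0 ?sqr_ge0//.
  have k2 := exprn_ge0 2 k0; have k3 := exprn_ge0 3 k0; lra.
have Ah0 : 0 <= Ah by rewrite !exprn_ge0// (le_trans _ A1).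
have H1 : 1 <= H by rewrite lerDl sqr_ge0.
have hH : h%:R <= H.
  rewrite /H; case: (h) => [|k]; first by rewrite expr0n addr0.
  by rewrite (le_trans (_ : _ <= k.+1%:R ^+ 2)) ?lerDr// expr2 ler_peMr// ler1n.
have beh : `|be ^+ h| <= Ah.
  by rewrite ger0_norm ?exprn_ge0// lerXn2r ?nnegrE// (le_trans be0).
have s2c' : Num.sqrt (2 * pi / s2) <= sc.
  rewrite ler_wsqrtr// ler_wpM2l ?mulr_ge0// lef_pV2 ?posrE//; lra.
have s4c : Num.sqrt (pi / (s2 / 4)) <= sc.
  rewrite ler_wsqrtr// invfM invrK.
  have -> : pi * (s2^-1 * 4) = 2 * pi * (2 / s2) by ring.
  rewrite ler_wpM2l ?mulr_ge0// ler_pdivrMr// mulrC ler_pdivlMr//; lra.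
have ex : expR (- (s2 / 4 * N%:R) * (pi / q%:R) ^+ 2) <=
    2 * q%:R ^+ 2 / (c * pi ^+ 2) / N%:R.
  rewrite mulNr expRN -[leRHS]invrK lef_pV2 ?posrE ?expR_gt0//; last first.
    by rewrite invr_gt0 !divr_gt0 ?mulr_gt0 ?exprn_gt0.
  rewrite (le_trans _ (expR_ge1Dx _))//.
  have -> : (2 * q%:R ^+ 2 / (c * pi ^+ 2) / N%:R)^-1 = c / 2 * N%:R * (pi / q%:R) ^+ 2.
    by rewrite !invfM !invrK !expr2; move: (@pi R) (q%:R^-1 : R) => P q2; ring.
  by rewrite ler_wpDl// ler_wpM2r ?sqr_ge0// ler_wpM2r//; lra.
set G := (_ - _); set RHS1 := (X in _ <= X) => main.
have R1 : RHS1 <= Q * (sc * (l + 2 * q%:R ^+ 2 / (c * pi ^+ 2))) * Ah * H / (N%:R * sN).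
  rewrite /RHS1.
  have e1 : l * Ah * H / N%:R * (sc / sN) = sc * l * Ah * H / (N%:R * sN).
    by rewrite invfM; ring.
  have e2 : `|be ^+ h| * (expR (- (s2 / 4 * N%:R) * (pi / q%:R) ^+ 2) *
      (Num.sqrt (pi / (s2 / 4)) / sN)) <= Ah * H * (2 * q%:R ^+ 2 / (c * pi ^+ 2) / N%:R * (sc / sN)).
    apply: ler_pM => //.
    - by rewrite mulr_ge0 ?expR_ge0// divr_ge0// ltW.
    - by rewrite (le_trans beh)// ler_peMr.
    - apply: ler_pM; rewrite ?expR_ge0 ?divr_ge0 ?(ltW sN0)//.
      by rewrite ler_wpM2r// invr_ge0 ltW.
  rewrite e1; apply: (le_trans (ler_wpM2l (ltW Q0) (lerD (lexx _) e2))).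
  by rewrite le_eqVlt; apply/orP; left; apply/eqP; rewrite !invfM; ring.
have R2 : `|be ^+ h * (Q * (Num.sqrt (2 * pi / s2) / sN)) - be ^+ h * (Q * (Num.sqrt (2 * pi / s2) / sn))|
    <= Q * (sc * 1) * Ah * H / (N%:R * sN).
  have -> : be ^+ h * (Q * (Num.sqrt (2 * pi / s2) / sN)) - be ^+ h * (Q * (Num.sqrt (2 * pi / s2) / sn))
    = be ^+ h * (Q * Num.sqrt (2 * pi / s2)) * (sN^-1 - sn^-1) by ring.
  have sNn : sN <= sn by rewrite ler_wsqrtr// ler_nat.
  have d0 : 0 <= sN^-1 - sn^-1 by rewrite subr_ge0 lef_pV2 ?posrE.
  have d1 : sN^-1 - sn^-1 <= h%:R / (N%:R * sN).
    rewrite ler_pdivlMr ?mulr_gt0//.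
    have -> : (sN^-1 - sn^-1) * (N%:R * sN) = (sn - sN) * (N%:R / sn).
      by rewrite mulrBl mulrBl mulrC mulrA mulfK ?gt_eqF// mulrCA divff ?gt_eqF// mulr1; ring.
    have -> : h%:R = (sn - sN) * (sn + sN).
      rewrite -subr_sqr snn sNN -hNn natrD; ring.
    rewrite ler_wpM2l ?subr_ge0// ler_pdivrMr// -sNN expr2.
    by rewrite (le_trans (ler_wpM2l (ltW sN0) sNn))// ler_wpM2r ?(ltW sn0)// lerDr ltW.
  rewrite 2!normrM (ger0_norm d0) normrM (ger0_norm (ltW Q0)) (ger0_norm (sqrtr_ge0 _))//.
  have -> : Q * (sc * 1) * Ah * H / (N%:R * sN) = Ah * (Q * sc) * (H / (N%:R * sN)) by ring.
  apply: ler_pM => //.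
  - by apply: mulr_ge0 => //; apply: mulr_ge0; [exact: ltW|exact: sqrtr_ge0].
  - by apply: ler_pM => //; [apply: mulr_ge0; [exact: ltW|exact: sqrtr_ge0]|rewrite ler_wpM2l// ltW].
  - by apply: (le_trans d1); rewrite ler_wpM2r// invr_ge0 mulr_ge0// ltW.
have R3 : (N%:R * sN)^-1 <= 4 / (n%:R * sn).
  rewrite ler_pdivlMr ?mulr_gt0// mulrC ler_pdivrMr ?mulr_gt0//.
  have a1 : n%:R <= 2 * N%:R :> R by rewrite -natrM ler_nat -hNn; move: hN; clear; lia.
  have a2 : sn <= 2 * sN.
    rewrite -(@ler_pXn2r _ 2) ?nnegrE ?mulr_ge0 ?ltW// exprMn snn sNN.
    by apply: (le_lt_trans a1); rewrite ltr_pM2r// -natrX ltr_nat.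
  have -> : 4 * (N%:R * sN) = 2 * N%:R * (2 * sN) by ring.
  by apply: ler_pM; rewrite // ltW.
have GE : (B 2 ^+ h * B 0 ^+ N)`_K - be ^+ h * (Q * (Num.sqrt (2 * pi / s2) / sn)) =
  G + (be ^+ h * (Q * (Num.sqrt (2 * pi / s2) / sN)) - be ^+ h * (Q * (Num.sqrt (2 * pi / s2) / sn))).
  by rewrite /G; ring.
rewrite GE (le_trans (ler_normD _ _))// (le_trans (lerD (le_trans main R1) R2))//.
rewrite -!mulrDl -!mulrDr -/sc.
apply: (@le_trans _ _ (llt_error * Ah * H * (4 / (n%:R * sn)))); last first.
  by rewrite le_eqVlt; apply/orP; left; apply/eqP; ring.
have -> : llt_error = Q * (sc * (l + 2 * q%:R ^+ 2 / (c * pi ^+ 2) + 1)).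
  by rewrite /llt_error -/l -/Q -/sc; ring.
have k0 : 0 <= 2 * q%:R ^+ 2 / (c * pi ^+ 2).
  apply: divr_ge0; apply: mulr_ge0 => //; [exact: ltW|exact: exprn_ge0].
apply: ler_wpM2l => //; apply: mulr_ge0; last exact: le_trans H1.
apply: mulr_ge0 => //; apply: mulr_ge0; first exact: ltW.
apply: mulr_ge0 => //; apply: addr_ge0 => //; exact: addr_ge0.
Qed.

End FixedLaw.
End LocalLimit.

(** * Patchwork expansion of the graph count *)

Section TruncatedSeries.
Context {R : realType}.
Implicit Types (P Q : {poly R}) (x y z : R).

(** Congruence modulo [X^(m+1)]: power series are handled through truncations such as [exptr], as
    only coefficients up to the bound are read. *)
Definition eqpm m P Q := forall k, (k <= m)%N -> P`_k = Q`_k.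

Lemma eqpm_trans m P Q S : eqpm m P Q -> eqpm m Q S -> eqpm m P S.
Proof. by move=> PQ QS k km; rewrite PQ// QS. Qed.

Lemma eqpmM m P P' Q Q' : eqpm m P P' -> eqpm m Q Q' -> eqpm m (P * Q) (P' * Q').
Proof.
move=> PP QQ k km; rewrite !coefM; apply: eq_bigr => i _.
by rewrite PP ?QQ// (leq_trans _ km)// ?leq_subr// leq_ord.
Qed.

Lemma eqpm_prod m (I : finType) (P Q : I -> {poly R}) :
  (forall i, eqpm m (P i) (Q i)) -> eqpm m (\prod_i P i) (\prod_i Q i).
Proof. by move=> PQ; elim/big_ind2: _ => // a b c d; exact: eqpmM. Qed.

Definition exptr m y : {poly R} := \poly_(k < m.+1) (y ^+ k / k`!%:R).

Lemma coef_exptr m y k : (k <= m)%N -> (exptr m y)`_k = y ^+ k / k`!%:R.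
Proof. by move=> km; rewrite coef_poly ltnS km. Qed.

Lemma natr_fact_neq0 k : k`!%:R != 0 :> R.
Proof. by rewrite pnatr_eq0 -lt0n fact_gt0. Qed.

Lemma exptrD m y z : eqpm m (exptr m y * exptr m z) (exptr m (y + z)).
Proof.
move=> k km; rewrite coefM coef_exptr// [y + z]addrC exprDn mulr_suml.
apply: eq_bigr => i _; have ik := leq_ord i.
rewrite !coef_exptr ?(leq_trans _ km) ?leq_subr//.
have /(congr1 (fun n => n%:R : R)) := bin_fact ik.
rewrite !natrM => <-; rewrite -mulr_natr.
have C0 : 'C(k, i)%:R != 0 :> R by rewrite pnatr_eq0 -lt0n bin_gt0.
by field; rewrite C0 !natr_fact_neq0.
Qed.

Lemma exptr0 m : eqpm m (exptr m 0) 1.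
Proof.
move=> k km; rewrite coef_exptr// coef1 expr0n; case: k km => [|k] km.
  by rewrite divr1.
by rewrite mul0r.
Qed.

Lemma exptr_prod m (I : finType) (y : I -> R) :
  eqpm m (\prod_i exptr m (y i)) (exptr m (\sum_i y i)).
Proof.
elim/big_ind2: _ => [|P a Q b Pa Qb|//].
  by move=> k km; rewrite (exptr0 km).
exact: eqpm_trans (eqpmM Pa Qb) (exptrD _ _).
Qed.

Lemma coef_prod_poly (I : finType) K (a : I -> nat -> R) k :
  (\prod_i \poly_(d < K) a i d)`_k =
  \sum_(g : {ffun I -> 'I_K} | (\sum_i g i)%N == k) \prod_i a i (g i).
Proof.
under eq_bigr do rewrite poly_def.
rewrite bigA_distr_bigA /= coef_sum [RHS]big_mkcond /=; apply: eq_bigr => g _.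
have -> : \prod_i (a i (g i) *: 'X^(g i)) = (\prod_i a i (g i)) *: 'X^(\sum_i g i)%N :> {poly R}.
  by rewrite scaler_prod -expr_sum.
by rewrite coefZ coefXn eq_sym; case: eqP; rewrite ?mulr1 ?mulr0.
Qed.

End TruncatedSeries.

Section PatchCoefficients.
Context {R : realType}.
Variable n : nat.
Local Notation pair := ('I_n * 'I_n)%type.

(* The pair [e] stands for an edge when [e.1 < e.2], for a loop when
   [e.1 = e.2], and is inert otherwise.  [patchc e k] is the coefficient of
   [y^k] in [(1 + y) exp (- y)] for an edge and in [exp (- y / 2)] for a loop. *)
Definition patchc (e : pair) (k : nat) : R :=
  if (e.1 < e.2)%N then (- 1) ^+ k * (1 - k%:R) / k`!%:R
  else if e.1 == e.2 then (- (1 / 2)) ^+ k / k`!%:R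
  else (k == 0%N)%:R.

Definition patchw (e : pair) : R :=
  if (e.1 < e.2)%N then 1 else if e.1 == e.2 then 1 / 2 else 0.

(** For a loop or an inert pair the left side is [1]: the loop factors [exp (- y / 2) exp (y / 2)]
    are inserted only to make the exponents add up to half a square. *)
Lemma patch_exptr m (e : pair) (y : R) :
  eqpm m (1 + (if (e.1 < e.2)%N then y else 0) *: 'X)
    ((\poly_(k < m.+1) (patchc e k * y ^+ k)) * exptr m (patchw e * y)).
Proof.
rewrite /patchc /patchw; case: ifP => _; last case: ifP => _.
- rewrite mul1r; set C := \poly_(_ < _) _.
  have CE : eqpm m C ((1 + y *: 'X) * exptr m (- y)).
    move=> k km; rewrite mulrDl mul1r -scalerAl coefD coefZ coefXM coef_exptr//.
    rewrite coef_poly ltnS km; case: k km => [|k] km.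
      by rewrite !expr0 mulr0 subr0 !mulr1 addr0.
    rewrite coef_exptr 1?ltnW// factS natrM -natr1 -[- y]mulN1r !exprMn !exprS.
    have := natr_fact_neq0 (R := R) k; have : k%:R + 1 != 0 :> R by rewrite natr1 pnatr_eq0.
    by move=> /= a b; field; rewrite a b.
  move=> k km; rewrite (eqpmM CE (fun _ _ => erefl) km) -mulrA.
  rewrite -[in LHS](mulr1 (1 + y *: 'X)).
  apply: eqpmM km => // j jm.
  by rewrite (exptrD (- y) y jm) addNr (exptr0 jm).
- rewrite scale0r addr0; set C := \poly_(_ < _) _.
  have -> : C = exptr m (- (1 / 2) * y).
    by apply/polyP => k; rewrite !coef_poly; case: ifP => //; rewrite exprMn mulrAC.
  by move=> k km; rewrite (exptrD _ _ km) mulNr addNr (exptr0 km).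
- rewrite scale0r addr0 mul0r => k km.
  rewrite (eqpmM (P' := 1) (Q' := 1) _ _ km) ?mulr1//; last exact: exptr0.
  move=> j jm; rewrite coef_poly ltnS jm coef1.
  by case: j jm => [|j] jm; rewrite ?mul0r// mulr1.
Qed.

Definition fsum m (f : {ffun pair -> 'I_m.+1}) : nat := \sum_e f e.

(** The patch takes [fsum f] of the degree [m] and the exponential of half the square takes the
    rest, whence the power [m - fsum f] and its factorial. *)
Lemma coef_prod_edges m (x : 'I_n -> R) :
  (\prod_(e : pair) (1 + (if (e.1 < e.2)%N then x e.1 * x e.2 else 0) *: 'X))`_m =
  \sum_(f : {ffun pair -> 'I_m.+1} | (fsum f <= m)%N)
    (\prod_e (patchc e (f e) * (x e.1 * x e.2) ^+ f e)) *
    (((\sum_v x v) ^+ 2 / 2) ^+ (m - fsum f) / (m - fsum f)`!%:R).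
Proof.
rewrite (eqpm_prod (fun e => @patch_exptr m e (x e.1 * x e.2)) (leqnn m)).
rewrite big_split /=.
rewrite (eqpmM (fun _ _ => erefl) (exptr_prod (m := m) (fun e : pair => patchw e * (x e.1 * x e.2))) (leqnn m)).
have -> : \sum_(e : pair) patchw e * (x e.1 * x e.2) = (\sum_v x v) ^+ 2 / 2.
  pose F (i j : 'I_n) : R := (if (i < j)%N then x i * x j else 0) + (if i == j then x i * x j / 2 else 0).
  have -> : \sum_(e : pair) patchw e * (x e.1 * x e.2) = \sum_i \sum_j F i j.
    rewrite pair_big /=; apply: eq_bigr => -[i j] _ /=; rewrite /patchw /F /=.
    have [ij|ij|ij] := ltngtP i j.
    - by rewrite -val_eqE/= (ltn_eqF ij) addr0 mul1r.
    - by rewrite -val_eqE/= (gtn_eqF ij) addr0 mul0r.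
    - by rewrite -val_eqE/= ij eqxx add0r; field.
  have -> : (\sum_v x v) ^+ 2 / 2 = \sum_i \sum_j (x i * x j / 2).
    rewrite expr2 mulr_suml mulr_suml; apply: eq_bigr => i _.
    by rewrite mulr_sumr mulr_suml.
  (* [F] plus its transpose is the full square: off the diagonal exactly one of the two orders
     carries [x i * x j], and on it two halves meet. *)
  have h2 : \sum_i \sum_j F i j + \sum_i \sum_j F i j = \sum_i \sum_j (x i * x j).
    rewrite {2}exchange_big -big_split; apply: eq_bigr => i _ /=.
    rewrite -big_split; apply: eq_bigr => j _ /=; rewrite /F.
    have [ij|ij|ij] := ltngtP i j.
    - by rewrite -!val_eqE/= (ltn_eqF ij) (gtn_eqF ij) !addr0.
    - by rewrite -!val_eqE/= (ltn_eqF ij) (gtn_eqF ij) !addr0 add0r mulrC.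
    - have -> : i = j by apply/val_inj.
      by rewrite eqxx !add0r; field.
  have -> : \sum_i \sum_j (x i * x j / 2) = (\sum_i \sum_j (x i * x j)) / 2.
    by rewrite mulr_suml; apply: eq_bigr => i _; rewrite mulr_suml.
  by rewrite -h2; field.
rewrite coefM.
have E := coef_prod_poly m.+1 (fun (e : pair) k => patchc e k * (x e.1 * x e.2) ^+ k).
transitivity (\sum_(i < m.+1) \sum_(f : {ffun pair -> 'I_m.+1} | fsum f == i)
  ((\prod_e (patchc e (f e) * (x e.1 * x e.2) ^+ f e)) *
   (((\sum_v x v) ^+ 2 / 2) ^+ (m - i) / (m - i)`!%:R))).
  apply: eq_bigr => i _; rewrite coef_exptr ?leq_subr// -mulr_suml; congr (_ * _).
  exact: E.
rewrite (exchange_big_dep (fun f : {ffun pair -> 'I_m.+1} => (fsum f <= m)%N)) /=; last first.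
  by move=> i f _ /eqP ->; exact: leq_ord.
apply: eq_bigr => f fm.
have fm' : (fsum f < m.+1)%N by [].
by rewrite (big_pred1 (Ordinal fm'))// => i; rewrite eq_sym -val_eqE.
Qed.

End PatchCoefficients.

(** * Graphs encoded as sets of increasing pairs *)

Section GraphsAsPairs.
Variable n : nat.
Local Notation pair := ('I_n * 'I_n)%type.

(** A loop at [v] counts twice, so that the degrees of a patch sum to twice its size. *)
Definition incid (v : 'I_n) (e : pair) : nat := (e.1 == v) + (e.2 == v).

Definition edge (e : pair) : {set 'I_n} := [set e.1; e.2]%SET.

Lemma edge_inj (e e' : pair) : (e.1 < e.2)%N -> (e'.1 < e'.2)%N ->
  edge e = edge e' -> e = e'.
Proof.
case: e e' => [i j] [k l] /= ij kl /setP E.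
have := E i; have := E j; have := E k; have := E l.
rewrite !inE !eqxx /= ?orbT => h1 h2 h3 h4.
have {}h1 : (l == i) || (l == j) by rewrite h1.
have {}h2 : (k == i) || (k == j) by rewrite h2.
case/orP: h1 => /eqP e1; case/orP: h2 => /eqP e2; subst => //.
- by rewrite ltnn in kl.
- by move: (ltn_trans ij kl); rewrite ltnn.
- by rewrite ltnn in kl.
Qed.

Lemma card_edge (e : pair) : (e.1 < e.2)%N -> #|edge e| = 2%N.
Proof. by move=> e12; rewrite cards2 -val_eqE /= ltn_eqF. Qed.

Lemma mem_edge (v : 'I_n) (e : pair) : (e.1 < e.2)%N -> incid v e = (v \in edge e).
Proof.
move=> e12; rewrite !inE /incid (eq_sym v) (eq_sym v).
have [ev|//] := eqVneq e.1 v; have [e'v|//] := eqVneq e.2 v.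
by move: e12; rewrite ev e'v ltnn.
Qed.

Definition ltpairs : {set pair} := [set e : pair | (e.1 < e.2)%N]%SET.

Definition SGpairs (D : set nat) (m : nat) : {set {set pair}} :=
  [set E : {set pair} | [&& E \subset ltpairs, #|E| == m &
    [forall v : 'I_n, (\sum_(e in E) incid v e)%N \in D]]]%SET.

Lemma edge_inj_in (E : {set pair}) : E \subset ltpairs -> {in E &, injective edge}.
Proof.
move=> /fintype.subsetP EL e e' /EL + /EL; rewrite !inE => h h'; exact: edge_inj.
Qed.

Lemma degree_edges (E : {set pair}) v : E \subset ltpairs ->
  degree (edge @: E)%SET v = (\sum_(e in E) incid v e)%N.
Proof.
move=> EL; rewrite /degree.
have -> : [set e in edge @: E | v \in e]%SET = (edge @: [set e in E | v \in edge e])%SET.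
  apply/setP => S; rewrite inE; apply/andP/imsetP.
    by case=> /imsetP[e eE ->] ve; exists e; rewrite // inE eE.
  by case=> e; rewrite inE => /andP[eE ve] ->; rewrite ve; split => //; exact: imset_f.
rewrite card_in_imset; last first.
  move=> e e'; rewrite !inE => /andP[h _] /andP[h' _]; exact: (edge_inj_in EL).
rewrite -sum1_card [LHS]big_mkcond [RHS]big_mkcond /=; apply: eq_bigr => e _.
rewrite inE; case: ifPn => [/andP[eE ve]|]; rewrite ?eE.
  by rewrite mem_edge ?ve//; move/fintype.subsetP: EL => /(_ _ eE); rewrite inE.
rewrite negb_and; case: ifP => //= eE /negPf ve.
by rewrite mem_edge ?ve//; move/fintype.subsetP: EL => /(_ _ eE); rewrite inE.
Qed.

Lemma SG_pairs D m : SG D n m = ((fun E : {set pair} => edge @: E) @: SGpairs D m)%SET.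
Proof.
apply/setP => S; apply/idP/imsetP; last first.
  case=> E; rewrite !inE => /and3P[EL /eqP Em /forallP degE] ->; apply/and3P; split.
  - apply/forall_inP => _ /imsetP[e eE ->].
    by move/fintype.subsetP: EL => /(_ _ eE); rewrite inE => /card_edge ->.
  - by rewrite card_in_imset ?Em//; exact: edge_inj_in.
  - by apply/forallP => v; rewrite degree_edges.
rewrite inE => /and3P[/forall_inP S2 Sm /forallP degS].
pose E := [set e : pair | (e.1 < e.2)%N && (edge e \in S)]%SET.
have EL : E \subset ltpairs by apply/fintype.subsetP => e; rewrite !inE => /andP[].
have SE : S = (edge @: E)%SET.
  apply/setP => s; apply/idP/imsetP; last by case=> e; rewrite inE => /andP[_ eS ->].
  move=> sS; have /cards2P[i [j [ij sij]]] := S2 s sS.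
  have : (i != j :> nat) by rewrite val_eqE.
  rewrite neq_ltn => /orP[lij|lij].
  - by exists (i, j) => //; rewrite inE /= lij /edge/= -sij.
  - have sji : s = edge (j, i) by rewrite sij /edge /= finset.setUC.
    by exists (j, i) => //; rewrite inE /= lij -sji.
exists E => //; rewrite inE EL /=; apply/andP; split.
  by rewrite -(card_in_imset (edge_inj_in EL)) -SE.
by apply/forallP => v; rewrite -degree_edges// -SE.
Qed.

Lemma card_SG D m : #|SG D n m| = #|SGpairs D m|.
Proof.
rewrite SG_pairs card_in_imset// => E E'; rewrite !inE => /and3P[EL _ _] /and3P[EL' _ _] EE.
apply/setP => e; apply/idP/idP => eE.
  have : edge e \in (edge @: E')%SET by rewrite -EE; exact: imset_f.
  case/imsetP => e' e'E /edge_inj -> //.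
    by move/fintype.subsetP: EL => /(_ _ eE); rewrite inE.
  by move/fintype.subsetP: EL' => /(_ _ e'E); rewrite inE.
have : edge e \in (edge @: E)%SET by rewrite EE; exact: imset_f.
case/imsetP => e' e'E /edge_inj -> //.
  by move/fintype.subsetP: EL' => /(_ _ eE); rewrite inE.
by move/fintype.subsetP: EL => /(_ _ e'E); rewrite inE.
Qed.

Lemma sum_incid (e : pair) : (\sum_v incid v e = 2)%N.
Proof.
have one (i : 'I_n) : (\sum_v (i == v) = 1)%N.
  by rewrite (bigD1 i)//= eqxx big1// => v vi; rewrite eq_sym (negPf vi).
by rewrite big_split /= !one.
Qed.

End GraphsAsPairs.

(** * Interpolation functional and exact patch formula *)

Section Interpolation.
Context {R : realType}.

(* For [t d = (d \in D)], the condition that a degree lies in [D] becomes linear,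
   so that it can be applied termwise to an expansion. *)
Lemma node_functional K (t : nat -> R) : exists lam : 'I_K -> R,
  forall d, (d < K)%N -> \sum_(a < K) lam a * a%:R ^+ d = t d.
Proof.
pose a : 'rV[R]_K := \row_(i < K) i%:R.
pose V : 'M[R]_K := Vandermonde K a.
have Vu : V \in unitmx.
  rewrite unitmxE det_Vandermonde unitfE; apply/prodf_neq0 => i _.
  apply/prodf_neq0 => j ij; rewrite !mxE subr_eq0 eqr_nat.
  by rewrite gtn_eqF.
pose b : 'cV[R]_K := \col_(d < K) t d.
exists (fun i => (invmx V *m b) i ord0) => d dK.
have : V *m (invmx V *m b) = b by rewrite mulmxA mulmxV// mul1mx.
move=> /matrixP /(_ (Ordinal dK) ord0); rewrite !mxE => <-.
by apply: eq_bigr => i _; rewrite !mxE mulrC.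
Qed.

End Interpolation.

Section GraphCount.
Context {R : realType}.
Variable n : nat.
Local Notation pair := ('I_n * 'I_n)%type.
Implicit Types (x : 'I_n -> R).

Definition pdeg m (f : {ffun pair -> 'I_m.+1}) (v : 'I_n) : nat :=
  \sum_e f e * incid v e.

Lemma sum_pdeg m (f : {ffun pair -> 'I_m.+1}) : (\sum_v pdeg f v = 2 * fsum f)%N.
Proof.
rewrite exchange_big /= /fsum big_distrr /=; apply: eq_bigr => e _.
by rewrite -big_distrr /= sum_incid mulnC.
Qed.

Lemma pdeg_le m (f : {ffun pair -> 'I_m.+1}) v : (pdeg f v <= 2 * fsum f)%N.
Proof. by rewrite -sum_pdeg (bigD1 v)//= leq_addr. Qed.

Lemma monomial_pair x (e : pair) k :
  (x e.1 * x e.2) ^+ k = \prod_v x v ^+ (k * incid v e).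
Proof.
under eq_bigr do rewrite mulnC exprM; rewrite prodrXl; congr (_ ^+ _).
under eq_bigr do rewrite exprD; rewrite big_split /=.
have one (i : 'I_n) : \prod_v x v ^+ (i == v) = x i.
  rewrite (bigD1 i)//= eqxx expr1 big1 ?mulr1// => v vi.
  by rewrite eq_sym (negPf vi).
by rewrite !one.
Qed.

Lemma monomial_pairs x (A : {pred pair}) (a : pair -> nat) :
  \prod_(e in A) (x e.1 * x e.2) ^+ a e =
  \prod_v x v ^+ (\sum_(e in A) a e * incid v e)%N.
Proof.
under eq_bigr do rewrite monomial_pair.
by rewrite exchange_big /=; apply: eq_bigr => v _; rewrite expr_sum.
Qed.

Lemma coef_prod_graphs m x :
  (\prod_(e : pair) (1 + (if (e.1 < e.2)%N then x e.1 * x e.2 else 0) *: 'X))`_m =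
  \sum_(E : {set pair} | (E \subset ltpairs n) && (#|E| == m))
     \prod_v x v ^+ (\sum_(e in E) incid v e).
Proof.
under eq_bigr do rewrite addrC.
rewrite bigA_distr coef_sum [RHS]big_mkcond /=; apply: eq_bigr => E _.
(* Multiplicities [1] are inserted in the exponents so that [monomial_pairs] applies. *)
rewrite -big_mkcond /= -[in RHS](eq_bigr _ (fun v _ => congr2 _ (erefl (x v)) (eq_bigr _ (fun e _ => mul1n _)))).
rewrite -(monomial_pairs x E (fun=> 1%N)).
have -> : \prod_(e in E) ((if (e.1 < e.2)%N then x e.1 * x e.2 else 0) *: 'X) =
  (\prod_(e in E) (if (e.1 < e.2)%N then x e.1 * x e.2 else 0)) *: 'X^#|E| :> {poly R}.
  by rewrite scaler_prod prodr_const.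
rewrite coefZ coefXn eq_sym.
have [EL|EL] /= := boolP (E \subset ltpairs n); last first.
  move: EL => /fintype.subsetPn[e eE]; rewrite inE => /negPf eL.
  by rewrite (bigD1 e)//= eL !mul0r.
case: eqP => _; rewrite ?mulr0 ?mulr1//; apply: eq_bigr => e eE.
by move/fintype.subsetP: EL => /(_ _ eE); rewrite inE expr1 => ->.
Qed.

(** On a product grid of nodes the functional acts on each vertex variable separately, so a monomial
    goes to a product. *)
Lemma node_monomial K (lam : 'I_K -> R) (t : nat -> R) (a : 'I_n -> nat) :
  (forall d, (d < K)%N -> \sum_(i < K) lam i * i%:R ^+ d = t d) ->
  (forall v, (a v < K)%N) ->
  \sum_(x : {ffun 'I_n -> 'I_K}) (\prod_v lam (x v)) * \prod_v (x v)%:R ^+ a v =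
  \prod_v t (a v).
Proof.
move=> lamE aK.
transitivity (\sum_(x : {ffun 'I_n -> 'I_K}) \prod_v (lam (x v) * (x v)%:R ^+ a v)).
  by apply: eq_bigr => x _; rewrite big_split.
rewrite -(bigA_distr_bigA (fun v (i : 'I_K) => lam i * i%:R ^+ a v)) /=.
by apply: eq_bigr => v _; rewrite lamE.
Qed.

(** The multinomial theorem, read off from the coefficient of [X^j] in a product of exponential
    series. *)
Lemma sum_pow_multinomial x j k : (j <= k)%N ->
  (\sum_v x v) ^+ j = j`!%:R *
    \sum_(g : {ffun 'I_n -> 'I_k.+1} | (\sum_v g v)%N == j) \prod_v (x v ^+ g v / (g v)`!%:R).
Proof.
move=> jk; have := exptr_prod (m := k) x jk.
rewrite coef_exptr// => E; rewrite -(coef_prod_poly k.+1 (fun v d => x v ^+ d / d`!%:R)).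
by rewrite [X in _ * X]E mulrC divfK// natr_fact_neq0.
Qed.

(** One coefficient is expanded in two ways, by edge sets and by patches, and the node functional is
    applied to both. On an edge set it tests whether every degree lies in [D]; on a patch term the
    exponent tested at [v] is [pdeg f v + g v]. *)
Lemma graph_count (D : set nat) (m : nat) :
  #|SG D n m|%:R =
  \sum_(f : {ffun pair -> 'I_m.+1} | (fsum f <= m)%N)
    (\prod_e patchc e (f e)) *
    ((2 * (m - fsum f))`!%:R / (2 ^ (m - fsum f) * (m - fsum f)`!)%:R) *
    \sum_(g : {ffun 'I_n -> 'I_(2 * m).+1} | (\sum_v g v)%N == (2 * (m - fsum f))%N)
      \prod_v (((pdeg f v + g v)%N \in D)%:R / (g v)`!%:R) :> R.
Proof.
(* [pdeg f v] and [g v] are each at most [2 m], so every exponent met below is less than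
   [4 m + 1]. *)
pose K := (4 * m).+1; pose t d : R := (d \in D)%:R.
have [lam lamE] := node_functional K t.
pose X (x : {ffun 'I_n -> 'I_K}) (v : 'I_n) : R := (x v)%:R.
pose Lam (x : {ffun 'I_n -> 'I_K}) : R := \prod_v lam (x v).
transitivity (\sum_x Lam x * (\prod_(e : pair) (1 + (if (e.1 < e.2)%N
    then X x e.1 * X x e.2 else 0) *: 'X))`_m).
  under eq_bigr do rewrite coef_prod_graphs mulr_sumr.
  rewrite exchange_big /= card_SG -sum1_card natr_sum big_mkcond /= [RHS]big_mkcond /=.
  apply: eq_bigr => E _; rewrite inE andbA; have degb : E \subset ltpairs n -> #|E| == m ->
      forall v, (\sum_(e in E) incid v e < K)%N.
    move=> _ /eqP Em v; rewrite /K ltnS; apply: (@leq_trans (\sum_(e in E) 2)).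
      by apply: leq_sum => e _; rewrite /incid; case: eqP; case: eqP.
    by rewrite sum_nat_const Em mulnC leq_mul2r orbT.
  case: ifPn => [|].
    case/andP => /andP[EL Em] /forallP degE; rewrite EL Em; rewrite (node_monomial lamE).
      by rewrite big1// => v _; rewrite /t degE.
    exact: degb EL Em.
  case: ifP => //= /andP[EL Em]; rewrite negb_forall => /existsP[v degv].
  rewrite (node_monomial lamE).
    by rewrite (bigD1 v)//= /t (negPf degv) mul0r.
  exact: degb EL Em.
under eq_bigr do rewrite coef_prod_edges mulr_sumr.
rewrite exchange_big /=; apply: eq_bigr => f fm.
set j := (m - fsum f)%N.
have jm : (2 * j <= 2 * m)%N by rewrite leq_mul2l leq_subr.
transitivity (\sum_x \sum_(g : {ffun 'I_n -> 'I_(2 * m).+1} | (\sum_v g v)%N == (2 * j)%N)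
  (\prod_e patchc e (f e)) * ((2 * j)`!%:R / (2 ^ j * j`!)%:R) *
  ((\prod_v (g v)`!%:R^-1) * (Lam x * \prod_v X x v ^+ (pdeg f v + g v)))).
  apply: eq_bigr => x _.
  rewrite expr_div_n -exprM (sum_pow_multinomial _ jm) big_split /=.
  rewrite (monomial_pairs (X x) predT (fun e => f e)) -/(pdeg f _).
  rewrite natrM natrX invfM.
  pose C : R := (2 * j)`!%:R / (2 ^+ j * j`!%:R) * (\prod_e patchc e (f e)) *
    (Lam x * \prod_v X x v ^+ pdeg f v).
  rewrite [RHS](eq_bigr (fun g : {ffun 'I_n -> 'I_(2 * m).+1} =>
    C * \prod_v (X x v ^+ g v / (g v)`!%:R))); last first.
    move=> g _.
    have -> : \prod_v X x v ^+ (pdeg f v + g v) = (\prod_v X x v ^+ pdeg f v) * \prod_v X x v ^+ g v.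
      by rewrite -big_split; apply: eq_bigr => v _; rewrite exprD.
    have -> : \prod_v (X x v ^+ g v / (g v)`!%:R) = (\prod_v X x v ^+ g v) * \prod_v (g v)`!%:R^-1.
      by rewrite -big_split.
    by rewrite /C invfM; ring.
  by rewrite -mulr_sumr /C invfM; ring.
rewrite exchange_big /= mulr_sumr; apply: eq_bigr => g /eqP gj.
rewrite -mulr_sumr -mulr_sumr (node_monomial lamE).
  by congr (_ * _); rewrite -big_split; apply: eq_bigr => v _; rewrite mulrC.
move=> v; rewrite ltnS (_ : 4 * m = 2 * m + 2 * m)%N; last by rewrite -mulnDl.
apply: leq_add; first by rewrite (leq_trans (pdeg_le f v))// leq_mul2l fm orbT.
by rewrite (leq_trans _ jm)// -gj (bigD1 v)//= leq_addr.
Qed.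

End GraphCount.

(** * Exponential tilting of the exact formula *)

Section TiltedCount.
Context {R : realType}.
Variables (D : set nat) (n m : nat) (z Z : R).
Hypotheses (z0 : z != 0) (Z0 : Z != 0).
Local Notation pair := ('I_n * 'I_n)%type.

(** For [z > 0] and [Z = SetD D z], the Poisson law of parameter [z] conditioned on [D]. In this
    section [z] and [Z] are still free. *)
Definition tilt (d : nat) : R := (d \in D)%:R * z ^+ d / d`!%:R / Z.

(* The double factorial [(2 k - 1)!!]. *)
Definition dfac (k : nat) : R := (2 * k)`!%:R / (2 ^ k * k`!)%:R.

(** For [h <= m], the inverse of the product of the [h] largest odd numbers below [2 m]; close to
    [(2 m)^(-h)] when [h] is small. *)
Definition rho (h : nat) : R := dfac (m - h) / dfac m.

Lemma dfac_neq0 k : dfac k != 0.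
Proof.
by rewrite mulf_neq0 ?natr_fact_neq0// invr_neq0// natrM mulf_neq0 ?natr_fact_neq0// pnatr_eq0 expn_eq0.
Qed.

(** Since [(d ^_ k) / d! = 1 / (d - k)!], weighting by a falling factorial amounts to reserving [k]
    of the degree for the patch. *)
Lemma facpoly_shift k : eqpm (2 * m) (facpoly tilt (2 * m).+1 k)
  ('X^k * \poly_(d < (2 * m).+1) (((k + d)%N \in D)%:R * z ^+ (k + d) / d`!%:R / Z)).
Proof.
move=> d dm; rewrite coef_poly ltnS dm coefXnM; case: ltnP => kd.
  by rewrite ffact_small// mul0r.
rewrite coef_poly ltnS (leq_trans (leq_subr _ _) dm) subnKC// /tilt.
have E : (d ^_ k)%:R * (d - k)`!%:R = d`!%:R :> R by rewrite -natrM ffact_fact.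
rewrite -E.
have dk : (d ^_ k)%:R != 0 :> R by rewrite pnatr_eq0 -lt0n ffact_gt0.
by field; rewrite natr_fact_neq0 dk Z0.
Qed.

(** The exponents [pdeg f v + g v] sum to [2 m] whatever the patch, so the factors come out as
    [Z^n / z^(2m)] and the identity is exact. *)
Lemma sum_tilt (f : {ffun pair -> 'I_m.+1}) : (fsum f <= m)%N ->
  \sum_(g : {ffun 'I_n -> 'I_(2 * m).+1} | (\sum_v g v)%N == (2 * (m - fsum f))%N)
      \prod_v (((pdeg f v + g v)%N \in D)%:R / (g v)`!%:R) =
  Z ^+ n / z ^+ (2 * m) * (\prod_v facpoly tilt (2 * m).+1 (pdeg f v))`_(2 * m).
Proof.
move=> fm; rewrite (eqpm_prod (fun v => facpoly_shift (pdeg f v)) (leqnn _)).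
rewrite big_split /= -expr_sum sum_pdeg coefXnM ltnNge leq_mul2l fm orbT /= -mulnBr.
rewrite (coef_prod_poly _ (fun v d => ((pdeg f v + d)%N \in D)%:R * z ^+ (pdeg f v + d) / d`!%:R / Z)).
rewrite mulr_sumr; apply: eq_bigr => g /eqP gj.
have zE : z ^+ (2 * m) = \prod_v z ^+ (pdeg f v + g v).
  by rewrite -expr_sum big_split /= sum_pdeg gj -mulnDr subnKC.
have ZE : Z ^+ n = \prod_(v < n) Z by rewrite prodr_const card_ord.
have pz : \prod_v z ^+ (pdeg f v + g v) != 0.
  by rewrite -zE expf_neq0.
rewrite zE ZE mulrAC -[LHS](mulfK pz) -!big_split; congr (_ / _).
apply: eq_bigr => v _ /=.
by field; rewrite natr_fact_neq0 Z0.
Qed.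

Lemma graph_count_tilt :
  #|SG D n m|%:R = (2 * m)`!%:R / (2 ^ m * m`!)%:R * (Z ^+ n / z ^+ (2 * m)) *
  \sum_(f : {ffun pair -> 'I_m.+1} | (fsum f <= m)%N)
    (\prod_e patchc e (f e)) * rho (fsum f) *
    (\prod_v facpoly tilt (2 * m).+1 (pdeg f v))`_(2 * m).
Proof.
rewrite graph_count mulr_sumr; apply: eq_bigr => f fm.
rewrite sum_tilt// -/(dfac _) -/(dfac _) /rho.
by field; rewrite dfac_neq0 expf_neq0.
Qed.

End TiltedCount.

(** * The series SetD and the saddle point *)

Section SetSeries.
Context {R : realType}.
Implicit Types (D : set nat) (x z : R).

Definition setc D (d : nat) : R := (d \in D)%:R / d`!%:R.

Lemma setc_ge0 D d : 0 <= setc D d.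
Proof. by rewrite divr_ge0. Qed.

Lemma setc_le D d : setc D d <= d`!%:R^-1.
Proof. by rewrite /setc ler_piMl// lern1 leq_b1. Qed.

Lemma set_subE D i : set_sub D i = [set d | D (d + i)%N].
Proof.
apply/seteqP; split => [d|d Dd]; first by case=> e /= [De ie] <-; rewrite subnK.
by exists (d + i)%N; rewrite /= ?addnK//; split => //; exact: leq_addl.
Qed.

Lemma set_sub0 D : set_sub D 0 = D.
Proof. by rewrite set_subE; apply/seteqP; split => d /=; rewrite addn0. Qed.

Lemma set_subD D i j : set_sub (set_sub D i) j = set_sub D (j + i).
Proof. by rewrite !set_subE; apply/seteqP; split => d /=; rewrite addnA. Qed.

Lemma mem_set_sub D i d : (d \in set_sub D i) = ((d + i)%N \in D).
Proof. by rewrite set_subE; apply/idP/idP; rewrite !inE. Qed.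

Lemma setc_sub D i d : setc (set_sub D i) d = ((d + i) ^_ i)%:R * setc D (d + i).
Proof.
rewrite /setc mem_set_sub mulrCA; congr (_ * _).
have := ffact_fact (leq_addl d i); rewrite addnK => <-.
rewrite natrM invfM mulVKf// pnatr_eq0 -lt0n ffact_gt0 leq_addl//.
Qed.

Lemma cvg_pow_series (x : R) (f : nat -> R) : 0 <= x ->
  (forall d, 0 <= f d <= d`!%:R^-1) -> cvgn (series (fun d => f d * x ^+ d)).
Proof.
move=> x0 fd; apply: (@series_le_cvg _ _ (exp_coeff x)).
- by move=> d; case/andP: (fd d) => f0 _; rewrite mulr_ge0// exprn_ge0.
- by move=> d; rewrite /exp_coeff divr_ge0// exprn_ge0.
- move=> d; case/andP: (fd d) => _ f1; rewrite /exp_coeff mulrC ler_wpM2l//.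
  by rewrite exprn_ge0.
- exact: is_cvg_series_exp_coeff.
Qed.

Lemma cvg_SetD D x : 0 <= x -> series (fun d => setc D d * x ^+ d) @ \oo --> SetD D x.
Proof.
move=> x0; apply: cvg_pow_series => // d; rewrite setc_ge0 setc_le//.
Qed.

Lemma series_le_lim (f : nat -> R) (l : R) : (forall d, 0 <= f d) ->
  series f @ \oo --> l -> forall T, \sum_(d < T) f d <= l.
Proof.
move=> f0 fl T; rewrite -(cvg_lim _ fl)//.
have -> : \sum_(d < T) f d = series f T by rewrite /series /= big_mkord.
apply: nondecreasing_cvgn_le.
- by apply/nondecreasing_seqP => n; rewrite seriesSr lerDl.
- by apply/cvg_ex; exists l.
Qed.

Lemma SetD_ge0 D x : 0 <= x -> 0 <= SetD D x.
Proof.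
move=> x0; have h d : 0 <= setc D d * x ^+ d by rewrite mulr_ge0 ?setc_ge0 ?exprn_ge0.
by have := series_le_lim h (cvg_SetD x0) 0; rewrite big_ord0.
Qed.

Lemma SetD_le_expR D x : 0 <= x -> SetD D x <= expR x.
Proof.
move=> x0; apply: (ler_cvg_to (cvg_SetD x0) (is_cvg_series_exp_coeff x)).
near=> n; apply: ler_sum => d _; rewrite /exp_coeff mulrC ler_wpM2l ?exprn_ge0//.
exact: setc_le.
Unshelve. all: by end_near. Qed.

Lemma SetD_ge_term D x d : 0 <= x -> D d -> x ^+ d / d`!%:R <= SetD D x.
Proof.
move=> x0 Dd.
have h : forall d, 0 <= setc D d * x ^+ d by move=> ?; rewrite mulr_ge0 ?setc_ge0 ?exprn_ge0.
apply: le_trans (series_le_lim h (cvg_SetD x0) d.+1).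
rewrite big_ord_recr /= {2}/setc mem_set// mul1r [_^-1 * _]mulrC lerDr.
exact: sumr_ge0.
Qed.

Lemma pseries_diffs_setc D : pseries_diffs (setc D) = setc (set_sub D 1).
Proof.
by apply/funext => d; rewrite setc_sub /pseries_diffs addn1 ffactn1.
Qed.

Lemma is_derive_SetD D x : 0 < x -> is_derive x 1 (SetD D) (SetD (set_sub D 1) x).
Proof.
move=> x0; have K0 : 0 <= x + 1 by rewrite addr_ge0// ltW.
have := @pseries_snd_diffs R (setc D) (x + 1) x.
rewrite !pseries_diffs_setc; apply.
- exact: cvgP (cvg_SetD K0).
- exact: cvgP (cvg_SetD K0).
- exact: cvgP (cvg_SetD K0).
- by rewrite !ger0_norm// ?ltrDl// ltW.
Qed.

Lemma cvg_series_ffact D x k : 0 <= x ->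
  series (fun d => (d ^_ k)%:R * (setc D d * x ^+ d)) @ \oo --> x ^+ k * SetD (set_sub D k) x.
Proof.
move=> x0; rewrite -(cvg_shiftn k).
have -> : (fun n => series (fun d => (d ^_ k)%:R * (setc D d * x ^+ d)) (n + k)%N) =
   (fun n => x ^+ k * series (fun d => setc (set_sub D k) d * x ^+ d) n).
  apply/funext => n; rewrite /series /= (big_cat_nat (n := k)) ?leq_addl//=.
  rewrite big_nat_cond big1 ?add0r; last first.
    by move=> d /andP[/andP[_ dk] _]; rewrite ffact_small ?mul0r.
  rewrite -{1}[k]add0n big_addn addnK mulr_sumr; apply: eq_bigr => d _.
  by rewrite setc_sub exprD; ring.
by apply: cvgM; [exact: cvg_cst|exact: cvg_SetD].
Qed.

End SetSeries.

(** * Moments and tails of the tilted law *)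

Section TiltedMoments.
Context {R : realType}.
Variables (D : set nat) (z : R).
Hypotheses (z0 : 0 < z) (Dn0 : exists d, D d).
Local Notation Z := (SetD D z).
Local Notation p := (tilt D z Z).

Definition tmean : R := phi D z.
Definition tfac2 : R := z ^+ 2 * SetD (set_sub D 2) z / Z.
Definition tvar : R := tfac2 + tmean - tmean ^+ 2.

Lemma SetD_gt0 : 0 < Z.
Proof.
case: Dn0 => d Dd; apply: lt_le_trans (SetD_ge_term (ltW z0) Dd).
by rewrite divr_gt0 ?exprn_gt0// ltr0n fact_gt0.
Qed.

Lemma tiltE d : p d = setc D d * z ^+ d / Z.
Proof. by rewrite /tilt /setc; congr (_ / _); rewrite mulrAC. Qed.

Lemma tilt_ge0 d : 0 <= p d.
Proof. by rewrite tiltE divr_ge0 ?(ltW SetD_gt0)// mulr_ge0 ?setc_ge0 ?exprn_ge0// ltW. Qed.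

Lemma cvg_tilt_fac k : series (fun d => (d ^_ k)%:R * p d) @ \oo -->
  z ^+ k * SetD (set_sub D k) z / Z.
Proof.
have -> : series (fun d => (d ^_ k)%:R * p d) =
    (fun n => series (fun d => (d ^_ k)%:R * (setc D d * z ^+ d)) n / Z).
  apply/funext => n; rewrite /series /= mulr_suml; apply: eq_bigr => d _.
  by rewrite tiltE !mulrA.
by apply: cvgM; [exact: cvg_series_ffact (ltW z0)|exact: cvg_cst].
Qed.

Lemma cvg_tilt0 : series p @ \oo --> (1 : R).
Proof.
have := @cvg_tilt_fac 0%N.
rewrite expr0 mul1r set_sub0 divff ?gt_eqF ?SetD_gt0//.
by rewrite (_ : (fun d => (d ^_ 0)%:R * p d) = p)//; apply/funext => d; rewrite ffactn0 mul1r.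
Qed.

Lemma cvg_tilt1 : series (fun d => d%:R * p d) @ \oo --> tmean.
Proof.
have := @cvg_tilt_fac 1%N; rewrite expr1.
by rewrite (_ : (fun d => (d ^_ 1)%:R * p d) = (fun d => d%:R * p d))//; apply/funext => d; rewrite ffactn1.
Qed.

Lemma cvg_tilt_mean0 : series (fun d => (d%:R - tmean) * p d) @ \oo --> (0 : R).
Proof.
have -> : series (fun d => (d%:R - tmean) * p d) =
    (fun n => series (fun d => d%:R * p d) n - tmean * series p n).
  apply/funext => n; rewrite /series /= mulr_sumr -sumrB; apply: eq_bigr => d _.
  by rewrite mulrBl.
have -> : 0 = tmean - tmean * 1 by rewrite mulr1 subrr.
apply: cvgB; first exact: cvg_tilt1.
by apply: cvgM; [exact: cvg_cst|exact: cvg_tilt0].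
Qed.

Lemma cvg_tilt_var : series (fun d => (d%:R - tmean) ^+ 2 * p d) @ \oo --> tvar.
Proof.
have -> : series (fun d => (d%:R - tmean) ^+ 2 * p d) =
    (fun n => series (fun d => (d ^_ 2)%:R * p d) n +
       (1 - 2 * tmean) * series (fun d => d%:R * p d) n + tmean ^+ 2 * series p n).
  apply/funext => n; rewrite /series /= 2!mulr_sumr -!big_split; apply: eq_bigr => d _ /=.
  have -> : (d ^_ 2)%:R = d%:R ^+ 2 - d%:R :> R.
    case: d => [|d]; first by rewrite expr0n subr0.
    by rewrite ffactnS ffactn1 /= natrM -natr1; ring.
  by ring.
have -> : tvar = tfac2 + (1 - 2 * tmean) * tmean + tmean ^+ 2 * 1 by rewrite /tvar; ring.
apply: cvgD; first apply: cvgD.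
- exact: cvg_tilt_fac.
- by apply: cvgM; [exact: cvg_cst|exact: cvg_tilt1].
- by apply: cvgM; [exact: cvg_cst|exact: cvg_tilt0].
Qed.

(** An exponential moment, since [e^d z^d = (z e)^d]. It dominates the polynomial moments and tails
    needed later, uniformly for [z] in a compact interval of positive numbers. *)
Lemma tilt_exp_le T : \sum_(d < T) expR d%:R * p d <= expR (z * expR 1) / Z.
Proof.
have -> : \sum_(d < T) expR d%:R * p d = (\sum_(d < T) setc D d * (z * expR 1) ^+ d) / Z.
  rewrite mulr_suml; apply: eq_bigr => d _; rewrite tiltE exprMn.
  by rewrite -expRM_natl mulr1; ring.
have ze : 0 <= z * expR 1 by rewrite mulr_ge0 ?expR_ge0 ?ltW.
rewrite ler_wpM2r ?invr_ge0 ?(ltW SetD_gt0)// (le_trans _ (SetD_le_expR D ze))//.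
apply: (series_le_lim _ (cvg_SetD ze)) => d.
by rewrite mulr_ge0 ?setc_ge0 ?exprn_ge0.
Qed.

Lemma tilt_moment_le (f : nat -> R) (C : R) T : 0 <= C ->
  (forall d, `|f d| <= C * expR d%:R) ->
  \sum_(d < T) `|f d| * p d <= C * (expR (z * expR 1) / Z).
Proof.
move=> C0 fC; apply: le_trans (ler_wpM2l C0 (tilt_exp_le T)).
rewrite mulr_sumr; apply: ler_sum => d _; rewrite [leRHS]mulrA ler_wpM2r ?tilt_ge0//.
Qed.

(** For [d >= T] one has [1 <= d^2 / T^2], so the additional factor [d^2] in the growth bound on [f]
    buys the decay [T^-2]. *)
Lemma tilt_tail (f : nat -> R) (C l : R) T : 0 <= C -> (0 < T)%N ->
  (forall d, `|f d| * d%:R ^+ 2 <= C * expR d%:R) ->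
  series (fun d => f d * p d) @ \oo --> l ->
  `|\sum_(d < T) f d * p d - l| <= C * (expR (z * expR 1) / Z) / T%:R ^+ 2.
Proof.
move=> C0 T0 fC fl; have T2 : 0 < T%:R ^+ 2 :> R by rewrite exprn_gt0// ltr0n.
set S := \sum_(d < T) f d * p d.
have cl : (fun n => `|S - series (fun d => f d * p d) n|) @ \oo --> `|S - l|.
  by apply: cvg_norm; apply: cvgB => //; exact: cvg_cst.
apply: (ler_cvg_to cl (cvg_cst _)); near=> n.
have Tn : (T <= n)%N by near: n; exact: nbhs_infty_ge.
rewrite /S -(big_mkord xpredT (fun d => f d * p d)) /series /= [X in _ - X](big_cat_nat (n := T))//=.
rewrite opprD addNKr normrN.
apply: (@le_trans _ _ (\sum_(T <= d < n) C / T%:R ^+ 2 * (expR d%:R * p d))).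
  rewrite (le_trans (ler_norm_sum _ _ _))// !big_nat; apply: ler_sum => d /andP[Td _].
  rewrite normrM (ger0_norm (tilt_ge0 d)) mulrA ler_wpM2r ?tilt_ge0//.
  rewrite mulrAC ler_pdivlMr// (le_trans _ (fC d))// ler_wpM2l//.
  by rewrite lerXn2r ?nnegrE// ler_nat.
rewrite -mulr_sumr [leLHS]mulrAC ler_wpM2r ?invr_ge0 ?(ltW T2)// ler_wpM2l//.
apply: le_trans (tilt_exp_le n).
rewrite -(big_mkord xpredT (fun d => expR d%:R * p d)) [leRHS](big_cat_nat (n := T))//= lerDr.
by apply: sumr_ge0 => d _; rewrite mulr_ge0 ?expR_ge0 ?tilt_ge0.
Unshelve. all: by end_near. Qed.

Lemma tilt_fac_le k T : \sum_(d < T) (d ^_ k)%:R * p d <= z ^+ k * SetD (set_sub D k) z / Z.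
Proof.
have h d : 0 <= (d ^_ k)%:R * p d by rewrite mulr_ge0 ?tilt_ge0.
exact: (series_le_lim h (@cvg_tilt_fac k)).
Qed.

(** Two support points at distance at least [1] cannot both be close to the mean: their squared
    distances to it sum to at least [1/2]. *)
Lemma tilt_var_ge (d1 d2 : nat) : D d1 -> D d2 -> d1 <> d2 ->
  Num.min (p d1) (p d2) / 2 <= tvar.
Proof.
wlog d12 : d1 d2 / (d1 < d2)%N.
  move=> H D1 D2 /eqP; rewrite neq_ltn => /orP[d12|d12].
    by apply: H => //; apply/eqP; rewrite neq_ltn d12.
  by rewrite minC; apply: H => //; apply/eqP; rewrite neq_ltn d12.
move=> D1 D2 _.
have f0 d : 0 <= (d%:R - tmean) ^+ 2 * p d by rewrite mulr_ge0 ?sqr_ge0 ?tilt_ge0.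
apply: le_trans (series_le_lim f0 cvg_tilt_var d2.+1).
rewrite big_ord_recr /= (bigD1 (Ordinal d12)) //=.
set S := \sum_(_ | _) _; have S0 : 0 <= S by exact: sumr_ge0.
set a := Num.min _ _.
have a1 : a <= p d1 by rewrite ge_min lexx.
have a2 : a <= p d2 by rewrite ge_min lexx orbT.
have a0 : 0 <= a by rewrite le_min !tilt_ge0.
have := ler_wpM2l (sqr_ge0 (d1%:R - tmean)) a1.
have := ler_wpM2l (sqr_ge0 (d2%:R - tmean)) a2.
have : 1 <= (d2%:R - d1%:R) ^+ 2 :> R.
  by rewrite -natrB ?(ltnW d12)// -natrX ler1n expn_gt0 subn_gt0 d12.
move: S S0 (p d1) (p d2) a a0 (d1%:R : R) (d2%:R : R) tmean {a1 a2 f0} => S S0 p1 p2 a a0 x1 x2 mu h h2 h1.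
have : 1 / 2 <= (x1 - mu) ^+ 2 + (x2 - mu) ^+ 2.
  have : 0 <= (x1 + x2 - 2 * mu) ^+ 2 by exact: sqr_ge0.
  nra.
move=> /(ler_wpM2l a0); lra.
Qed.

End TiltedMoments.

(** * Existence, uniqueness and location of the saddle point *)

Section SaddlePoint.
Context {R : realType}.
Variable D : set nat.
Hypothesis Dn0 : exists d, D d.
Implicit Types (x y z a b : R).

(** [phi D x] is the mean of the tilted law and [x phi'(x)] its variance, whose positivity makes
    [phi] strictly increasing. *)
Lemma is_derive_phi x : 0 < x -> is_derive x 1 (@phi R D) (tvar D x / x).
Proof.
move=> x0; have Z0 := SetD_gt0 x0 Dn0.
have d0 := @is_derive_SetD R D x x0.
have d1 := @is_derive_SetD R (set_sub D 1) x x0.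
rewrite set_subD in d1.
have Zn0 : SetD D x != 0 by rewrite gt_eqF.
have dV := is_deriveV Zn0 d0.
have -> : phi D = (fun x : R => x) * SetD (set_sub D 1) * (fun y : R => (SetD D y)^-1) by [].
apply: is_derive_eq.
rewrite /GRing.scale /= /tvar /tfac2 /tmean /phi addn1.
have xn0 : x != 0 by rewrite gt_eqF.
by rewrite mulrfctE /=; field; rewrite xn0 Zn0.
Qed.

Lemma continuous_phi a b : 0 < a -> {within `[a, b], continuous (@phi R D)}.
Proof.
move=> a0; apply: derivable_within_continuous => x; rewrite in_itv/= => /andP[ax _].
by case: (is_derive_phi (lt_le_trans a0 ax)).
Qed.

Lemma tvar_gt0 x (d1 d2 : nat) : 0 < x -> D d1 -> D d2 -> d1 <> d2 -> 0 < tvar D x.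
Proof.
move=> x0 D1 D2 d12; apply: lt_le_trans (tilt_var_ge x0 Dn0 D1 D2 d12).
have p0 d : D d -> 0 < tilt D x (SetD D x) d.
  move=> Dd; by rewrite /tilt mem_set// mul1r !divr_gt0 ?exprn_gt0 ?SetD_gt0 ?ltr0n ?fact_gt0.
by rewrite divr_gt0// lt_min !p0.
Qed.

Lemma phi_lt x y (d1 d2 : nat) : D d1 -> D d2 -> d1 <> d2 ->
  0 < x -> x < y -> phi D x < phi D y.
Proof.
move=> D1 D2 d12 x0 xy; rewrite -subr_gt0.
have dphi z : z \in `]x, y[%R -> is_derive z 1 (@phi R D) (tvar D z / z).
  by rewrite in_itv/= => /andP[xz _]; apply: is_derive_phi; exact: lt_trans xz.
have [c] := MVT xy dphi (continuous_phi x0).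
rewrite in_itv /= => /andP[xc _] ->.
have c0 := lt_trans x0 xc.
by rewrite mulr_gt0 ?subr_gt0// divr_gt0// (tvar_gt0 c0 D1 D2 d12).
Qed.

(** The sign of [phi D x - a] becomes that of a series, so bounds on [phi] can be checked on partial
    sums. *)
Lemma cvg_phi_sums x a : 0 < x ->
  series (fun d => (d%:R - a) * (setc D d * x ^+ d)) @ \oo -->
    (phi D x - a) * SetD D x.
Proof.
move=> x0; have Z0 := SetD_gt0 x0 Dn0.
have c1 := cvg_series_ffact (D := D) (k := 1) (ltW x0).
have c0 := cvg_SetD (D := D) (ltW x0).
rewrite expr1 in c1.
have -> : (phi D x - a) * SetD D x = x * SetD (set_sub D 1) x - a * SetD D x.
  by rewrite mulrBl /phi divfK// gt_eqF.
have -> : series (fun d => (d%:R - a) * (setc D d * x ^+ d)) =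
  (fun n => series (fun d => (d ^_ 1)%:R * (setc D d * x ^+ d)) n -
     a * series (fun d => setc D d * x ^+ d) n).
  apply/funext => n; rewrite /series /= mulr_sumr -sumrB; apply: eq_bigr => d _.
  by rewrite ffactn1 mulrBl.
by apply: cvgB => //; apply: cvgM => //; exact: cvg_cst.
Qed.

Lemma phi_le_of_sums x a : 0 < x -> (forall T, exists2 T' : nat, (T <= T')%N &
    \sum_(d < T') (d%:R - a) * (setc D d * x ^+ d) <= 0) -> phi D x <= a.
Proof.
move=> x0 H; have Z0 := SetD_gt0 x0 Dn0.
rewrite leNgt; apply/negP => l0.
have l0' : 0 < (phi D x - a) * SetD D x by rewrite mulr_gt0// subr_gt0.
have [N _ NP] := cvgr_gt _ (@cvg_phi_sums x a x0) _ l0'.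
have [T' TT] := H N; rewrite leNgt => /negP; apply.
by have := NP T' TT; rewrite /series /= big_mkord.
Qed.

Lemma phi_ge_of_sums x a : 0 < x -> (forall T, exists2 T' : nat, (T <= T')%N &
    0 <= \sum_(d < T') (d%:R - a) * (setc D d * x ^+ d)) -> a <= phi D x.
Proof.
move=> x0 H; have Z0 := SetD_gt0 x0 Dn0.
rewrite leNgt; apply/negP => l0.
have l0' : (phi D x - a) * SetD D x < 0 by rewrite nmulr_rlt0// subr_lt0.
have [N _ NP] := cvgr_lt _ (@cvg_phi_sums x a x0) _ l0'.
have [T' TT] := H N; rewrite leNgt => /negP; apply.
by have := NP T' TT; rewrite /series /= big_mkord.
Qed.

(** For small [x] the term [d = r], which is negative, outweighs the others: these carry at least
    [x^(r+1)], and [d <= 2^d] bounds their coefficients by the terms of the series of [exp 2]. *)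
Lemma phi_small r a : is_min D r -> r%:R < a -> exists2 x, 0 < x & phi D x <= a.
Proof.
move=> [Dr rD] ra.
have rf0 : 0 < r`!%:R :> R by rewrite ltr0n fact_gt0.
pose e2 : R := expR 2.
pose x := Num.min 1 ((a - r%:R) / (r`!%:R * e2)).
have xr0 : 0 < (a - r%:R) / (r`!%:R * e2).
  by rewrite divr_gt0 ?subr_gt0// mulr_gt0 ?expR_gt0.
have x0 : 0 < x by rewrite lt_min ltr01.
have x1 : x <= 1 by rewrite ge_min lexx.
have xs : x * (r`!%:R * e2) <= a - r%:R.
  by rewrite -ler_pdivlMr ?mulr_gt0 ?expR_gt0// ge_min lexx orbT.
exists x => //; apply: phi_le_of_sums => // T.
exists (T + r.+1)%N; first exact: leq_addr.
have rT : (r < T + r.+1)%N by rewrite addnS ltnS leq_addl.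
rewrite (bigD1 (Ordinal rT)) //= {1}/setc mem_set// mul1r.
have h : \sum_(d < T + r.+1 | d != Ordinal rT) (d%:R - a) * (setc D d * x ^+ d) <= x ^+ r.+1 * e2.
  apply: (@le_trans _ _ (\sum_(d < T + r.+1) x ^+ r.+1 * exp_coeff 2 d)); last first.
    rewrite -mulr_sumr ler_wpM2l ?exprn_ge0 ?(ltW x0)//.
    apply: (series_le_lim (f := exp_coeff 2)) => [d|]; first by rewrite exp_coeff_ge0.
    exact: is_cvg_series_exp_coeff.
  rewrite big_mkcond /=; apply: ler_sum => d _.
  have c0 : 0 <= x ^+ r.+1 * exp_coeff 2 d.
    by rewrite mulr_ge0 ?exp_coeff_ge0 ?exprn_ge0 ?(ltW x0).
  case: ifPn => // dr.
  rewrite /setc; have [Dd|] := boolP ((d : nat) \in D); last by rewrite !mul0r mulr0.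
  have rd : (r < d)%N.
    rewrite ltn_neqAle eq_sym -val_eqE /= in dr *; rewrite dr /=.
    by have := rD _ (set_mem Dd).
  have a0 : 0 < a by rewrite (le_lt_trans _ ra).
  have f0 : 0 <= d`!%:R^-1 :> R by rewrite invr_ge0.
  rewrite mul1r /exp_coeff /=.
  have -> : x ^+ r.+1 * (2 ^+ d / d`!%:R) = 2 ^+ d * (d`!%:R^-1 * x ^+ r.+1) by ring.
  apply: (@le_trans _ _ (2 ^+ d * (d`!%:R^-1 * x ^+ d))).
    apply: ler_wpM2r; first by rewrite mulr_ge0 ?exprn_ge0 ?(ltW x0).
    apply: (@le_trans _ _ d%:R); first by rewrite gerBl ltW.
    by rewrite -natrX ler_nat ltnW// ltn_expl.
  rewrite !ler_wpM2l ?exprn_ge0//.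
  by rewrite ler_wiXn2l// ltW.
move: h; set S := \sum_(_ | _) _ => h.
have h2 : x ^+ r.+1 * e2 <= x ^+ r * ((a - r%:R) / r`!%:R).
  rewrite exprSr -mulrA ler_wpM2l ?exprn_ge0 ?(ltW x0)// ler_pdivlMr//.
  by move: xs; rewrite [_ * e2]mulrC mulrA.
have := le_trans h h2; rewrite -subr_ge0 => h3; rewrite -oppr_ge0.
apply: le_trans h3 _; rewrite le_eqVlt; apply/orP; left; apply/eqP; ring.
Qed.

(** For large [x] the positive term [d = d0] outweighs the [d0] indices below it, each contributing
    at least [- b x^(d0-1)]; the terms above are nonnegative. *)
Lemma phi_large (d0 : nat) b : D d0 -> 0 <= b -> b < d0%:R -> exists2 x, 0 < x & b <= phi D x.
Proof.
move=> Dd0 b0 bd0; have d00 : (0 < d0)%N by rewrite -(ltr0n R) (le_lt_trans b0).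
have f0 : 0 < d0`!%:R :> R by rewrite ltr0n fact_gt0.
pose x := Num.max 1 (b * d0%:R * d0`!%:R / (d0%:R - b)).
have x1 : 1 <= x by rewrite le_max lexx.
have x0 : 0 < x by rewrite (lt_le_trans ltr01).
have xs : b * d0%:R * d0`!%:R <= x * (d0%:R - b).
  by rewrite -ler_pdivrMr ?subr_gt0// le_max lexx orbT.
exists x => //; apply: phi_ge_of_sums => // T.
exists (T + d0.+1)%N; first exact: leq_addr.
have dT : (d0 < T + d0.+1)%N by rewrite addnS ltnS leq_addl.
pose g (d : 'I_(T + d0.+1)) : R := if (d < d0)%N then b * x ^+ d0.-1 else 0.
have gE : \sum_(d < T + d0.+1) g d = d0%:R * (b * x ^+ d0.-1).
  rewrite -big_mkcond /= -(big_ord_widen _ (fun=> b * x ^+ d0.-1)) ?(ltnW dT)//.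
  by rewrite sumr_const card_ord mulr_natl.
have h : - (d0%:R * (b * x ^+ d0.-1)) <=
    \sum_(d < T + d0.+1 | d != Ordinal dT) (d%:R - b) * (setc D d * x ^+ d).
  rewrite -gE -sumrN [leRHS]big_mkcond /=; apply: ler_sum => d _; rewrite /g.
  have c0 : 0 <= setc D d * x ^+ d by rewrite mulr_ge0 ?setc_ge0 ?exprn_ge0 ?(ltW x0).
  have cx : setc D d * x ^+ d <= x ^+ d.
    rewrite ler_piMl ?exprn_ge0 ?(ltW x0)// (le_trans (setc_le _ _))//.
    by rewrite invf_le1 ?ltr0n ?fact_gt0// ler1n fact_gt0.
  case: ifPn => [dd|dd].
    have xd : x ^+ d <= x ^+ d0.-1 by rewrite ler_weXn2l// -ltnS prednK.
    have bx := ler_wpM2l b0 (le_trans cx xd).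
    have dc : 0 <= d%:R * (setc D d * x ^+ d) by rewrite mulr_ge0.
    case: ifP => _; first by rewrite mulrBl; lra.
    by rewrite oppr_le0 mulr_ge0// exprn_ge0// ltW.
  rewrite oppr0; case: ifP => // _; rewrite mulr_ge0// subr_ge0.
  by rewrite (le_trans (ltW bd0))// ler_nat leqNgt.
rewrite (bigD1 (Ordinal dT)) //= {1}/setc mem_set// mul1r.
apply: le_trans (lerD (lexx _) h); rewrite subr_ge0.
have -> : x ^+ d0 = x * x ^+ d0.-1 by rewrite -exprS prednK.
have -> : (d0%:R - b) * (d0`!%:R^-1 * (x * x ^+ d0.-1)) = x * (d0%:R - b) / d0`!%:R * x ^+ d0.-1 by ring.
rewrite mulrA ler_wpM2r ?exprn_ge0 ?(ltW x0)// ler_pdivlMr//.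
by rewrite [_ * b]mulrC.
Qed.

(** The bounds [z1] and [z2] are chosen before [v]; all later uniformity rests on this. *)
Lemma saddle_exists r (d1 d2 d0 : nat) a b : is_min D r -> D d1 -> D d2 -> d1 <> d2 ->
  D d0 -> r%:R < a -> a <= b -> b < d0%:R ->
  exists z1 z2 : R, 0 < z1 /\ forall v, a <= v <= b ->
    exists2 z, z1 <= z <= z2 & unique (fun z : R => 0 < z /\ phi D z = v) z.
Proof.
move=> rD D1 D2 d12 Dd0 ra ab bd.
have b0 : 0 <= b by rewrite (le_trans _ ab)// (le_trans _ (ltW ra)).
have [z1 z10 h1] := phi_small rD ra.
have [z2 z20 h2] := phi_large Dd0 b0 bd.
have lt_phi := phi_lt D1 D2 d12.
exists z1, z2; split => // v /andP[av vb].
have z12 : z1 <= z2.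
  rewrite leNgt; apply/negP => z21; have := lt_phi _ _ z20 z21.
  by rewrite ltNge (le_trans h1)// (le_trans av)// (le_trans vb).
have [|z] := @IVT R (phi D) z1 z2 v z12 (continuous_phi z10).
  rewrite ge_min le_max (le_trans h1 av) (le_trans vb h2) orbT //.
rewrite in_itv /= => zI zv; exists z => //.
have z0 : 0 < z by case/andP: zI => + _; exact: lt_le_trans.
split => // y [y0 yv]; have [yz|zy|//] := ltgtP z y.
  by have := lt_phi _ _ z0 yz; rewrite yv zv ltxx.
by have := lt_phi _ _ y0 zy; rewrite yv zv ltxx.
Qed.

End SaddlePoint.

(** * Decay of the characteristic function *)

Section Decay.
Context {R : realType}.

(** The squared mass minus the squared modulus is the double sum of
    [p_i p_j (1 - cos (th_i - th_j))], with nonnegative terms. A single pair is kept, with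
    [1 - cos (2 x) = 2 sin^2 x]. *)
Lemma charf_gap (p : nat -> R) T (mu t : R) (d1 d2 : nat) :
  (forall d, 0 <= p d) -> \sum_(d < T) p d <= 1 -> (d1 < T)%N -> (d2 < T)%N ->
  p d1 * p d2 * sin ((d1%:R - d2%:R) * t / 2) ^+ 2 <=
  1 - Normc.normc (charf (facpoly p T 0) mu t) ^+ 2.
Proof.
move=> p0 p1 d1T d2T.
rewrite facpoly0 charf_poly normc_sqr Re_sum Im_sum.
under eq_bigr do rewrite ReZ /=.
under [X in _ <= 1 - (_ + X ^+ 2)]eq_bigr do rewrite ImZ /=.
set X := \sum_(d < T) _; set Y := \sum_(d < T) _.
set S := \sum_(d < T) p d in p1.
have S0 : 0 <= S by apply: sumr_ge0.
apply: (@le_trans _ _ (S ^+ 2 - (X ^+ 2 + Y ^+ 2))); last first.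
  by rewrite lerD2r expr_le1.
pose th (d : nat) := (d%:R - mu) * t.
have -> : S ^+ 2 - (X ^+ 2 + Y ^+ 2) =
    \sum_(i < T) \sum_(j < T) p i * p j * (1 - cos (th i - th j)).
  rewrite !expr2 /S /X /Y !mulr_suml -big_split -sumrB; apply: eq_bigr => i _ /=.
  rewrite !mulr_sumr -big_split -sumrB; apply: eq_bigr => j _ /=.
  rewrite cosB /th; ring.
have pos i j : 0 <= p i * p j * (1 - cos (th i - th j)).
  by rewrite !mulr_ge0// subr_ge0 cos_le1.
rewrite (bigD1 (Ordinal d1T)) //= (bigD1 (Ordinal d2T)) //=.
apply: (@le_trans _ _ (p d1 * p d2 * (1 - cos (th d1 - th d2)))); last first.
  rewrite -addrA lerDl addr_ge0 ?sumr_ge0// => i _.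
  by rewrite sumr_ge0.
rewrite ler_wpM2l ?mulr_ge0//.
have -> : th d1 - th d2 = (d1%:R - d2%:R) * t / 2 *+ 2.
  by rewrite /th mulr2n; field.
rewrite cos_mulr2n cos2sin2; have := sqr_ge0 (sin ((d1%:R - d2%:R) * t / 2)).
rewrite mulr2n; lra.
Qed.

Variables (D : set nat) (z1 z2 : R).
Hypotheses (z10 : 0 < z1) (Dn0 : exists d, D d).

Local Notation law z := (tilt D z (SetD D z)).

(* These [g] form a subgroup of [int], which therefore contains the gcd of the
   differences of [D]. *)
Definition gap_controlled (g : int) := exists (C : R) (T0 : nat), 0 <= C /\
  forall z T mu t, z1 <= z <= z2 -> (T0 <= T)%N ->
    sin (g%:~R * t / 2) ^+ 2 <=
    C * (1 - Normc.normc (charf (facpoly (law z) T 0) mu t) ^+ 2).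

(** For [d] in [D], a lower bound of the tilted probability common to all [z] in [[z1, z2]]: [z^d]
    is bounded below at [z1], and [SetD D z] above by [exp z2]. *)
Definition pmin (d : nat) : R := z1 ^+ d / d`!%:R / expR z2.

Lemma pmin_gt0 d : 0 < pmin d.
Proof. by rewrite /pmin !divr_gt0 ?exprn_gt0 ?expR_gt0 ?ltr0n ?fact_gt0. Qed.

Lemma tilt_ge_pmin z d : z1 <= z <= z2 -> D d -> pmin d <= law z d.
Proof.
move=> /andP[zz1 zz2] Dd; have z0 := lt_le_trans z10 zz1.
have f0 : 0 < d`!%:R :> R by rewrite ltr0n fact_gt0.
rewrite /tilt mem_set// mul1r /pmin; apply: ler_pM.
- by rewrite divr_ge0 ?exprn_ge0// ltW.
- by rewrite invr_ge0 expR_ge0.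
- by rewrite ler_wpM2r ?invr_ge0 ?(ltW f0)// lerXn2r ?nnegrE// ltW.
- rewrite lef_pV2 ?posrE ?expR_gt0 ?SetD_gt0//.
  by rewrite (le_trans (SetD_le_expR _ (ltW z0)))// ler_expR.
Qed.

Lemma sum_tilt_le1 z T : z1 <= z -> \sum_(d < T) law z d <= 1.
Proof.
move=> zz1; have z0 := lt_le_trans z10 zz1.
exact: (series_le_lim (tilt_ge0 z0 Dn0) (cvg_tilt0 z0 Dn0)).
Qed.

Lemma gap_controlled_diff (d1 d2 : nat) : D d1 -> D d2 -> gap_controlled (d1%:Z - d2%:Z).
Proof.
move=> D1 D2; exists (pmin d1 * pmin d2)^-1, (maxn d1 d2).+1.
have pp : 0 < pmin d1 * pmin d2 by rewrite mulr_gt0 ?pmin_gt0.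
split; first by rewrite invr_ge0 ltW.
move=> z T mu t zI; rewrite gtn_max => /andP[d1T d2T].
have z0 : 0 < z by case/andP: zI => + _; exact: lt_le_trans.
rewrite [leRHS]mulrC ler_pdivlMr// mulrC rmorphB /= -!pmulrn.
apply: le_trans (charf_gap (d1 := d1) (d2 := d2) mu t (tilt_ge0 z0 Dn0) _ d1T d2T).
  rewrite ler_wpM2r ?sqr_ge0//; apply: ler_pM; rewrite ?(ltW (pmin_gt0 _))//; exact: tilt_ge_pmin.
by apply: sum_tilt_le1; case/andP: zI.
Qed.

(** From [sin^2 (x - y) <= 2 (sin^2 x + sin^2 y)]. *)
Lemma gap_controlledB g h : gap_controlled g -> gap_controlled h -> gap_controlled (g - h).
Proof.
move=> [C [T [C0 HC]]] [C' [T' [C'0 HC']]]; exists (2 * (C + C')), (maxn T T').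
split; first by rewrite mulr_ge0// addr_ge0.
move=> z U mu t zI; rewrite geq_max => /andP[TU T'U].
have h1 := HC z U mu t zI TU; have h2 := HC' z U mu t zI T'U.
set x := sin _ ^+ 2 in h1; set y := sin _ ^+ 2 in h2.
set G := 1 - _ in h1 h2 *.
apply: (@le_trans _ _ (2 * (x + y))); last first.
  by rewrite -mulrA ler_wpM2l// mulrDl lerD.
have -> : (g - h)%:~R * t / 2 = g%:~R * t / 2 - h%:~R * t / 2 :> R.
  by rewrite rmorphB /=; ring.
rewrite sinB /x /y; set a := g%:~R * t / 2; set b := h%:~R * t / 2.
have ca : cos a ^+ 2 <= 1 by rewrite cos2sin2 gerBl sqr_ge0.
have cb : cos b ^+ 2 <= 1 by rewrite cos2sin2 gerBl sqr_ge0.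
apply: (@le_trans _ _ (2 * ((sin a * cos b) ^+ 2 + (cos a * sin b) ^+ 2))).
  rewrite -subr_ge0 (_ : _ - _ = (sin a * cos b + cos a * sin b) ^+ 2) ?sqr_ge0//; ring.
rewrite ler_wpM2l// !exprMn lerD//; first by rewrite ler_piMr ?sqr_ge0.
by rewrite ler_piMl ?sqr_ge0.
Qed.

Lemma gap_controlled0 : gap_controlled 0.
Proof. by case: Dn0 => d Dd; rewrite -(subrr d%:Z); exact: gap_controlled_diff. Qed.

Lemma gap_controlledN g : gap_controlled g -> gap_controlled (- g).
Proof. by move=> h; rewrite -sub0r; apply: gap_controlledB => //; exact: gap_controlled0. Qed.

Lemma gap_controlledMn g (k : nat) : gap_controlled g -> gap_controlled (g *+ k).
Proof.
move=> h; elim: k => [|k IH]; first exact: gap_controlled0.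
by rewrite mulrSr -[g in _ + g]opprK; apply: gap_controlledB => //; exact: gap_controlledN.
Qed.

Lemma gap_controlledMz g (k : int) : gap_controlled g -> gap_controlled (g * k).
Proof.
move=> h; case: k => k; first by rewrite -[Posz k]natz mulr_natr; exact: gap_controlledMn.
by rewrite NegzE mulrN -[Posz _]natz mulr_natr; apply/gap_controlledN/gap_controlledMn.
Qed.

(** By Euclidean division the least positive controlled integer divides every difference of [D],
    hence divides [q], and multiples of a controlled integer are controlled. *)
Lemma gap_controlled_gcd (q : nat) (d1 d2 : nat) : D d1 -> D d2 -> d1 <> d2 ->
  is_gcd_diff D q -> gap_controlled q.
Proof.
move=> D1 D2 d12 [_ qmax].
pose P (g : nat) := (0 < g)%N && `[< gap_controlled g%:Z >].
have exP : exists g, P g.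
  exists `|d1%:Z - d2%:Z|%N; rewrite /P absz_gt0 subr_eq0 eqz_nat.
  have /eqP -> /= := d12; apply/asboolP.
  have := gap_controlled_diff D1 D2; set x := d1%:Z - d2%:Z.
  have [x0|x0] := leP 0 x; first by rewrite gez0_abs.
  by rewrite ltz0_abs//; exact: gap_controlledN.
have [g /andP[g0 /asboolP gG] gmin] := ex_minnP exP.
have gdvd e1 e2 : D e1 -> D e2 -> (g%:Z %| e1%:Z - e2%:Z)%Z.
  move=> E1 E2; have gx := gap_controlled_diff E1 E2; set x := e1%:Z - e2%:Z in gx *.
  have gm : gap_controlled (x %% g%:Z)%Z.
    have -> : (x %% g%:Z)%Z = x - (x %/ g%:Z)%Z * g%:Z.
      by rewrite [X in X - _](divz_eq x g%:Z) addrAC subrr add0r.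
    apply: gap_controlledB => //.
    by rewrite mulrC; exact: gap_controlledMz.
  have m0 : (0 <= x %% g%:Z)%Z by rewrite modz_ge0// -lt0n.
  have mg : (x %% g%:Z < g%:Z)%Z by rewrite ltz_pmod// ltz_nat.
  case E : (x %% g%:Z)%Z m0 mg gm => [k|//] _; rewrite ltz_nat => kg gk.
  have [k0|k0] := posnP k; first by apply/dvdz_mod0P; rewrite E k0.
  have : P k by rewrite /P k0; apply/asboolP.
  by move/gmin; rewrite leqNgt kg.
have /dvdnP[k ->] := qmax g gdvd.
by rewrite PoszM mulrC; exact: gap_controlledMz.
Qed.

End Decay.

(** * Uniform constants for the tilted laws *)

Section UniformLaw.
Context {R : realType}.

Lemma gcd_diff_gt0 (D : set nat) (q d1 d2 : nat) : D d1 -> D d2 -> d1 <> d2 ->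
  is_gcd_diff D q -> (0 < q)%N.
Proof.
move=> D1 D2 d12 [qD _]; rewrite lt0n; apply/negP => /eqP q0.
have := qD _ _ D1 D2; rewrite q0 dvd0z subr_eq0 eqz_nat => /eqP; exact: d12.
Qed.

Lemma gcd_diff_mod (D : set nat) (r q d : nat) : is_min D r -> is_gcd_diff D q ->
  D d -> d = r %[mod q].
Proof.
move=> [Dr rD] [qD _] Dd; have rd : (r <= d)%N by exact: rD.
have := qD _ _ Dd Dr; rewrite subzn// => qdr.
by apply/eqP; rewrite eqn_mod_dvd.
Qed.

Section FixedSaddle.
Variables (D : set nat) (r q : nat) (z1 z2 a b C : R) (T0 d1 d2 : nat).
Hypotheses (hr : is_min D r) (hq : is_gcd_diff D q) (D1 : D d1) (D2 : D d2) (d12 : d1 <> d2).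
Hypotheses (z10 : 0 < z1) (a0 : 0 < a) (C0 : 0 <= C).
Hypothesis gapC : forall z T mu t, z1 <= z <= z2 -> (T0 <= T)%N ->
    sin (q%:Z%:~R * t / 2) ^+ 2 <=
    C * (1 - Normc.normc (charf (facpoly (tilt D z (SetD D z)) T 0) mu t) ^+ 2).

Let Zmin : R := z1 ^+ r / r`!%:R.
Let G : R := expR (z2 * expR 1) / Zmin.
(** [24 = 4!]: for [X = d + b + 1] one has [X^4 <= 4! exp X], and [X] majorizes [1], [d] and
    [|d - mu|]. *)
Let M : R := 24 * expR (b + 1).
Let CC : R := M * G.

(** [CC] bounds the moments. [CC / a ^+ 2] bounds the truncation errors: the cut [2 m + 1] exceeds
    [a n], and [tilt_tail] gives the inverse square of the cut. *)
Definition law_E : R := 2 * CC + CC / a ^+ 2 + 1.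
(** Each factor is increased by [1] so as to be at least [1]; the fixed factor [expR z2 / Zmin] of
    the factorial moments is then absorbed into the [k]-th power for [k > 0]. *)
Definition law_A : R := (z2 + 1) * (expR z2 / Zmin + 1).
(* [288 = 2 * 144], from [sin (q t / 2) ^ 2 >= t ^ 2 / 144] on the Fourier window. *)
Definition law_c : R := Num.min ((288 * (C + 1))^-1)
  (Num.min (pmin z1 z2 d1) (pmin z1 z2 d2) / 4).

Let Zmin0 : 0 < Zmin.
Proof. by rewrite divr_gt0 ?exprn_gt0// ltr0n fact_gt0. Qed.

Let M0 : 0 <= M. Proof. by rewrite mulr_ge0 ?expR_ge0. Qed.
Let G0 : 0 <= G. Proof. by rewrite divr_ge0 ?expR_ge0// ltW. Qed.
Let CC0 : 0 <= CC. Proof. exact: mulr_ge0. Qed.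
Let CCa0 : 0 <= CC / a ^+ 2. Proof. by rewrite divr_ge0// sqr_ge0. Qed.

Lemma law_E_ge1 : 1 <= law_E.
Proof. by rewrite /law_E lerDr addr_ge0// mulr_ge0. Qed.

Lemma law_c_gt0 : 0 < law_c.
Proof.
rewrite lt_min invr_gt0 mulr_gt0 ?ltr_wpDl//=.
by rewrite divr_gt0// lt_min !pmin_gt0.
Qed.

Lemma lattice_law_tilt n m z : z1 <= z <= z2 -> (0 < n)%N -> (T0 <= (2 * m).+1)%N ->
  a * n%:R <= (2 * m)%:R -> 0 <= phi D z <= b ->
  lattice_law r q law_c law_E law_A n (tilt D z (SetD D z)) (2 * m).+1
    (phi D z) (tvar D z) (tfac2 D z).
Proof.
move=> zI n0 T0m am /andP[mu0 mub].
have [zz1 zz2] : z1 <= z /\ z <= z2 by apply/andP.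
have z0 := lt_le_trans z10 zz1; have z20 := lt_le_trans z0 zz2.
have Dn0 : exists d, D d by exists d1.
set p := tilt D z (SetD D z); set mu := phi D z; set T := (2 * m).+1.
have p0 : forall d, 0 <= p d := tilt_ge0 z0 Dn0.
have q0 := gcd_diff_gt0 D1 D2 d12 hq.
have Z0 : 0 < SetD D z := SetD_gt0 z0 Dn0.
have ZZ : Zmin <= SetD D z.
  case: hr => Dr _; apply: le_trans (SetD_ge_term (ltW z0) Dr).
  by rewrite ler_wpM2r ?invr_ge0// lerXn2r ?nnegrE// ltW.
have GZ : expR (z * expR 1) / SetD D z <= G.
  apply: ler_pM; rewrite ?expR_ge0 ?invr_ge0 ?(ltW Z0)//.
    by rewrite ler_expR ler_wpM2r ?expR_ge0.
  by rewrite lef_pV2.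
pose X (d : nat) : R := d%:R + (b + 1).
have b0 : 0 <= b by exact: le_trans mub.
have X1 d : 1 <= X d by rewrite /X addrA lerDr addr_ge0.
have X0 d : 0 <= X d by exact: le_trans (X1 d).
have XM d j : (j <= 4)%N -> X d ^+ j <= M * expR d%:R.
  move=> j4; apply: (@le_trans _ _ (X d ^+ 4)); first by rewrite ler_weXn2l.
  by rewrite (le_trans (pow_le_expR 4 (X0 d)))// /X expRD /M; rewrite -mulrA [expR _ * expR _]mulrC.
have dX d : `|d%:R - mu| <= X d.
  have d0 : 0 <= d%:R :> R by [].
  by rewrite ler_norml /X; apply/andP; split; move: mub mu0 d0 b0; rewrite -/mu; lra.
have d2X d : (d ^_ 2)%:R <= X d ^+ 2.
  apply: (@le_trans _ _ (d%:R ^+ 2)).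
    by rewrite -natrX ler_nat ffactnS ffactn1 -mulnn leq_mul2l leq_pred orbT.
  by rewrite lerXn2r ?nnegrE// lerDl addr_ge0.
have mom (f : nat -> R) j : (j <= 4)%N -> (forall d, 0 <= f d <= X d ^+ j) ->
    \sum_(d < T) f d * p d <= CC.
  move=> j4 fX.
  have -> : \sum_(d < T) f d * p d = \sum_(d < T) `|f d| * p d.
    by apply: eq_bigr => d _; case/andP: (fX d) => f0 _; rewrite ger0_norm.
  apply: (le_trans (tilt_moment_le z0 Dn0 T M0 _)); last by rewrite ler_wpM2l.
  move=> d; case/andP: (fX d) => f0 f1; rewrite ger0_norm// (le_trans f1)//.
  exact: XM.
have CCE : CC <= law_E by rewrite /law_E; move: CC0 CCa0; lra.
have tail (f : nat -> R) l : (forall d, `|f d| <= X d ^+ 2) ->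
    series (fun d => f d * p d) @ \oo --> l ->
    `|\sum_(d < T) f d * p d - l| <= CC / a ^+ 2 * n%:R^-1 ^+ 2.
  move=> fX fl.
  have fM d : `|f d| * d%:R ^+ 2 <= M * expR d%:R.
    apply: le_trans (XM d 4%N (leqnn _)); rewrite (_ : X d ^+ 4 = X d ^+ 2 * X d ^+ 2); last by rewrite -exprD.
    apply: ler_pM => //.
    by rewrite lerXn2r ?nnegrE// lerDl addr_ge0.
  apply: (le_trans (tilt_tail z0 Dn0 M0 (ltn0Sn _) fM fl)).
  rewrite -/T -[leRHS]mulrA; have T1 : 0 < T%:R :> R by rewrite ltr0n.
  have n1 : 0 < n%:R :> R by rewrite ltr0n.
  apply: ler_pM.
  - by rewrite mulr_ge0// divr_ge0 ?expR_ge0// ltW.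
  - by rewrite invr_ge0 sqr_ge0.
  - by rewrite ler_wpM2l.
  - rewrite exprVn -invfM lef_pV2 ?posrE ?mulr_gt0 ?exprn_gt0// -exprMn.
    rewrite lerXn2r ?nnegrE ?mulr_ge0 ?(ltW a0)//.
    by rewrite (le_trans am)// ler_nat.
have tailE (f : nat -> R) l : (forall d, `|f d| <= X d ^+ 2) ->
    series (fun d => f d * p d) @ \oo --> l ->
    `|\sum_(d < T) f d * p d - l| <= law_E * n%:R^-1 ^+ 2.
  move=> fX /(tail _ _ fX) /le_trans; apply; rewrite ler_wpM2r ?sqr_ge0//.
  by rewrite /law_E; move: CC0; lra.
have facA k : z ^+ k * SetD (set_sub D k) z / SetD D z <= z2 ^+ k * (expR z2 / Zmin).
  rewrite -mulrA; apply: ler_pM.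
  - by rewrite exprn_ge0// ltW.
  - by rewrite divr_ge0 ?SetD_ge0 ?ltW.
  - by rewrite lerXn2r ?nnegrE// ltW.
  - apply: ler_pM; rewrite ?SetD_ge0 ?invr_ge0 ?(ltW z0) ?(ltW Z0)//.
      by rewrite (le_trans (SetD_le_expR _ (ltW z0)))// ler_expR.
    by rewrite lef_pV2.
have facA' k : (0 < k)%N -> z2 ^+ k * (expR z2 / Zmin) <= law_A ^+ k.
  move=> k0; have g0 : 0 <= expR z2 / Zmin by rewrite divr_ge0 ?expR_ge0 ?ltW.
  rewrite /law_A exprMn; apply: ler_pM => //.
  - by rewrite exprn_ge0// ltW.
  - by rewrite lerXn2r ?nnegrE ?addr_ge0 ?(ltW z20)// lerDl.
  - rewrite (@le_trans _ _ (expR z2 / Zmin + 1))// ?lerDl//.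
    rewrite -[leLHS]expr1 ler_weXn2l// lerDr//.
have tv : tvar D z <= law_E.
  have sqX d : `|(d%:R - mu) ^+ 2| <= X d ^+ 2.
    by rewrite normrX lerXn2r ?nnegrE.
  have := tail _ _ sqX (cvg_tilt_var z0 Dn0).
  have m2 : \sum_(d < T) (d%:R - mu) ^+ 2 * p d <= CC.
    apply: (mom (fun d => (d%:R - mu) ^+ 2) 2%N) => // d.
    by rewrite sqr_ge0 /= (le_trans (ler_norm _)).
  have n1 : CC / a ^+ 2 * n%:R^-1 ^+ 2 <= CC / a ^+ 2.
    by rewrite ler_piMr// expr_le1// ?invr_ge0// invf_le1 ?ltr0n// ler1n.
  rewrite ler_norml => /andP[h _]; rewrite /law_E; move: h m2 n1 CC0.
  by set S := \sum_(_ < _) _; lra.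
have E1 := law_E_ge1.
have tc : 2 * law_c <= tvar D z.
  apply: le_trans (tilt_var_ge z0 Dn0 D1 D2 d12).
  have : law_c <= Num.min (pmin z1 z2 d1) (pmin z1 z2 d2) / 4 by rewrite ge_min lexx orbT.
  have : Num.min (pmin z1 z2 d1) (pmin z1 z2 d2) <= Num.min (p d1) (p d2).
    by rewrite le_min !ge_min !(tilt_ge_pmin z10 Dn0 zI)// orbT.
  rewrite -/p; lra.
have swap (f : nat -> R) : \sum_(d < T) p d * f d = \sum_(d < T) f d * p d.
  by apply: eq_bigr => d _; rewrite mulrC.
constructor.
- exact: p0.
- move=> d; rewrite /p /tilt; case: (boolP (d \in D)) => [/set_mem Dd _|_].
    exact: gcd_diff_mod hr hq Dd.
  by rewrite !mul0r eqxx.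
- rewrite (swap (fun d => `|d%:R - mu| ^+ 3)); apply: le_trans CCE.
  apply: (mom (fun d => `|d%:R - mu| ^+ 3) 3%N) => // d.
  by rewrite exprn_ge0//= lerXn2r ?nnegrE.
- rewrite (swap (fun d => (d%:R - mu) ^+ 4)); apply: le_trans CCE.
  apply: (mom (fun d => (d%:R - mu) ^+ 4) 4%N) => // d.
  have -> : (d%:R - mu) ^+ 4 = `|d%:R - mu| ^+ 4.
    by rewrite -[4%N]/(2 * 2)%N !exprM real_normK ?num_real.
  by rewrite exprn_ge0//= lerXn2r ?nnegrE.
- under eq_bigr do rewrite mulrAC.
  apply: le_trans CCE; apply: (mom (fun d => (d ^_ 2)%:R * `|d%:R - mu|) 3%N) => // d.
  by rewrite mulr_ge0//= exprSr; apply: ler_pM.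
- under eq_bigr do rewrite mulrAC.
  apply: le_trans CCE; apply: (mom (fun d => (d ^_ 2)%:R * (d%:R - mu) ^+ 2) 4%N) => // d.
  rewrite mulr_ge0 ?sqr_ge0//= -[4%N]/(2 + 2)%N exprD; apply: ler_pM; rewrite ?sqr_ge0//.
  by rewrite -real_normK ?num_real// lerXn2r ?nnegrE.
- move=> k; have [->|k0] := posnP k.
    rewrite expr0; under eq_bigr do rewrite ffactn0 mul1r.
    exact: sum_tilt_le1 z10 Dn0 _ _ zz1.
  by apply: le_trans (facA' k k0); apply: le_trans (facA k); exact: tilt_fac_le.
- under eq_bigr do rewrite -[p _]mul1r.
  apply: (tailE (fun=> 1)) => [d|].
    by rewrite normr1 expr_ge1.
  by under eq_fun do rewrite mul1r; exact: cvg_tilt0.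
- rewrite (swap (fun d => d%:R - mu)) -[X in `|X|]subr0.
  apply: (tailE (fun d => d%:R - mu)) => [d|]; last exact: cvg_tilt_mean0.
  by rewrite (le_trans (dX d))// expr2 ler_peMr.
- rewrite (swap (fun d => (d%:R - mu) ^+ 2)).
  apply: (tailE (fun d => (d%:R - mu) ^+ 2)) => [d|]; last exact: cvg_tilt_var.
  by rewrite normrX lerXn2r ?nnegrE.
- apply: (tailE (fun d => (d ^_ 2)%:R)) => [d|]; last exact: cvg_tilt_fac.
  by rewrite ger0_norm.
- apply/andP; split.
    by rewrite /tfac2 divr_ge0 ?mulr_ge0 ?sqr_ge0 ?SetD_ge0 ?ltW.
  by apply: le_trans (facA' 2%N isT); exact: facA.
- by rewrite tc.
- move=> t tq.
  have h := gapC mu t zI T0m.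
  set U := Normc.normc _ ^+ 2 in h *.
  have U1 : 0 <= 1 - U.
    (* With both degrees equal to [0] the left side vanishes, and what remains says that the modulus
       is at most [1]. *)
    have := charf_gap (d1 := 0) (d2 := 0) mu t p0 (sum_tilt_le1 z10 Dn0 _ zz1) (ltn0Sn (2 * m)) (ltn0Sn _).
    by rewrite subrr !mul0r sin0 expr0n mulr0.
  have qr : 1 <= q%:R :> R by rewrite ler1n.
  have qr0 : 0 < q%:R :> R by rewrite ltr0n.
  pose x := q%:R * `|t| / 2.
  have x0 : 0 <= x <= pi / 2.
    rewrite /x !mulr_ge0//= ler_wpM2r//.
    by move: tq; rewrite ler_pdivlMr// mulrC.
  have sx : sin (q%:Z%:~R * t / 2) ^+ 2 = sin x ^+ 2.
    rewrite /x -pmulrn; case: (leP 0 t) => t0; rewrite ?(ger0_norm t0)// ltr0_norm//.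
    by rewrite mulrN mulNr sinN sqrrN.
  have s6 := sin_ge_linear x0.
  have : (x / 6) ^+ 2 <= sin x ^+ 2.
    by case/andP: x0 => x0 _; rewrite lerXn2r ?nnegrE ?divr_ge0// (le_trans _ s6)// divr_ge0.
  rewrite -sx => /le_trans /(_ h) h2.
  have h3 : t ^+ 2 / 144 <= (C + 1) * (1 - U).
    apply: le_trans (le_trans h2 _); last by rewrite ler_wpM2r// lerDl.
    have -> : (x / 6) ^+ 2 = q%:R ^+ 2 * (`|t| ^+ 2 / 144) by rewrite /x; field.
    by rewrite real_normK ?num_real// ler_peMl ?divr_ge0 ?sqr_ge0// expr_ge1.
  have C1 : 0 < C + 1 by rewrite ltr_wpDl.
  have cc : law_c <= (288 * (C + 1))^-1 by rewrite ge_min lexx.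
  have : 2 * law_c * t ^+ 2 <= 1 - U; last lra.
  apply: (@le_trans _ _ (2 * (288 * (C + 1))^-1 * t ^+ 2)).
    by rewrite ler_wpM2r ?sqr_ge0// ler_wpM2l.
  have -> : 2 * (288 * (C + 1))^-1 * t ^+ 2 = t ^+ 2 / 144 / (C + 1).
    by field; rewrite gt_eqF.
  by rewrite ler_pdivrMr// [leRHS]mulrC.
Qed.

End FixedSaddle.
End UniformLaw.

(** * Sums over patches *)

Section PatchSums.
Context {R : realType}.
Variables (n m : nat).
Local Notation pair := ('I_n * 'I_n)%type.
Local Notation pf := {ffun pair -> 'I_m.+1}.
Implicit Types (w : R) (e : pair).

(** The order of magnitude of a pair with positive multiplicity: an edge effectively starts at
    multiplicity [2], a loop at [1]. Times [-1/2], it is also the leading term of the signed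
    series. *)
Definition patchg w e : R :=
  if (e.1 < e.2)%N then w ^+ 2 else if e.1 == e.2 then w else 0.

Definition patchab e k : R := `|@patchc R n e k|.

(** Multiplicities beyond the leading one, which cost an additional factor [w]. *)
Definition heavy e k : bool :=
  if (e.1 < e.2)%N then (2 < k)%N else if e.1 == e.2 then (1 < k)%N else false.

Lemma patchc0 e : @patchc R n e 0 = 1.
Proof.
rewrite /patchc; case: ifP => _; last case: ifP => _ //.
  by rewrite !expr0 subr0 !mul1r invr1.
by rewrite expr0 mul1r invr1.
Qed.

Lemma patchab0 e : patchab e 0 = 1.
Proof. by rewrite /patchab patchc0 normr1. Qed.

(** For an edge the terms [k / (k + 1)!] telescope to [1 - 1 / m!]; a loop is compared with the
    geometric series of ratio [1/2]. *)
Lemma sum_patchab_le1 e : \sum_(k < m) patchab e k.+1 <= 1.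
Proof.
have rf k : 0 < k`!%:R :> R by rewrite ltr0n fact_gt0.
rewrite /patchab /patchc; case: (e.1 < e.2)%N; last case: (e.1 == e.2).
- suff -> : \sum_(k < m) `|(- 1) ^+ k.+1 * (1 - k.+1%:R) / k.+1`!%:R| = 1 - m`!%:R^-1 :> R.
    by rewrite gerBl invr_ge0 ltW.
  elim: (m) => [|l IH]; first by rewrite big_ord0 invr1 subrr.
  rewrite big_ord_recr /= IH normrM normfV (ger0_norm (ltW (rf l.+1))) normrM normrX normrN1 expr1n mul1r.
  rewrite -[l.+1%:R]natr1 opprD addrCA subrr addr0 normrN normr_nat.
  have := rf l; rewrite factS natrM -natr1 => fl.
  have l1 : l%:R + 1 != 0 :> R by rewrite natr1 pnatr_eq0.
  by field; rewrite l1 gt_eqF.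
- suff : \sum_(k < m) `|(- (1 / 2)) ^+ k.+1 / k.+1`!%:R| <= 1 - (1 / 2) ^+ m :> R.
    by move/le_trans; apply; rewrite gerBl exprn_ge0.
  elim: (m) => [|l IH]; first by rewrite big_ord0 expr0 subrr.
  rewrite big_ord_recr /= (le_trans (lerD IH (lexx _)))//.
  have : `|(- (1 / 2)) ^+ l.+1 / l.+1`!%:R| <= (1 / 2) ^+ l.+1 :> R.
    have r0 : 0 <= l.+1`!%:R^-1 :> R by rewrite invr_ge0 ltW.
    have h0 : 0 <= 1 / 2 :> R by [].
    rewrite normrM normrX normrN (ger0_norm h0) (ger0_norm r0) ler_piMr ?exprn_ge0//.
    by rewrite invf_le1// ler1n fact_gt0.
  have -> : (1 / 2) ^+ l.+1 = 1 / 2 * (1 / 2) ^+ l :> R by rewrite exprS.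
  lra.
- by rewrite big1// => k _; rewrite normr0.
Qed.

Lemma sum_active_le w e : 0 <= w <= 1 ->
  \sum_(k < m) patchab e k.+1 * w ^+ k.+1 <= patchg w e.
Proof.
move=> /andP[w0 w1].
suff : \sum_(k < m) patchab e k.+1 * w ^+ k.+1 <= \sum_(k < m) patchab e k.+1 * patchg w e.
  move/le_trans; apply; rewrite -mulr_suml ler_piMl ?sum_patchab_le1//.
  by rewrite /patchg; case: ifP => _; [rewrite sqr_ge0|case: ifP].
apply: ler_sum => k _; rewrite /patchab /patchc /patchg.
case: ifP => _; last case: ifP => _; last by rewrite normr0 !mul0r.
  case: (k : nat) => [|l]; first by rewrite subrr mulr0 mul0r normr0 !mul0r.
  by rewrite ler_wpM2l// ler_wiXn2l.
by rewrite ler_wpM2l// -[leRHS]expr1 ler_wiXn2l.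
Qed.

Lemma sum_heavy_le w e : 0 <= w <= 1 ->
  \sum_(k < m | heavy e k.+1) patchab e k.+1 * w ^+ k.+1 <= w * patchg w e.
Proof.
move=> /andP[w0 w1].
have g0 : 0 <= w * patchg w e.
  by rewrite mulr_ge0// /patchg; case: ifP => _; [rewrite sqr_ge0|case: ifP].
suff : \sum_(k < m | heavy e k.+1) patchab e k.+1 * w ^+ k.+1 <=
    \sum_(k < m) patchab e k.+1 * (w * patchg w e).
  move/le_trans; apply; rewrite -mulr_suml ler_piMl ?sum_patchab_le1//.
rewrite big_mkcond /=; apply: ler_sum => k _.
rewrite /heavy /patchg in g0 *; move: g0; case: (e.1 < e.2)%N; last case: (e.1 == e.2); move=> g0.
- case: ifP => [k2|_]; last by rewrite mulr_ge0// /patchab.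
  by rewrite ler_wpM2l// /patchab// -exprS ler_wiXn2l.
- case: ifP => [k2|_]; last by rewrite mulr_ge0// /patchab.
  by rewrite ler_wpM2l// /patchab// -expr2 ler_wiXn2l.
- by rewrite mulr0 mulr0.
Qed.

Definition patchG w e : R := \sum_(k < m.+1) patchab e k * w ^+ k.

Lemma patchGE w e : patchG w e = 1 + \sum_(k < m) patchab e k.+1 * w ^+ k.+1.
Proof. by rewrite /patchG big_ord_recl patchab0 expr0 mulr1. Qed.

Lemma patchg_ge0 w e : 0 <= w -> 0 <= patchg w e.
Proof. by move=> w0; rewrite /patchg; case: ifP => _; [rewrite sqr_ge0|case: ifP]. Qed.

Lemma patchG_ge1 w e : 0 <= w -> 1 <= patchG w e.
Proof.
by move=> w0; rewrite patchGE lerDl sumr_ge0// => k _; rewrite mulr_ge0 ?exprn_ge0// /patchab.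
Qed.

Lemma patchG_le w e : 0 <= w <= 1 -> patchG w e <= expR (patchg w e).
Proof.
by move=> w01; rewrite patchGE (le_trans _ (expR_ge1Dx _))// lerD2l sum_active_le.
Qed.

Lemma sum_patchg w : 0 <= w ->
  \sum_e patchg w e = n%:R * w + 'C(n, 2)%:R * w ^+ 2.
Proof.
move=> w0.
have -> : \sum_e patchg w e = \sum_(i < n) \sum_(j < n) patchg w (i, j).
  by rewrite pair_big /=; apply: eq_bigr => -[].
have -> : \sum_(i < n) \sum_(j < n) patchg w (i, j) =
   \sum_(j < n) (w + w ^+ 2 * j%:R).
  rewrite exchange_big /=; apply: eq_bigr => j _.
  transitivity (\sum_(i < n) ((if i == j then w else 0) + (if (i < j)%N then w ^+ 2 else 0))).
    apply: eq_bigr => i _; rewrite /patchg /=; case: ifPn => [ij|_]; last by rewrite addr0.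
    by rewrite -val_eqE /= (ltn_eqF ij) add0r.
  rewrite big_split /= -!big_mkcond /= big_pred1_eq; congr (_ + _).
  rewrite -(big_ord_widen _ (fun=> w ^+ 2) (ltnW (ltn_ord j))).
  by rewrite sumr_const card_ord mulr_natr.
rewrite big_split /= sumr_const card_ord mulr_natl; congr (_ + _).
rewrite -mulr_sumr -natr_sum mulrC; congr (_%:R * _).
by rewrite -bin2_sum big_mkord.
Qed.

Lemma sum_patchg_le w : 0 <= w -> \sum_e patchg w e <= n%:R * w + n%:R ^+ 2 * w ^+ 2.
Proof.
move=> w0; rewrite sum_patchg// lerD2l ler_wpM2r ?sqr_ge0//.
rewrite -natrX ler_nat bin2 leq_half_double.
by have := leq_mul (leqnn n) (leq_pred n); rewrite -mulnn; lia.
Qed.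

(** Bounded in [n] when [w] is of order [1/n]: it accounts for [n] loops and at most [n^2] edges. *)
Definition patch_tot w : R := expR (n%:R * w + n%:R ^+ 2 * w ^+ 2).

Lemma prod_patchG_le w : 0 <= w <= 1 -> \prod_e patchG w e <= patch_tot w.
Proof.
move=> w01; have w0 : 0 <= w by case/andP: w01.
apply: (@le_trans _ _ (\prod_e expR (patchg w e))).
  apply: ler_prod => e _; rewrite patchG_le// andbT.
  by rewrite (le_trans ler01)// patchG_ge1.
by rewrite -expR_sum ler_expR sum_patchg_le.
Qed.

Definition abs_patch_weight w (f : pf) : R := \prod_e (patchab e (f e) * w ^+ f e).

Lemma abs_patch_weight_ge0 w f : 0 <= w -> 0 <= abs_patch_weight w f.
Proof. by move=> w0; apply: prodr_ge0 => e _; rewrite mulr_ge0 ?exprn_ge0// /patchab. Qed.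

Lemma sum_abs_patch_le w : 0 <= w <= 1 -> \sum_f abs_patch_weight w f <= patch_tot w.
Proof.
move=> w01; apply: le_trans (prod_patchG_le w01).
by rewrite -(bigA_distr_bigA (fun e (k : 'I_m.+1) => patchab e k * w ^+ k)).
Qed.

Lemma sum_abs_patch_restr w (P : pair -> 'I_m.+1 -> bool) : 0 <= w ->
  \sum_(f : pf | [forall e, P e (f e)]) abs_patch_weight w f =
  \prod_e \sum_(k < m.+1 | P e k) patchab e k * w ^+ k.
Proof.
move=> w0; pose F e (k : 'I_m.+1) : R := if P e k then patchab e k * w ^+ k else 0.
rewrite (eq_bigr (fun e => \sum_(k < m.+1) F e k)); last by move=> e _; rewrite big_mkcond.
rewrite (bigA_distr_bigA F) big_mkcond /=; apply: eq_bigr => f _.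
case: ifPn => [/forallP Pf|]; first by apply: eq_bigr => e _; rewrite /F Pf.
by rewrite negb_forall => /existsP[e /negPf Pe]; rewrite (bigD1 e)//= /F Pe mul0r.
Qed.

(** The absolute sum factors over pairs, so a constraint on the pairs of [S] changes only their
    factors. The full factors are at least [1], so the product outside [S] is at most the full
    product. *)
Let restr_le w (S : {set pair}) (P : pair -> 'I_m.+1 -> bool) (B : pair -> R) : 0 <= w <= 1 ->
  (forall e, e \in S -> 0 <= \sum_(k < m.+1 | P e k) patchab e k * w ^+ k <= B e) ->
  (forall e, e \notin S -> forall k, P e k) ->
  \sum_(f : pf | [forall e, P e (f e)]) abs_patch_weight w f <= (\prod_(e in S) B e) * patch_tot w.
Proof.
move=> w01 HS HnS; have w0 : 0 <= w by case/andP: w01.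
rewrite sum_abs_patch_restr// (bigID (mem S)) /=.
have nS : \prod_(e | e \notin S) \sum_(k < m.+1 | P e k) patchab e k * w ^+ k <= patch_tot w.
  apply: le_trans (prod_patchG_le w01).
  rewrite [leRHS](bigID (mem S)) /= (eq_bigr (patchG w)); last first.
    by move=> e eS; apply: eq_bigl => k; rewrite HnS.
  rewrite ler_peMl//; first by apply: prodr_ge0 => e _; rewrite (le_trans ler01)// patchG_ge1.
  elim/big_ind: _ => // [x y x1 y1|e _]; last exact: patchG_ge1.
  by rewrite -[1]mulr1; apply: ler_pM.
apply: ler_pM => //.
- by apply: prodr_ge0 => e /HS /andP[].
- by apply: prodr_ge0 => e _; apply: sumr_ge0 => k _; rewrite mulr_ge0 ?exprn_ge0// /patchab.
- by apply: ler_prod => e /HS.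
Qed.

Lemma sum_active_itv w e : 0 <= w <= 1 ->
  0 <= \sum_(k < m.+1 | (0 < k)%N) patchab e k * w ^+ k <= patchg w e.
Proof.
move=> w01; have w0 : 0 <= w by case/andP: w01.
rewrite big_mkcond big_ord_recl /= add0r sum_active_le// andbT.
by apply: sumr_ge0 => k _; rewrite mulr_ge0 ?exprn_ge0// /patchab.
Qed.

Lemma sum_heavy_itv w e : 0 <= w <= 1 ->
  0 <= \sum_(k < m.+1 | heavy e k) patchab e k * w ^+ k <= w * patchg w e.
Proof.
move=> w01; have w0 : 0 <= w by case/andP: w01.
rewrite big_mkcond big_ord_recl /=.
have -> : heavy e 0 = false by rewrite /heavy; case: ifP => // _; case: ifP.
rewrite add0r -big_mkcond sum_heavy_le// andbT.
by apply: sumr_ge0 => k _; rewrite mulr_ge0 ?exprn_ge0// /patchab.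
Qed.

Lemma sum_abs_patch_heavy w e0 : 0 <= w <= 1 ->
  \sum_(f : pf | heavy e0 (f e0)) abs_patch_weight w f <= w * patchg w e0 * patch_tot w.
Proof.
move=> w01; pose P e (k : 'I_m.+1) := (e == e0) ==> heavy e k.
have := @restr_le w [set e0]%SET P (fun e => w * patchg w e) w01.
rewrite big_set1; move=> /(_ _ _) h.
rewrite (eq_bigl (fun f : pf => [forall e, P e (f e)])); last first.
  move=> f; apply/idP/forallP => [h0 e|/(_ e0)]; last by rewrite /P eqxx.
  by apply/implyP => /eqP ->.
apply: h => e; rewrite inE.
  move/eqP => ->; rewrite (eq_bigl (fun k : 'I_m.+1 => heavy e0 k)) ?sum_heavy_itv//.
  by move=> k; rewrite /P eqxx.
by move=> /negPf ee k; rewrite /P ee.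
Qed.

Lemma sum_abs_patch_two w e0 e1 : 0 <= w <= 1 -> e0 != e1 ->
  \sum_(f : pf | (0 < f e0)%N && (0 < f e1)%N) abs_patch_weight w f <= patchg w e0 * patchg w e1 * patch_tot w.
Proof.
move=> w01 e01; pose P e (k : 'I_m.+1) := ((e == e0) || (e == e1)) ==> (0 < k)%N.
have := @restr_le w [set e0; e1]%SET P (patchg w) w01.
have -> : \prod_(e in [set e0; e1]%SET) patchg w e = patchg w e0 * patchg w e1.
  by rewrite big_setU1 ?inE//= big_set1.
move=> /(_ _ _) h.
rewrite (eq_bigl (fun f : pf => [forall e, P e (f e)])); last first.
  move=> f; apply/andP/forallP => [[h0 h1] e|H].
    by apply/implyP => /orP[] /eqP ->.
  by split; [have := H e0|have := H e1]; rewrite /P eqxx ?orbT.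
apply: h => e; rewrite !inE.
  move=> ee; rewrite (eq_bigl (fun k : 'I_m.+1 => (0 < k)%N)) ?sum_active_itv//.
  by move=> k; rewrite /P ee.
by move=> /negPf ee k; rewrite /P ee.
Qed.

End PatchSums.

(** * Bad patches and the limit of the signed patch sum *)

Section BadPatches.
Context {R : realType}.
Variables (n m : nat).
Local Notation pair := ('I_n * 'I_n)%type.
Local Notation pf := {ffun pair -> 'I_m.+1}.
Implicit Types (w : R) (e : pair).
Local Notation abs_patch_weight := (@abs_patch_weight R n m).
Local Notation patchg := (@patchg R n).

Definition bad_patch (f : pf) : bool :=
  [exists v, (pdeg f v != 0%N) && (pdeg f v != 2%N)].

Lemma incid_le1 (v : 'I_n) e : (e.1 < e.2)%N -> (incid v e <= 1)%N.
Proof. by move=> e12; rewrite mem_edge// leq_b1. Qed.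

(* A single edge of multiplicity 1 never occurs: its coefficient [1 - k] in
   [patchc] vanishes at [k = 1]. *)
Lemma bad_patch_cases w (f : pf) : bad_patch f -> abs_patch_weight w f != 0 ->
  exists v e, (0 < incid v e)%N /\ (heavy e (f e) \/
    exists2 e', (0 < incid v e')%N && (e' != e) & (0 < f e)%N && (0 < f e')%N).
Proof.
case/existsP => v /andP[d0 d2] /prodf_neq0 fw; exists v.
have c0 e : @patchab R n e (f e) != 0.
  by have := fw e isT; rewrite mulf_eq0 negb_or => /andP[].
have : [exists e, (0 < f e * incid v e)%N].
  apply: contraNT d0; rewrite negb_exists => /forallP H.
  by rewrite /pdeg big1// => e _; apply/eqP; rewrite -leqn0 leqNgt H.
case/existsP => e; rewrite muln_gt0 => /andP[fe ve]; exists e; split => //.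
have [/existsP[e' /and3P[h1 h2 h3]]|] :=
    boolP [exists e', [&& (0 < incid v e')%N, e' != e & (0 < f e')%N]].
  by right; exists e'; rewrite ?h1 ?h2 ?fe ?h3.
rewrite negb_exists => /forallP H; left.
have dE : pdeg f v = (f e * incid v e)%N.
  rewrite /pdeg (bigD1 e)//= big1 ?addn0// => e' ee'.
  by have := H e'; rewrite ee' /= negb_and -!leqNgt !leqn0 => /orP[] /eqP ->; rewrite ?muln0.
rewrite dE in d2; have := c0 e; rewrite /heavy /patchab /patchc.
case: ifPn => [e12|e12].
  have v1 : incid v e = 1%N by apply/eqP; rewrite eqn_leq incid_le1.
  rewrite v1 muln1 in d2; case: (nat_of_ord (f e)) fe d2 => [|[|[|k]]] //= _ _.
  by rewrite subrr mulr0 mul0r normr0 eqxx.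
case: ifPn => [/eqP e1|_].
  have v2 : incid v e = 2%N.
    by move: ve; rewrite /incid e1; case: eqP.
  by rewrite v2 in d2; case: (nat_of_ord (f e)) fe d2 => [|[|k]].
by case: (nat_of_ord (f e)) fe => // k _; rewrite normr0 eqxx.
Qed.

Definition patchg_vertex w (v : 'I_n) : R := \sum_(e | (0 < incid v e)%N) patchg w e.

Lemma patchg_vertex_ge0 w v : 0 <= w -> 0 <= patchg_vertex w v.
Proof. by move=> w0; apply: sumr_ge0 => e _; exact: patchg_ge0. Qed.

Lemma patchg_vertex_le w v : 0 <= w -> patchg_vertex w v <= 2 * (w + n%:R * w ^+ 2).
Proof.
move=> w0; have g0 e := patchg_ge0 e w0.
have w2 : 0 <= w ^+ 2 by exact: sqr_ge0.
apply: (@le_trans _ _ (\sum_(e : pair | e.1 == v) patchg w e + \sum_(e : pair | e.2 == v) patchg w e)).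
  rewrite [X in X + _]big_mkcond [X in _ + X]big_mkcond /patchg_vertex [leLHS]big_mkcond -big_split /=.
  apply: ler_sum => e _; rewrite /incid.
  by case: (e.1 == v); case: (e.2 == v) => /=; rewrite ?addr0 ?add0r// lerDl.
have gle i j : patchg w (i, j) <= (if i == j then w else 0) + w ^+ 2.
  rewrite /patchg /=; case: ifP => _; first by rewrite lerDr; case: ifP.
  by case: ifP => _; rewrite ?lerDl// add0r.
have -> : 2 * (w + n%:R * w ^+ 2) = (w + n%:R * w ^+ 2) + (w + n%:R * w ^+ 2) by ring.
apply: lerD.
- have -> : \sum_(e : pair | e.1 == v) patchg w e = \sum_j patchg w (v, j).
    rewrite (reindex_onto (fun j => (v, j)) (fun e : pair => e.2)) /=; last by case=> i j /= /eqP ->.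
    by apply: eq_bigl => j; rewrite !eqxx.
  rewrite (le_trans (ler_sum _ (fun j _ => gle v j)))// big_split /= sumr_const card_ord mulr_natl lerD2r.
  by rewrite -big_mkcond /= (big_pred1 v)// => j; rewrite eq_sym.
- have -> : \sum_(e : pair | e.2 == v) patchg w e = \sum_j patchg w (j, v).
    rewrite (reindex_onto (fun j => (j, v)) (fun e : pair => e.1)) /=; last by case=> i j /= /eqP ->.
    by apply: eq_bigl => j; rewrite !eqxx.
  rewrite (le_trans (ler_sum _ (fun j _ => gle j v)))// big_split /= sumr_const card_ord mulr_natl lerD2r.
  by rewrite -big_mkcond /= (big_pred1 v).
Qed.

(** A union bound over a vertex and, at this vertex, a heavy pair or two active pairs. For [w] of
    order [1/n] the pairs at a vertex have total [patchg] of order [1/n], so a vertex contributes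
    order [n^-2]. *)
Lemma sum_bad_le w : 0 <= w <= 1 ->
  \sum_(f : pf | bad_patch f) abs_patch_weight w f <=
  n%:R * (w * (2 * (w + n%:R * w ^+ 2)) + (2 * (w + n%:R * w ^+ 2)) ^+ 2) * patch_tot n w.
Proof.
move=> w01; have w0 : 0 <= w by case/andP: w01.
(* Counts witnesses of badness at [v]; over all vertices the count is at least [1] on a bad patch of
   nonzero weight. *)
pose I (f : pf) (v : 'I_n) : R :=
  \sum_(e | (0 < incid v e)%N) ((heavy e (f e))%:R +
    \sum_(e' | (0 < incid v e')%N && (e' != e)) ((0 < f e)%N && (0 < f e')%N)%:R).
have I0 f v : 0 <= I f v.
  by apply: sumr_ge0 => e _; rewrite addr_ge0// sumr_ge0.
have t0 : 0 <= patch_tot n w by exact: expR_ge0.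
apply: (@le_trans _ _ (\sum_f (\sum_v I f v) * abs_patch_weight w f)).
  rewrite big_mkcond /=; apply: ler_sum => f _.
  have aw0 := abs_patch_weight_ge0 f w0.
  case: ifPn => [fb|_]; last by rewrite mulr_ge0// sumr_ge0.
  have [->|awn0] := eqVneq (abs_patch_weight w f) 0; first by rewrite mulr0.
  rewrite ler_peMl//.
  have [v [e [ve H]]] := bad_patch_cases fb awn0.
  rewrite (bigD1 v)//= ler_wpDr ?sumr_ge0//.
  rewrite /I (bigD1 e)//= ler_wpDr ?sumr_ge0//.
    by move=> e' _; rewrite addr_ge0// sumr_ge0.
  case: H => [->|[e' e'P e'f]]; first by rewrite lerDl sumr_ge0.
  by rewrite ler_wpDl// (bigD1 e')//= e'f lerDl sumr_ge0.
under eq_bigr do rewrite mulr_suml.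
rewrite exchange_big /=.
apply: (@le_trans _ _ (\sum_(v < n) (w * patchg_vertex w v + patchg_vertex w v ^+ 2) * patch_tot n w)).
  apply: ler_sum => v _; rewrite /I.
  under eq_bigr do rewrite mulr_suml.
  rewrite exchange_big /=.
  apply: (@le_trans _ _ (\sum_(e | (0 < incid v e)%N) (w * patchg w e * patch_tot n w +
     \sum_(e' | (0 < incid v e')%N && (e' != e)) patchg w e * patchg w e' * patch_tot n w))).
    apply: ler_sum => e ve.
    under eq_bigr do rewrite mulrDl mulr_suml.
    rewrite big_split /= lerD//.
      apply: le_trans (sum_abs_patch_heavy m e w01); rewrite [leRHS]big_mkcond /=.
      by apply: ler_sum => f _; case: ifP; rewrite ?mul1r ?mul0r.
    rewrite exchange_big /=; apply: ler_sum => e' /andP[_ ee'].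
    rewrite eq_sym in ee'; apply: le_trans (sum_abs_patch_two m w01 ee'); rewrite [leRHS]big_mkcond /=.
    by apply: ler_sum => f _; case: ifP; rewrite ?mul1r ?mul0r.
  rewrite mulrDl big_split /= lerD//.
    by rewrite -mulr_suml -mulr_sumr.
  rewrite expr2 {2}/patchg_vertex mulr_suml [leRHS]mulr_suml; apply: ler_sum => e _.
  rewrite /patchg_vertex mulr_sumr mulr_suml [leLHS]big_mkcond [leRHS]big_mkcond /=; apply: ler_sum => e' _.
  case: ifPn => [/andP[-> _]//|_]; case: ifP => // _.
  by rewrite !mulr_ge0 ?patchg_ge0.
rewrite -mulr_suml ler_wpM2r// mulr_natl -[X in _ *+ X](card_ord n) -sumr_const ler_sum// => v _.
have s1 := patchg_vertex_le v w0; have s0 := patchg_vertex_ge0 v w0.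
by rewrite lerD// ?ler_wpM2l// lerXn2r ?nnegrE// (le_trans s0).
Qed.

(** Telescoping; majorants at least [1] allow the omitted factor to be restored, which leaves the
    full product on the right. *)
Lemma normrB_prod (I : Type) (s : seq I) (x y M : I -> R) :
  (forall i, `|x i| <= M i) -> (forall i, `|y i| <= M i) -> (forall i, 1 <= M i) ->
  `|\prod_(i <- s) x i - \prod_(i <- s) y i| <=
  (\sum_(i <- s) `|x i - y i|) * \prod_(i <- s) M i.
Proof.
move=> xM yM M1; have M0 i : 0 <= M i by exact: le_trans (M1 i).
elim: s => [|i s IH]; first by rewrite !big_nil subrr normr0 mul0r.
rewrite !big_cons.
have yP : `|\prod_(j <- s) y j| <= \prod_(j <- s) M j.
  by rewrite normr_prod ler_prod// => j _; rewrite yM normr_ge0.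
have P0 : 0 <= \prod_(j <- s) M j by rewrite prodr_ge0.
have -> : x i * \prod_(j <- s) x j - y i * \prod_(j <- s) y j =
  x i * (\prod_(j <- s) x j - \prod_(j <- s) y j) + (x i - y i) * \prod_(j <- s) y j by ring.
apply: (le_trans (ler_normD _ _)); rewrite !normrM.
have h1 := ler_pM (normr_ge0 _) (normr_ge0 _) (xM i) IH.
have h2 := ler_pM (normr_ge0 (x i - y i)) (normr_ge0 _) (lexx _) yP.
apply: (le_trans (lerD h1 h2)); rewrite mulrDl addrC mulrCA lerD2r.
by rewrite ler_wpM2l// ler_peMl.
Qed.

Definition patchS w e : R := \sum_(k < m.+1) @patchc R n e k * w ^+ k.

Lemma patchg_le w e : 0 <= w <= 1 -> patchg w e <= w.
Proof.
move=> /andP[w0 w1]; rewrite /patchg; case: ifP => _; last by case: ifP.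
by rewrite expr2 ler_piMr.
Qed.

(** The leading coefficient is [-1/2] both for an edge ([k = 2]) and for a loop ([k = 1]), so either
    contributes about [1 - patchg w e / 2]. With [1 < m] the multiplicity [2] is in range. *)
Lemma patchS_approx w e : (1 < m)%N -> 0 <= w <= 1 ->
  `|patchS w e - expR (- (patchg w e / 2))| <= 2 * (w * patchg w e).
Proof.
move=> m1 w01; have w0 : 0 <= w by case/andP: w01.
have g0 := patchg_ge0 e w0; have gw := patchg_le e w01.
have ex := @expRN_taylor1 R (patchg w e / 2) (divr_ge0 g0 (ler0n _ 2)).
have ex2 : (patchg w e / 2) ^+ 2 <= w * patchg w e.
  rewrite expr2; apply: ler_pM; rewrite ?divr_ge0//; lra.
have light : \sum_(k < m.+1 | ~~ heavy e k) patchc e k * w ^+ k = 1 - patchg w e / 2 :> R.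
  case: (m) m1 => [|[|l]]// _.
  rewrite big_mkcond !big_ord_recl /= big1 ?addr0; last first.
    move=> k _; rewrite /heavy /patchc /bump /= !add1n.
    by case: (e.1 < e.2)%N => //=; case: (e.1 == e.2) => //=; rewrite mul0r.
  rewrite /heavy /patchc /patchg /bump /= !add1n !expr0 !expr1.
  case: (e.1 < e.2)%N => /=; last case: (e.1 == e.2) => /=.
  - by rewrite fact0 !factS fact0 !muln1; field.
  - by rewrite fact0 factS fact0 muln1; field.
  - by rewrite !mul0r !addr0 subr0 mulr1.
have -> : patchS w e = (1 - patchg w e / 2) + \sum_(k < m.+1 | heavy e k) patchc e k * w ^+ k.
  by rewrite -light /patchS (bigID (fun k : 'I_m.+1 => heavy e k)) /= addrC.
set Hs := \sum_(_ < _ | _) _.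
have hH : `|Hs| <= w * patchg w e.
  case/andP: (sum_heavy_itv m e w01) => _; apply: le_trans.
  rewrite (le_trans (ler_norm_sum _ _ _))// ler_sum// => k _.
  by rewrite normrM (ger0_norm (exprn_ge0 _ w0)).
have -> : 1 - patchg w e / 2 + Hs - expR (- (patchg w e / 2)) =
  Hs - (expR (- (patchg w e / 2)) - (1 - patchg w e / 2)) by ring.
rewrite (le_trans (ler_normB _ _))//.
have := le_trans ex ex2; lra.
Qed.

(** The loops give the exponent [n w / 2] and the edges [C(n,2) w^2 / 2], which is [(n w / 2)^2] up
    to [n w^2 / 4]: these become [W] and [W^2]. *)
Lemma sum_patchc_approx w : (1 < m)%N -> 0 <= w <= 1 ->
  `|\sum_(f : pf) \prod_e (patchc e (f e) * w ^+ f e)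
     - expR (- (n%:R * w / 2) - (n%:R * w / 2) ^+ 2)| <=
  2 * w * (n%:R * w + n%:R ^+ 2 * w ^+ 2) * patch_tot n w + n%:R * w ^+ 2.
Proof.
move=> m1 w01; have w0 : 0 <= w by case/andP: w01.
rewrite -(bigA_distr_bigA (fun e (k : 'I_m.+1) => patchc e k * w ^+ k)) /=.
set S := \prod_e _.
set T := \sum_e patchg w e.
have h1 : `|S - expR (- (T / 2))| <= 2 * w * (n%:R * w + n%:R ^+ 2 * w ^+ 2) * patch_tot n w.
  have -> : expR (- (T / 2)) = \prod_e expR (- (patchg w e / 2)).
    by rewrite -expR_sum; congr expR; rewrite /T mulr_suml -sumrN.
  apply: (le_trans (normrB_prod (M := fun e => expR (patchg w e)) _ _ _ _)).
  - move=> e; apply: le_trans (patchG_le m e w01).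
    rewrite (le_trans (ler_norm_sum _ _ _))// ler_sum// => k _.
    by rewrite normrM (ger0_norm (exprn_ge0 _ w0)).
  - move=> e; rewrite ger0_norm ?expR_ge0// ler_expR.
    by have := patchg_ge0 e w0; lra.
  - by move=> e; rewrite -expR0 ler_expR patchg_ge0.
  - rewrite -expR_sum; apply: ler_pM; rewrite ?expR_ge0 ?sumr_ge0//.
      apply: (@le_trans _ _ (\sum_e 2 * w * patchg w e)).
        by apply: ler_sum => e _; rewrite -mulrA patchS_approx.
      by rewrite -mulr_sumr ler_wpM2l ?mulr_ge0// sum_patchg_le.
    by rewrite ler_expR sum_patchg_le.
have h2 : `|expR (- (T / 2)) - expR (- (n%:R * w / 2) - (n%:R * w / 2) ^+ 2)| <= n%:R * w ^+ 2.
  have TE : T / 2 + n%:R * w ^+ 2 / 4 = n%:R * w / 2 + (n%:R * w / 2) ^+ 2.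
    rewrite /T sum_patchg//.
    have -> : 'C(n, 2)%:R = (n%:R ^+ 2 - n%:R) / 2 :> R.
      have := bin_ffact n 2; rewrite (_ : 2`! = 2)%N// => /(congr1 (fun k => k%:R : R)).
      rewrite natrM ffactnS ffactn1.
      have -> : (n * n.-1)%:R = n%:R ^+ 2 - n%:R :> R.
        by case: (n) => [|k]; rewrite ?mul0n ?expr0n ?subrr// natrM -natr1 /=; ring.
      by move=> <-; field.
    by field.
  have d0 : 0 <= n%:R * w ^+ 2 / 4 by rewrite divr_ge0// mulr_ge0// sqr_ge0.
  have -> : - (n%:R * w / 2) - (n%:R * w / 2) ^+ 2 = - (T / 2) - n%:R * w ^+ 2 / 4.
    by rewrite -opprD -TE opprD.
  rewrite expRD; set y := expR (- (T / 2)).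
  have y1 : y <= 1.
    rewrite -[leRHS]expR0 ler_expR oppr_le0 divr_ge0// sumr_ge0// => e _; exact: patchg_ge0.
  have y0 : 0 <= y by exact: expR_ge0.
  have ey := expR_ge1Dx (- (n%:R * w ^+ 2 / 4)).
  have ey1 : expR (- (n%:R * w ^+ 2 / 4)) <= 1 by rewrite -[leRHS]expR0 ler_expR oppr_le0.
  rewrite -{1}[y]mulr1 -mulrBr normrM (ger0_norm y0) ger0_norm ?subr_ge0//.
  apply: (@le_trans _ _ (1 * (n%:R * w ^+ 2 / 4))); last by rewrite mul1r; lra.
  by apply: ler_pM; rewrite ?subr_ge0//; lra.
have -> : S - expR (- (n%:R * w / 2) - (n%:R * w / 2) ^+ 2) = (S - expR (- (T / 2))) +
  (expR (- (T / 2)) - expR (- (n%:R * w / 2) - (n%:R * w / 2) ^+ 2)) by ring.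
by rewrite (le_trans (ler_normD _ _))// lerD.
Qed.

End BadPatches.

(** * Asymptotics of the patch expansion *)

Section PatchWeights.
Context {R : realType}.

Definition nnegp (F : {poly R}) := forall j, 0 <= F`_j.

Lemma nnegpM F G : nnegp F -> nnegp G -> nnegp (F * G).
Proof. by move=> F0 G0 j; rewrite coefM sumr_ge0// => i _; rewrite mulr_ge0. Qed.

Lemma nnegp_prod (I : finType) (P : pred I) (F : I -> {poly R}) :
  (forall i, nnegp (F i)) -> nnegp (\prod_(i | P i) F i).
Proof.
move=> F0; elim/big_ind: _ => [j|G H|//]; last exact: nnegpM.
by rewrite coef1; case: eqP.
Qed.

Lemma sum_coef_le (F : {poly R}) k : nnegp F -> \sum_(i < k) F`_i <= F.[1].
Proof.
move=> F0; rewrite horner_coef.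
under [leRHS]eq_bigr do rewrite expr1n mulr1.
have [ks|ks] := leqP k (size F).
  rewrite (big_ord_widen _ (fun i => F`_i) ks) big_mkcond /=.
  by apply: ler_sum => i _; case: ifP.
rewrite [leRHS](big_ord_widen _ (fun i => F`_i) (ltnW ks)) [leRHS]big_mkcond /=.
by apply: ler_sum => i _; case: ltnP => // si; rewrite nth_default.
Qed.

Lemma coefM_le (F G : {poly R}) (K : R) k : nnegp F -> (forall j, `|G`_j| <= K) ->
  `|(F * G)`_k| <= F.[1] * K.
Proof.
move=> F0 GK; have K0 : 0 <= K by exact: le_trans (GK 0%N).
rewrite coefM (le_trans (ler_norm_sum _ _ _))//.
apply: (@le_trans _ _ (\sum_(i < k.+1) F`_i * K)).
  by apply: ler_sum => i _; rewrite normrM ger0_norm// ler_wpM2l.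
by rewrite -mulr_suml ler_wpM2r// sum_coef_le.
Qed.

Lemma coef_le_horner1 (F : {poly R}) k : nnegp F -> `|F`_k| <= F.[1].
Proof.
move=> F0; rewrite ger0_norm//; apply: le_trans (sum_coef_le k.+1 F0).
by rewrite big_ord_recr /= lerDr sumr_ge0.
Qed.

Section Weights.
Variables (r q : nat) (c E A : R) (n m : nat) (p : nat -> R) (mu s2 be : R).
Hypotheses (c0 : 0 < c) (E1 : 1 <= E) (A1 : 1 <= A) (q0 : (0 < q)%N).
Hypothesis L : lattice_law r q c E A n p (2 * m).+1 mu s2 be.
Local Notation B := (facpoly p (2 * m).+1).
Local Notation pf := {ffun 'I_n * 'I_n -> 'I_m.+1}.

Definition patch_weight (f : pf) : R := (\prod_v B (pdeg f v))`_(2 * m).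

Let B0 k : nnegp (B k).
Proof.
by move=> j; rewrite coef_poly; case: ifP => // _; rewrite mulr_ge0 ?(law_ge0 L).
Qed.

Let B1 k : 0 <= (B k).[1] <= A ^+ k.
Proof.
rewrite (le_trans (normr_ge0 _) (coef_le_horner1 0 (B0 k))) /=.
rewrite horner_poly; under eq_bigr do rewrite expr1n mulr1.
exact: (law_fac L).
Qed.

Let prodB1 (P : pred 'I_n) (f : pf) :
  0 <= (\prod_(v | P v) B (pdeg f v)).[1] <= A ^+ (\sum_(v | P v) pdeg f v).
Proof.
rewrite horner_prod expr_sum prodr_ge0 => [|v _]; last by case/andP: (B1 (pdeg f v)).
by rewrite ler_prod// => v _; exact: B1.
Qed.

Lemma patch_weight_le (f : pf) : `|patch_weight f| <= (A ^+ 2) ^+ fsum f.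
Proof.
rewrite -exprM -sum_pdeg; apply: le_trans (coef_le_horner1 _ _) _.
  by apply: nnegp_prod => v; exact: B0.
by case/andP: (prodB1 xpredT f).
Qed.

(** A patch of size at most [n / 4] touches at most [n / 2] vertices. The others supply [B 0 ^+ N]
    with [N >= n / 2], whose coefficients have order [n^{-1/2}]; the touched ones cost their total
    mass. *)
Lemma patch_weight_small (f : pf) : (0 < n)%N -> (4 * fsum f <= n)%N ->
  `|patch_weight f| <= (A ^+ 2) ^+ fsum f *
     (2 * (q%:R / (2 * pi) * Num.sqrt (pi / c)) / Num.sqrt n%:R).
Proof.
move=> n0 fn; rewrite /patch_weight (bigID (fun v => pdeg f v != 0%N)) /=.
set F := \prod_(v | _) _.
have -> : \prod_(v < n | ~~ (pdeg f v != 0%N)) B (pdeg f v) =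
    B 0 ^+ #|[pred v | pdeg f v == 0%N]|.
  rewrite -prodr_const; apply: eq_big => [v|v]; first by rewrite inE negbK.
  by rewrite negbK => /eqP ->.
set N := #|_|.
have nN : (n <= 2 * N)%N.
  have : (#|[pred v | pdeg f v != 0%N]| <= 2 * fsum f)%N.
    rewrite -sum_pdeg -sum1_card [leqRHS](bigID (fun v => pdeg f v != 0%N)) /=.
    apply: leq_trans (leq_addr _ _); apply: leq_sum => v; rewrite inE => fv.
    by rewrite lt0n.
  have := cardC [pred v | pdeg f v == 0%N]; rewrite card_ord -/N.
  rewrite (eq_card (B := [pred v | pdeg f v != 0%N])) //.
  by move: fn; lia.
have N0 : (0 < N)%N by move: n0 nN; lia.
have pi0 := pi_gt0 R.
have k0 : 0 <= q%:R / (2 * pi) * Num.sqrt (pi / c).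
  by rewrite mulr_ge0 ?sqrtr_ge0// divr_ge0// mulr_ge0// ltW.
have sN0 : 0 < Num.sqrt N%:R :> R by rewrite sqrtr_gt0 ltr0n.
have sn0 : 0 < Num.sqrt n%:R :> R by rewrite sqrtr_gt0 ltr0n.
apply: le_trans (coefM_le _ _ (fun j => coef_pow_le c0 q0 L j N0)) _.
  by apply: nnegp_prod => v; exact: B0.
have /andP[F0 F1] := prodB1 (fun v => pdeg f v != 0%N) f.
apply: ler_pM => //.
- by rewrite divr_ge0// ltW.
- rewrite (le_trans F1)// -exprM -sum_pdeg ler_weXn2l//.
  by rewrite [leqRHS](bigID (fun v => pdeg f v != 0%N)) /= leq_addr.
- rewrite ler_pdivrMr// [leRHS]mulrAC ler_pdivlMr//.
  have : Num.sqrt n%:R <= 2 * Num.sqrt N%:R :> R.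
    rewrite -(@ler_pXn2r _ 2) ?nnegrE ?mulr_ge0 ?sqrtr_ge0// exprMn !sqr_sqrtr//.
    by rewrite -natrX -natrM ler_nat; move: nN; lia.
  by move=> /(ler_wpM2l k0) /le_trans; apply; rewrite mulrCA mulrA.
Qed.

(** Degrees being [0] or [2] with sum [2 * fsum f], exactly [fsum f] vertices have degree [2]. *)
Lemma patch_weight_good (f : pf) : ~~ bad_patch f ->
  patch_weight f = (B 2 ^+ fsum f * B 0 ^+ (n - fsum f))`_(2 * m) /\ (fsum f <= n)%N.
Proof.
rewrite negb_exists => /forallP good.
have gd v : pdeg f v = 0%N \/ pdeg f v = 2%N.
  have := good v; rewrite negb_and !negbK => /orP[] /eqP ->; by [left|right].
have c2 : #|[pred v | pdeg f v == 2%N]| = fsum f.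
  have : (\sum_(v < n) pdeg f v = #|[pred v | pdeg f v == 2%N]| * 2)%N.
    rewrite -sum_nat_const [RHS]big_mkcond /=; apply: eq_bigr => v _.
    by rewrite inE; case: (gd v) => ->.
  rewrite sum_pdeg mulnC => /eqP; rewrite eqn_pmul2r// => /eqP ->.
  by [].
have c0' : #|[pred v | pdeg f v != 2%N]| = (n - fsum f)%N.
  have cE := cardC [pred v | pdeg f v == 2%N]; rewrite card_ord c2 in cE.
  have -> : #|[pred v | pdeg f v != 2%N]| = #|predC [pred v | pdeg f v == 2%N]| by exact: eq_card.
  by apply/esym/eqP; rewrite -[X in (X - _)%N == _]cE addKn.
split; last by rewrite -c2 (leq_trans (max_card _))// card_ord.
rewrite /patch_weight; suff -> : \prod_v B (pdeg f v) = B 2 ^+ fsum f * B 0 ^+ (n - fsum f) by [].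
rewrite (bigID (fun v => pdeg f v == 2%N)) /= -[in B 2 ^+ _]c2 -c0' -!prodr_const; congr (_ * _).
- by apply: eq_bigr => v /eqP ->.
- by apply: eq_bigr => v; case: (gd v) => ->.
Qed.

End Weights.

Lemma dfacS k : dfac k.+1 = (2 * k + 1)%:R * dfac k :> R.
Proof.
rewrite /dfac mulnS addSn add1n !factS expnS !natrM.
have f0 : k`!%:R != 0 :> R := natr_fact_neq0 k.
have e0 : (2 ^ k)%:R != 0 :> R by rewrite pnatr_eq0 expn_eq0.
have k0 : k.+1%:R != 0 :> R by rewrite pnatr_eq0.
have -> : (2 * k).+2%:R = 2 * k.+1%:R :> R by rewrite -natrM mulnS.
have -> : (2 * k + 1)%:R = (2 * k).+1%:R :> R by rewrite addn1.
field; rewrite e0 f0 /=.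
by rewrite addrC natr1 pnatr_eq0.
Qed.

Lemma rho0 m : rho m 0 = 1 :> R.
Proof. by rewrite /rho subn0 divff// dfac_neq0. Qed.

Lemma rhoS m h : (h < m)%N -> rho m h = (2 * (m - h.+1) + 1)%:R * rho m h.+1 :> R.
Proof.
move=> hm; rewrite /rho [in RHS]mulrA -dfacS; congr (dfac _ / _).
by rewrite -subSn// subSS.
Qed.

Lemma rho_ge0 m h : 0 <= rho m h :> R.
Proof. by rewrite /rho /dfac !divr_ge0. Qed.

(** Each step multiplies by [2 m / (2 m - 2 h - 1)], a relative error of at most [(2 h + 1) / m].
    These add up to [h^2 / m], and [2 ^+ h] absorbs the cross terms. *)
Lemma rho_approx m h : (2 * h <= m)%N -> (0 < m)%N ->
  1 <= (2 * m)%:R ^+ h * @rho R m h <= 1 + 2 ^+ h * (h%:R ^+ 2 / m%:R).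
Proof.
move=> + m0; have m0' : 0 < m%:R :> R by rewrite ltr0n.
elim: h => [|h IH] hm; first by rewrite !expr0 !mul1r rho0 lexx expr0n mul0r addr0 lexx.
have hm' : (2 * h <= m)%N by move: hm; lia.
have hm1 : (h < m)%N by move: hm; lia.
have /andP[I1 I2] := IH hm'.
rewrite (rhoS hm1) in I1 I2.
set D : R := (2 * (m - h.+1) + 1)%:R in I1 I2.
set y : R := rho m h.+1 in I1 I2 *.
set P : R := (2 * m)%:R ^+ h in I1 I2.
have P0 : 0 <= P by rewrite exprn_ge0.
have Dm : m%:R <= D by rewrite /D ler_nat; move: hm; lia.
have DE : (2 * m)%:R = D + (2 * h%:R + 1) :> R.
  have -> : (2 * m = (2 * (m - h.+1) + 1) + (2 * h + 1))%N by move: hm; lia.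
  by rewrite natrD [X in _ + X]natrD natrM.
have D0 : 0 < D by exact: lt_le_trans Dm.
have h0 : 0 <= h%:R :> R by [].
set X : R := P * (D * y) in I1 I2.
have XE : (2 * m)%:R ^+ h.+1 * y = X * (1 + (2 * h%:R + 1) / D).
  rewrite exprS -/P DE /X; field; by rewrite gt_eqF.
have t1 : (2 * h%:R + 1) / D <= (2 * h%:R + 1) / m%:R.
  by rewrite ler_wpM2l ?addr_ge0 ?mulr_ge0// lef_pV2 ?posrE.
have t0 : 0 <= (2 * h%:R + 1) / D by rewrite divr_ge0 ?addr_ge0 ?mulr_ge0// ltW.
have t2 : (2 * h%:R + 1) / m%:R <= 1 :> R.
  by rewrite ler_pdivrMr// mul1r -natrM natr1 ler_nat; move: hm; lia.
rewrite XE; apply/andP; split.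
  by rewrite -[leLHS]mulr1; apply: ler_pM => //; rewrite lerDl.
apply: (@le_trans _ _ ((1 + 2 ^+ h * (h%:R ^+ 2 / m%:R)) * (1 + (2 * h%:R + 1) / m%:R))).
  by apply: ler_pM => //; rewrite ?lerD2l ?addr_ge0// (le_trans ler01).
set u := (2 * h%:R + 1) / m%:R in t1 t2 *.
set s := h%:R ^+ 2 / m%:R.
have -> : h.+1%:R ^+ 2 / m%:R = s + u.
  by rewrite /s /u -natr1; field; rewrite gt_eqF.
have s0 : 0 <= s by rewrite divr_ge0// sqr_ge0.
have u0 : 0 <= u by exact: le_trans t1.
have e1 : 1 <= 2 ^+ h :> R by rewrite exprn_ege1 ?ler1n//.
rewrite exprS; move: (2 ^+ h : R) e1 => e e1.
rewrite -subr_ge0.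
have -> : 1 + 2 * e * (s + u) - (1 + e * s) * (1 + u) = e * s * (1 - u) + (2 * e - 1) * u by ring.
by rewrite addr_ge0// !mulr_ge0 ?subr_ge0//; lra.
Qed.

(** Serves the patches of size comparable to [n], beyond the range of [rho_approx]. The odd factors
    are compared with [h], [h - 1], and so on, which are no larger since [h <= m]. *)
Lemma rho_le_fact m h : (h <= m)%N -> rho m h <= h`!%:R^-1 :> R.
Proof.
move=> hm; suff : h`!%:R * rho m h <= 1 :> R.
  by rewrite -ler_pdivlMl ?mulr1// ltr0n fact_gt0.
suff H : forall k, (k <= h)%N -> (h`!%:R / (h - k)`!%:R) * rho m k <= 1 :> R.
  by have := H h (leqnn _); rewrite subnn fact0 divr1.
elim=> [_|k IH kh]; first by rewrite subn0 divff ?natr_fact_neq0// mul1r rho0.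
apply: le_trans (IH (ltnW kh)).
rewrite (rhoS (leq_trans kh hm)) [leRHS]mulrA ler_wpM2r ?rho_ge0//.
have -> : (h - k = (h - k.+1).+1)%N by rewrite -subSn.
rewrite factS natrM invfM -[leRHS]mulrA.
rewrite ler_wpM2l// -[leLHS]mul1r mulrAC ler_wpM2r ?invr_ge0//.
rewrite mulrC ler_pdivlMr ?ltr0n// mul1r ler_nat.
by move: kh hm; lia.
Qed.

End PatchWeights.

(** * Comparison of each patch term with its Gaussian value *)

Section PatchTerms.
Context {R : realType}.

(** Turns a polynomial loss in the size [h] into a geometric one, absorbed by the factor [4] in
    [patch_base]. *)
Lemma add1_sqr_le_exp4 h : 1 + h%:R ^+ 2 <= 4 ^+ h :> R.
Proof.
elim: h => [|h IH]; first by rewrite expr0n addr0 expr0.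
rewrite [4 ^+ h.+1]exprS; have h0 : 0 <= h%:R :> R by [].
move: IH; rewrite -(natr1 h); move: (4 ^+ h : R) (h%:R : R) h0 => e x x0; nra.
Qed.

Let leq_half_sub (n h : nat) : (4 * h <= n)%N -> (h <= n - h)%N.
Proof. lia. Qed.
Let half_sub_gt0 (n h : nat) : (0 < n)%N -> (4 * h <= n)%N -> (0 < n - h)%N.
Proof. lia. Qed.

Section FixedTerms.
Variables (r q : nat) (c E A a : R) (n m : nat) (p : nat -> R) (mu s2 be : R).
Hypotheses (c0 : 0 < c) (E1 : 1 <= E) (A1 : 1 <= A) (q0 : (0 < q)%N) (a0 : 0 < a).
Hypotheses (n0 : (0 < n)%N) (am : a * n%:R <= (2 * m)%:R) (mumE : (2 * m)%:R = n%:R * mu)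
  (mcl : (2 * m = n * r %[mod q])%N).
Hypothesis L : lattice_law r q c E A n p (2 * m).+1 mu s2 be.
Local Notation pf := {ffun 'I_n * 'I_n -> 'I_m.+1}.
Local Notation Pw := (patch_weight p).

Definition decay_cst : R := q%:R / (2 * pi) * Num.sqrt (pi / c).
Definition gauss_cst : R := 4 * llt_error q c E.
Definition gauss_main : R := q%:R / (2 * pi) * Num.sqrt (2 * pi / (s2 * n%:R)).
(* Patches of size at most [large_ratio * n] are treated by the local limit
   theorem, larger ones by the factor [1 / h!] in [rho]. *)
Definition large_ratio : R := Num.min (1 / 4) (a / 4).
(** [A ^+ 2] is the mass cost per unit of patch size, and [2 / a] comes from
    [1 / m <= 2 / (a n)]. *)
Definition small_base : R := A ^+ 2 * (2 / a).
(** From [1 / h! <= (e / h)^h] with [h >= large_ratio * n]. *)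
Definition large_base : R := A ^+ 2 * (expR 1 / large_ratio).
Definition patch_base : R := 4 * (small_base + large_base).
Definition good_cst : R := 4 * decay_cst / a + gauss_cst.
Definition term_cst : R := good_cst + 3 * decay_cst + (1 + decay_cst) / large_ratio ^+ 2.

Let M := gauss_main.
Let sn : R := Num.sqrt n%:R.
Let w0 : R := be / (2 * m)%:R.
Let nr : 0 < n%:R :> R. Proof. by rewrite ltr0n. Qed.
Let sn0 : 0 < sn. Proof. by rewrite sqrtr_gt0. Qed.
Let snn : sn ^+ 2 = n%:R. Proof. by rewrite sqr_sqrtr// ltW. Qed.
Let sn1 : 1 <= sn. Proof. by rewrite -[leLHS]sqrtr1 ler_wsqrtr// ler1n. Qed.
Let snle : sn <= n%:R. Proof. by rewrite -snn expr2 ler_peMr// ltW. Qed.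
Let mm0 : 0 < (2 * m)%:R :> R. Proof. by apply: lt_le_trans am; rewrite mulr_gt0. Qed.
Let m0 : (0 < m)%N. Proof. by move: mm0; rewrite ltr0n muln_gt0. Qed.
Let mr : 0 < m%:R :> R. Proof. by rewrite ltr0n. Qed.
Let pi0 := pi_gt0 R.
Let A2 : 1 <= A ^+ 2. Proof. exact: exprn_ege1. Qed.
Let A20 : 0 < A ^+ 2. Proof. exact: lt_le_trans A2. Qed.
Let large_ratio_gt0 : 0 < large_ratio. Proof. by rewrite lt_min !divr_gt0. Qed.
Let decay_cst_ge0 : 0 <= decay_cst.
Proof. by rewrite mulr_ge0 ?sqrtr_ge0// divr_ge0// mulr_ge0// ltW. Qed.
Let gauss_cst_ge0 : 0 <= gauss_cst.
Proof.
have k0 : 0 <= 2 / c by rewrite divr_ge0// ltW.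
have k2 := exprn_ge0 2 k0; have k3 := exprn_ge0 3 k0.
have l0 : 0 <= llt_const c (48 * E ^+ 2).
  rewrite /llt_const divr_ge0 ?sqr_ge0// mulr_ge0 ?sqr_ge0//; lra.
rewrite /gauss_cst mulr_ge0// /llt_error mulr_ge0//.
  by rewrite mulr_ge0 ?sqrtr_ge0// divr_ge0// mulr_ge0// ltW.
by rewrite !addr_ge0// divr_ge0 ?mulr_ge0 ?sqr_ge0// ltW.
Qed.
Let good_cst_ge0 : 0 <= good_cst.
Proof. by apply: addr_ge0 => //; apply: divr_ge0; [exact: mulr_ge0|exact: ltW]. Qed.
Let small_base_gt0 : 0 < small_base. Proof. by rewrite mulr_gt0// divr_gt0. Qed.
Let large_base_gt0 : 0 < large_base. Proof. by rewrite mulr_gt0// divr_gt0// expR_gt0. Qed.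

Lemma gauss_main_le : 0 <= M <= decay_cst / sn.
Proof.
have q1 : 0 <= q%:R / (2 * pi) :> R by rewrite divr_ge0// mulr_ge0// ltW.
case/andP: (law_s2 L) => s2c _; have c0' := c0.
have s20 : 0 < s2 by lra.
have pp := ltW pi0.
have step : Num.sqrt (2 * pi / (s2 * n%:R)) <= Num.sqrt (pi / c) / sn.
  rewrite /sn -sqrtrV ?(ltW nr)// -sqrtrM; last by rewrite divr_ge0// ltW.
  rewrite ler_wsqrtr// invfM mulrA ler_wpM2r ?invr_ge0 ?(ltW nr)//.
  rewrite ler_pdivrMr// [leRHS]mulrAC ler_pdivlMr//.
  have -> : 2 * pi * c = pi * (2 * c) by ring.
  exact: ler_wpM2l.
rewrite /M /gauss_main mulr_ge0 ?sqrtr_ge0//= /decay_cst -[leRHS]mulrA.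
exact: ler_wpM2l.
Qed.

Let m_inv : m%:R^-1 <= 2 / a / n%:R.
Proof.
rewrite -[leRHS]invrK lef_pV2 ?posrE ?invr_gt0 ?divr_gt0//.
rewrite !invfM !invrK; move: am; rewrite natrM; lra.
Qed.

Let Am_le : A ^+ 2 / m%:R <= small_base / n%:R.
Proof. by rewrite /small_base -mulrA ler_wpM2l// ltW. Qed.

Lemma be_div_le : 0 <= w0 <= small_base / n%:R.
Proof.
case/andP: (law_be L) => be0 beA.
rewrite /w0 divr_ge0//=; apply: le_trans Am_le; apply: ler_pM => //.
by rewrite lef_pV2 ?posrE// ler_nat leq_pmull.
Qed.

Lemma rho_div_approx h : (2 * h <= m)%N ->
  `|rho m h - (2 * m)%:R ^- h| <= m%:R ^- h * (h%:R ^+ 2 / m%:R) :> R /\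
  rho m h <= m%:R ^- h * (1 + h%:R ^+ 2) :> R.
Proof.
move=> hm; have /andP[r1 r2] := @rho_approx R m h hm m0.
have P0 : 0 < (2 * m)%:R ^+ h :> R by rewrite exprn_gt0.
have rE : rho m h = (2 * m)%:R ^- h * ((2 * m)%:R ^+ h * rho m h) :> R.
  by rewrite mulrA mulVf ?mul1r// gt_eqF.
have mE : m%:R ^- h = (2 * m)%:R ^- h * 2 ^+ h :> R.
  by rewrite natrM exprMn invfM mulrAC mulVf ?mul1r// expf_neq0.
have Pi : 0 <= (2 * m)%:R ^- h :> R by rewrite invr_ge0 ltW.
split.
  rewrite {1}rE -[X in _ - X]mulr1 -mulrBr normrM ger0_norm// mE -mulrA ler_wpM2l//.
  by rewrite ger0_norm ?subr_ge0// lerBlDl.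
rewrite rE mE -mulrA ler_wpM2l// (le_trans r2)// mulrDr mulr1 lerD//.
  by rewrite exprn_ege1// ler1n.
by rewrite ler_wpM2l ?exprn_ge0// ler_pdivrMr// ler_peMr ?sqr_ge0// ler1n.
Qed.

(** Two replacements: [rho] by [(2 m)^(-h)] and the coefficient by its Gaussian value [be^h M];
    together they form [M * w0 ^+ h]. *)
Lemma patch_term_good (f : pf) : ~~ bad_patch f -> (4 * fsum f <= n)%N -> (2 * fsum f <= m)%N ->
  `|rho m (fsum f) * Pw f - M * w0 ^+ fsum f| <= good_cst * (4 * (small_base / n%:R)) ^+ fsum f / (n%:R * sn).
Proof.
move=> good fn fm; set h := fsum f in fn fm *.
have [rh _] := rho_div_approx fm.
have Ps := patch_weight_small c0 E1 A1 q0 L n0 fn.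
have [PE hn] := patch_weight_good p good.
have hN : (h <= n - h)%N by exact: leq_half_sub.
have N0 : (0 < n - h)%N by exact: half_sub_gt0.
have Pg := coef_pow_gauss c0 E1 A1 q0 L N0 (subnKC hn) hN mumE mcl.
rewrite -PE -/gauss_main -/M -/gauss_cst in Pg; rewrite -/decay_cst in Ps.
have w0E : w0 ^+ h = be ^+ h * (2 * m)%:R ^- h by rewrite /w0 exprMn exprVn.
have Pi : 0 <= (2 * m)%:R ^- h :> R by rewrite invr_ge0 exprn_ge0// ltW.
have -> : rho m h * Pw f - M * w0 ^+ h =
  (rho m h - (2 * m)%:R ^- h) * Pw f + (2 * m)%:R ^- h * (Pw f - be ^+ h * M).
  by rewrite w0E; ring.
rewrite (le_trans (ler_normD _ _))// !normrM (ger0_norm Pi).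
set H := 1 + h%:R ^+ 2 : R.
have H0 : 0 <= H by rewrite addr_ge0// sqr_ge0.
have AB : (A ^+ 2) ^+ h * m%:R ^- h <= (small_base / n%:R) ^+ h.
  by rewrite -exprVn -exprMn; apply: lerXn2r; rewrite ?nnegrE ?divr_ge0 ?(ltW A20) ?(ltW small_base_gt0).
have t1 : `|rho m h - (2 * m)%:R ^- h| * `|Pw f| <=
    (small_base / n%:R) ^+ h * H * (4 * decay_cst / a) / (n%:R * sn).
  apply: (@le_trans _ _ (m%:R ^- h * (h%:R ^+ 2 / m%:R) * ((A ^+ 2) ^+ h * (2 * decay_cst / sn)))).
    by apply: ler_pM.
  have -> : m%:R ^- h * (h%:R ^+ 2 / m%:R) * ((A ^+ 2) ^+ h * (2 * decay_cst / sn)) =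
    ((A ^+ 2) ^+ h * m%:R ^- h) * (h%:R ^+ 2) * (2 * decay_cst / sn * m%:R^-1) by ring.
  have -> : (small_base / n%:R) ^+ h * H * (4 * decay_cst / a) / (n%:R * sn) =
    (small_base / n%:R) ^+ h * H * (2 * decay_cst / sn * (2 / a / n%:R)) by rewrite invfM; ring.
  have AB0 : 0 <= (A ^+ 2) ^+ h * m%:R ^- h.
    by apply: mulr_ge0; rewrite ?invr_ge0 exprn_ge0 ?(ltW A20).
  have X0 : 0 <= 2 * decay_cst / sn by apply: divr_ge0; [exact: mulr_ge0|exact: ltW].
  apply: ler_pM.
  - by apply: mulr_ge0 => //; exact: sqr_ge0.
  - by apply: mulr_ge0 => //; rewrite invr_ge0.
  - by apply: ler_pM => //; rewrite /H lerDr.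
  - exact: ler_wpM2l.
have t2 : (2 * m)%:R ^- h * `|Pw f - be ^+ h * M| <=
    (small_base / n%:R) ^+ h * H * gauss_cst / (n%:R * sn).
  apply: (@le_trans _ _ (m%:R ^- h * (gauss_cst * (A ^+ 2) ^+ h * H / (n%:R * sn)))).
    apply: ler_pM => //.
    by rewrite lef_pV2 ?posrE ?exprn_gt0// lerXn2r ?nnegrE// ler_nat leq_pmull.
  have -> : m%:R ^- h * (gauss_cst * (A ^+ 2) ^+ h * H / (n%:R * sn)) =
    ((A ^+ 2) ^+ h * m%:R ^- h) * (H * gauss_cst / (n%:R * sn)) by ring.
  have -> : (small_base / n%:R) ^+ h * H * gauss_cst / (n%:R * sn) =
    (small_base / n%:R) ^+ h * (H * gauss_cst / (n%:R * sn)) by ring.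
  apply: ler_wpM2r => //; apply: divr_ge0; apply: mulr_ge0 => //; exact: ltW.
apply: (le_trans (lerD t1 t2)); rewrite -mulrDl -mulrDr -/good_cst.
apply: ler_wpM2r; first by rewrite invr_ge0; apply: mulr_ge0 => //; exact: ltW.
rewrite mulrC; apply: ler_wpM2l => //; rewrite [(4 * _) ^+ h]exprMn mulrC; apply: ler_wpM2r.
  by apply: exprn_ge0; rewrite divr_ge0// ltW.
exact: add1_sqr_le_exp4.
Qed.

(** The two terms are bounded separately by the order [n^{-1/2}]. This suffices for bad patches,
    whose total weight already has order [1/n]. *)
Lemma patch_term_small (f : pf) : (4 * fsum f <= n)%N -> (2 * fsum f <= m)%N ->
  `|rho m (fsum f) * Pw f - M * w0 ^+ fsum f| <= 3 * decay_cst * (4 * (small_base / n%:R)) ^+ fsum f / sn.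
Proof.
move=> fn fm; set h := fsum f in fn fm *.
have [_ rh] := rho_div_approx fm.
have Ps := patch_weight_small c0 E1 A1 q0 L n0 fn.
rewrite -/decay_cst in Ps.
have [M0 M1] := andP gauss_main_le.
have [w00 w01] := andP be_div_le.
have b0 : 0 <= small_base / n%:R by rewrite divr_ge0// ltW.
have h4 := add1_sqr_le_exp4 h.
have AB : (A ^+ 2) ^+ h * m%:R ^- h <= (small_base / n%:R) ^+ h.
  by rewrite -exprVn -exprMn; apply: lerXn2r; rewrite ?nnegrE ?divr_ge0 ?(ltW A20) ?(ltW small_base_gt0).
rewrite (le_trans (ler_normB _ _))//.
have t1 : `|rho m h * Pw f| <= 2 * decay_cst * (4 * (small_base / n%:R)) ^+ h / sn.
  rewrite normrM (ger0_norm (rho_ge0 _ _)).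
  apply: (@le_trans _ _ (m%:R ^- h * (1 + h%:R ^+ 2) * ((A ^+ 2) ^+ h * (2 * decay_cst / sn)))).
    by apply: ler_pM => //; exact: rho_ge0.
  have -> : m%:R ^- h * (1 + h%:R ^+ 2) * ((A ^+ 2) ^+ h * (2 * decay_cst / sn)) =
    (1 + h%:R ^+ 2) * ((A ^+ 2) ^+ h * m%:R ^- h) * (2 * decay_cst / sn) by ring.
  rewrite [(4 * _) ^+ h]exprMn [leRHS]mulrAC [leRHS]mulrC.
  apply: ler_wpM2r; first by apply: divr_ge0; [exact: mulr_ge0|exact: ltW].
  apply: ler_pM => //.
  by apply: mulr_ge0; rewrite ?invr_ge0 exprn_ge0 ?(ltW A20).
have t2 : `|M * w0 ^+ h| <= decay_cst * (4 * (small_base / n%:R)) ^+ h / sn.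
  rewrite ger0_norm; last by apply: mulr_ge0; rewrite ?exprn_ge0.
  rewrite [leRHS]mulrAC; apply: ler_pM; rewrite ?exprn_ge0//.
  apply: lerXn2r; rewrite ?nnegrE//; first by apply: mulr_ge0.
  by apply: (le_trans w01); lra.
apply: (le_trans (lerD t1 t2)); rewrite le_eqVlt; apply/orP; left; apply/eqP; ring.
Qed.

Lemma large_ratio_le h : ~~ ((4 * h <= n)%N && (2 * h <= m)%N) -> large_ratio * n%:R <= h%:R.
Proof.
rewrite negb_and -!ltnNge => /orP[hh|hh].
  apply: (@le_trans _ _ (1 / 4 * n%:R)); first by rewrite ler_wpM2r// ge_min lexx.
  by move: hh; rewrite -(ltr_nat R) natrM; lra.
apply: (@le_trans _ _ (a / 4 * n%:R)); first by rewrite ler_wpM2r// ge_min lexx orbT.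
have : m%:R < (2 * h)%:R :> R by rewrite ltr_nat.
by move: am; rewrite !natrM; lra.
Qed.

(** The coefficient is bounded by the total mass alone; the missing factor [n^{-3/2}] is paid by
    [4^h >= 1 + h^2 >= (large_ratio * n)^2]. *)
Lemma patch_term_large (f : pf) : ~~ ((4 * fsum f <= n)%N && (2 * fsum f <= m)%N) ->
  `|(if (fsum f <= m)%N then rho m (fsum f) * Pw f else 0) - M * w0 ^+ fsum f| <=
  (1 + decay_cst) / large_ratio ^+ 2 * (patch_base / n%:R) ^+ fsum f / (n%:R * sn).
Proof.
move=> fl; set h := fsum f in fl *; have kh := large_ratio_le fl.
have [M0 M1] := andP gauss_main_le.
have [w00 w01] := andP be_div_le.
have kn0 : 0 < large_ratio * n%:R by rewrite mulr_gt0.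
have h0 : 0 < h%:R :> R by exact: lt_le_trans kh.
have hnn : (0 < h)%N by rewrite -(ltr0n R).
set b := (small_base + large_base) / n%:R.
have b0 : 0 <= b by rewrite divr_ge0// addr_ge0// ltW.
have t1 : `|if (h <= m)%N then rho m h * Pw f else 0| <= b ^+ h.
  case: ifP => hm; last by rewrite normr0 exprn_ge0.
  rewrite normrM (ger0_norm (rho_ge0 _ _)).
  apply: (@le_trans _ _ ((expR 1 / (large_ratio * n%:R)) ^+ h * (A ^+ 2) ^+ h)).
    apply: ler_pM => //; rewrite ?rho_ge0//; last exact: patch_weight_le L f.
    apply: (le_trans (rho_le_fact hm)).
    have hh := pow_le_expR h (ltW h0).
    have f0 : 0 < h`!%:R :> R by rewrite ltr0n fact_gt0.
    rewrite exprMn exprVn -expRM_natl mulr1 -ler_pdivrMr ?invr_gt0 ?exprn_gt0// invrK mulrC.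
    rewrite ler_pdivrMr//; apply: le_trans (le_trans hh _); last by rewrite mulrC.
    by rewrite lerXn2r ?nnegrE// ltW.
  rewrite -exprMn; apply: lerXn2r; rewrite ?nnegrE//.
    by apply: mulr_ge0; [apply: divr_ge0; [exact: expR_ge0|exact: ltW]|exact: ltW].
  have -> : expR 1 / (large_ratio * n%:R) * A ^+ 2 = large_base / n%:R by rewrite /large_base invfM; ring.
  by rewrite /b ler_wpM2r ?invr_ge0// lerDr ltW.
have t2 : `|M * w0 ^+ h| <= decay_cst * b ^+ h.
  rewrite ger0_norm; last by apply: mulr_ge0; rewrite ?exprn_ge0.
  apply: ler_pM; rewrite ?exprn_ge0//.
    by rewrite (le_trans M1)// ler_pdivrMr// ler_peMr.
  apply: lerXn2r; rewrite ?nnegrE//; apply: (le_trans w01).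
  by rewrite /b ler_wpM2r ?invr_ge0// lerDl ltW.
apply: (le_trans (ler_normB _ _)); apply: (le_trans (lerD t1 t2)).
rewrite -[X in X + _]mul1r -mulrDl.
have c10 : 0 <= 1 + decay_cst by rewrite addr_ge0.
have -> : patch_base / n%:R = 4 * b by rewrite /patch_base /b mulrA.
rewrite [(4 * b) ^+ h]exprMn.
have -> : (1 + decay_cst) / large_ratio ^+ 2 * (4 ^+ h * b ^+ h) / (n%:R * sn) =
  (1 + decay_cst) * b ^+ h * (4 ^+ h / (large_ratio ^+ 2 * (n%:R * sn))) by rewrite (invfM (large_ratio ^+ 2)); ring.
rewrite ler_peMr ?mulr_ge0 ?exprn_ge0//.
rewrite ler_pdivlMr ?mulr_gt0 ?exprn_gt0// mul1r.
apply: le_trans (add1_sqr_le_exp4 h).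
apply: (@le_trans _ _ (h%:R ^+ 2)); last by rewrite lerDr.
apply: (@le_trans _ _ ((large_ratio * n%:R) ^+ 2)); last by rewrite lerXn2r ?nnegrE// ltW.
by rewrite exprMn ler_wpM2l ?sqr_ge0// expr2 ler_wpM2l// ltW.
Qed.

(** Patches with [fsum f > m], absent from the exact formula, are included: over all [f], both the
    majorants and the Gaussian values sum to products over pairs. *)
Lemma patch_term_le (f : pf) :
  `|(if (fsum f <= m)%N then rho m (fsum f) * Pw f else 0) - M * w0 ^+ fsum f| <=
  term_cst / sn * (n%:R^-1 + (bad_patch f)%:R) * (patch_base / n%:R) ^+ fsum f.
Proof.
have b1 : 0 <= small_base / n%:R by rewrite divr_ge0// ltW.
have b2 : 0 <= large_base / n%:R by rewrite divr_ge0// ltW.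
have bE : patch_base / n%:R = 4 * (small_base / n%:R) + 4 * (large_base / n%:R) by rewrite /patch_base; ring.
have bb : 0 <= patch_base / n%:R by rewrite bE; apply: addr_ge0; apply: mulr_ge0.
have bh : (4 * (small_base / n%:R)) ^+ fsum f <= (patch_base / n%:R) ^+ fsum f.
  apply: lerXn2r; rewrite ?nnegrE//; first exact: mulr_ge0.
  by rewrite bE lerDl mulr_ge0.
have bh0 : 0 <= (patch_base / n%:R) ^+ fsum f by rewrite exprn_ge0.
have k2 : 0 <= (1 + decay_cst) / large_ratio ^+ 2 by rewrite divr_ge0 ?addr_ge0 ?sqr_ge0.
have ni : 0 <= n%:R^-1 :> R by rewrite invr_ge0.
have si : 0 <= sn^-1 by rewrite invr_ge0 ltW.
have c5 : good_cst <= term_cst /\ 3 * decay_cst <= term_cst /\ (1 + decay_cst) / large_ratio ^+ 2 <= term_cst.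
  by rewrite /term_cst; move: good_cst_ge0 decay_cst_ge0 k2; set k := _ / _; split; [|split]; lra.
case: c5 => c54 [c51 c5k].
have gen (K x : R) : 0 <= K -> K <= term_cst -> 0 <= x -> x <= (patch_base / n%:R) ^+ fsum f ->
    K * x / (n%:R * sn) <= term_cst / sn * (n%:R^-1 + (bad_patch f)%:R) * (patch_base / n%:R) ^+ fsum f.
  move=> K0 K5 x0 xb.
  have -> : K * x / (n%:R * sn) = K / sn * n%:R^-1 * x by rewrite invfM; ring.
  apply: ler_pM => //; first by rewrite !mulr_ge0.
  by apply: ler_pM; rewrite ?mulr_ge0// ?ler_wpM2r// lerDl.
have [small|large] := boolP ((4 * fsum f <= n)%N && (2 * fsum f <= m)%N); last first.
  by apply: le_trans (patch_term_large large) _; apply: gen.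
have /andP[fn fm] := small.
have -> : (fsum f <= m)%N by apply: leq_trans fm; rewrite leq_pmull.
have x0 : 0 <= (4 * (small_base / n%:R)) ^+ fsum f by rewrite exprn_ge0// mulr_ge0.
have [bad|good] := boolP (bad_patch f); last first.
  by apply: le_trans (patch_term_good good fn fm) _; move: gen; rewrite (negPf good); apply.
apply: le_trans (patch_term_small fn fm) _.
have c31 : 0 <= 3 * decay_cst by exact: mulr_ge0.
have -> : 3 * decay_cst * (4 * (small_base / n%:R)) ^+ fsum f / sn =
  3 * decay_cst / sn * 1 * (4 * (small_base / n%:R)) ^+ fsum f by ring.
apply: ler_pM => //; first by apply: mulr_ge0 => //; exact: mulr_ge0.
apply: ler_pM => //; first exact: mulr_ge0.
  exact: ler_wpM2r.
by rewrite lerDr.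
Qed.

End FixedTerms.
End PatchTerms.

(** * Summation over all patches and relative error *)

Section PatchSum.
Context {R : realType}.
Variables (r q : nat) (c E A a : R) (n m : nat) (p : nat -> R) (mu s2 be : R).
Hypotheses (c0 : 0 < c) (E1 : 1 <= E) (A1 : 1 <= A) (q0 : (0 < q)%N) (a0 : 0 < a).
Hypotheses (n0 : (0 < n)%N) (am : a * n%:R <= (2 * m)%:R) (mumE : (2 * m)%:R = n%:R * mu)
  (mcl : (2 * m = n * r %[mod q])%N).
Hypothesis L : lattice_law r q c E A n p (2 * m).+1 mu s2 be.
Hypotheses (m1 : (1 < m)%N) (nbase : patch_base A a <= n%:R).
Local Notation pf := {ffun 'I_n * 'I_n -> 'I_m.+1}.

Let b : R := small_base A a.
Let B : R := patch_base A a.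
Let k1 : R := decay_cst q c.
Let k5 : R := term_cst q c E a.
Definition sum_cst : R :=
  k5 * (expR (B + B ^+ 2) * (1 + 2 * B * (B + B ^+ 2) + 4 * (B + B ^+ 2) ^+ 2)) +
  k1 * (2 * b * (b + b ^+ 2) * expR (b + b ^+ 2) + b ^+ 2).
(** A lower bound, uniform in [n], of [sqrt n] times the main value; it turns an absolute error of
    order [n^{-3/2}] into a relative one of order [1/n]. *)
Definition main_min : R :=
  q%:R / (2 * pi) * Num.sqrt (2 * pi / E) * expR (- (b / 2) - (b / 2) ^+ 2).

Let M := gauss_main q n s2.
Let sn : R := Num.sqrt n%:R.
Let w0 : R := be / (2 * m)%:R.
Let w1 : R := B / n%:R.
Let nr : 0 < n%:R :> R. Proof. by rewrite ltr0n. Qed.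
Let sn0 : 0 < sn. Proof. by rewrite sqrtr_gt0. Qed.

Lemma prod_patch_pow (w : R) (f : pf) :
  \prod_e (patchc e (f e) * w ^+ f e) = (\prod_e patchc e (f e)) * w ^+ fsum f.
Proof. by rewrite big_split /= prodrXr. Qed.

Lemma abs_patch_weight_fsum (w : R) (f : pf) : abs_patch_weight w f = `|\prod_e patchc e (f e)| * w ^+ fsum f.
Proof. by rewrite /abs_patch_weight big_split /= prodrXr normr_prod. Qed.

Let b0 : 0 < b.
Proof. by rewrite /b /small_base mulr_gt0 ?divr_gt0// exprn_gt0// (lt_le_trans _ A1). Qed.

Let bB : b <= B.
Proof.
have A20 : 0 < A ^+ 2 by rewrite exprn_gt0// (lt_le_trans _ A1).
have b20 : 0 < large_base A a.
  rewrite /large_base mulr_gt0// divr_gt0 ?expR_gt0// /large_ratio lt_min.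
  by apply/andP; split; apply: divr_gt0.
by have b0' := b0; rewrite /B /patch_base -/b; lra.
Qed.

Let w1_01 : 0 <= w1 <= 1.
Proof.
have B0 := le_trans (ltW b0) bB.
by rewrite divr_ge0//= ler_pdivrMr// mul1r.
Qed.

Let nw1 : n%:R * w1 = B. Proof. by rewrite /w1 mulrC divfK// gt_eqF. Qed.

Let w0b : 0 <= w0 <= b / n%:R. Proof. exact: (be_div_le A1 a0 n0 am L). Qed.

Let Mb : 0 <= M <= k1 / sn. Proof. exact: (gauss_main_le c0 n0 L). Qed.

(** The majorants turn the error into absolute patch sums at [w1 = B / n], which are bounded in [n]
    and gain a factor [1/n] when restricted to bad patches. *)
Lemma patch_sum_replace :
  `|\sum_(f : pf | (fsum f <= m)%N)
      \prod_e patchc e (f e) * rho m (fsum f) * patch_weight p f -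
    M * \sum_(f : pf) \prod_e (patchc e (f e) * w0 ^+ f e)| <=
  k5 * (expR (B + B ^+ 2) * (1 + 2 * B * (B + B ^+ 2) + 4 * (B + B ^+ 2) ^+ 2)) / (n%:R * sn).
Proof.
rewrite big_mkcond big_distrr /= -sumrB.
have T := patch_term_le c0 E1 A1 q0 a0 n0 am mumE mcl L.
have k5s : 0 <= k5 / sn.
  have := le_trans (normr_ge0 _) (T [ffun=> ord0]).
  have -> : fsum [ffun=> ord0] = 0%N :> nat.
    by move=> n' m'; rewrite /fsum big1// => e _; rewrite ffunE.
  rewrite expr0 mulr1 pmulr_lge0// ltr_pwDl// ?invr_gt0//.
apply: (@le_trans _ _ (\sum_(f : pf) k5 / sn * ((n%:R^-1 + (bad_patch f)%:R) * abs_patch_weight w1 f))).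
  apply: le_trans (ler_norm_sum _ _ _) (ler_sum _ _) => f _.
  rewrite abs_patch_weight_fsum prod_patch_pow.
  set P := \prod_e _; have := T f; rewrite -/k5 -/sn -/M -/w0 -/B -/w1.
  set X := n%:R^-1 + _; set Y := w1 ^+ _; move=> TT.
  have -> : k5 / sn * (X * (`|P| * Y)) = `|P| * (k5 / sn * X * Y) by ring.
  apply: le_trans (ler_wpM2l (normr_ge0 P) TT); rewrite -normrM.
  rewrite le_eqVlt; apply/orP; left; apply/eqP; congr (`| _ |).
  by case: ifP => _; ring.
rewrite -big_distrr /=.
have -> : \sum_(f : pf) (n%:R^-1 + (bad_patch f)%:R) * abs_patch_weight w1 f =
   n%:R^-1 * \sum_(f : pf) abs_patch_weight w1 f + \sum_(f : pf | bad_patch f) abs_patch_weight w1 f.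
  rewrite [in X in _ = _ + X]big_mkcond /= big_distrr /= -big_split /=; apply: eq_bigr => f _.
  by rewrite mulrDl; case: (bad_patch f); rewrite ?mul1r// mul0r.
have S1 := sum_abs_patch_le n m w1_01.
have S2 := sum_bad_le n m w1_01.
have tE : patch_tot n w1 = expR (B + B ^+ 2) by rewrite /patch_tot -exprMn nw1.
rewrite tE in S1 S2; set X := expR _ in S1 S2 *.
have -> : k5 * (X * (1 + 2 * B * (B + B ^+ 2) + 4 * (B + B ^+ 2) ^+ 2)) / (n%:R * sn) =
  k5 / sn * (n%:R^-1 * X + n%:R * (w1 * (2 * (w1 + n%:R * w1 ^+ 2)) + (2 * (w1 + n%:R * w1 ^+ 2)) ^+ 2) * X).
  rewrite -nw1; move: (w1) => w; have n1 := lt0r_neq0 nr; have s1 := lt0r_neq0 sn0.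
  by move: (X) (k5) n1 s1 => x k; move: (n%:R) (sn) => N s N1 s1; field; rewrite N1 s1.
apply: ler_wpM2l => //; apply: lerD => //.
by apply: ler_wpM2l => //; rewrite invr_ge0.
Qed.

Lemma patch_sum_main :
  `|M * \sum_(f : pf) \prod_e (patchc e (f e) * w0 ^+ f e) -
    M * expR (- (n%:R * w0 / 2) - (n%:R * w0 / 2) ^+ 2)| <=
  k1 * (2 * b * (b + b ^+ 2) * expR (b + b ^+ 2) + b ^+ 2) / (n%:R * sn).
Proof.
have [w00 w0le] := andP w0b; have [M0 Mle] := andP Mb.
have w01 : 0 <= w0 <= 1.
  rewrite w00 (le_trans w0le)// ler_pdivrMr// mul1r; exact: le_trans bB _.
have S := sum_patchc_approx n m1 w01.
rewrite -mulrBr normrM (ger0_norm M0).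
have -> : k1 * (2 * b * (b + b ^+ 2) * expR (b + b ^+ 2) + b ^+ 2) / (n%:R * sn) =
   k1 / sn * ((2 * b * (b + b ^+ 2) * expR (b + b ^+ 2) + b ^+ 2) / n%:R) by rewrite invfM; ring.
apply: ler_pM => //; apply: (le_trans S).
have nw0 : n%:R * w0 <= b by rewrite mulrC -ler_pdivlMr.
have nw00 : 0 <= n%:R * w0 by rewrite mulr_ge0.
have P1 : patch_tot n w0 <= expR (b + b ^+ 2).
  rewrite /patch_tot ler_expR -exprMn lerD// lerXn2r// nnegrE//; exact: ltW.
have sq : (n%:R * w0) ^+ 2 <= b ^+ 2 by rewrite lerXn2r// nnegrE//; exact: ltW.
have sq0 := sqr_ge0 (n%:R * w0).
rewrite [leRHS]mulrDl; apply: lerD.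
  have -> : 2 * b * (b + b ^+ 2) * expR (b + b ^+ 2) / n%:R =
    2 * (b / n%:R) * (b + b ^+ 2) * expR (b + b ^+ 2) by ring.
  rewrite -exprMn; apply: ler_pM => //.
  - by apply: mulr_ge0; [exact: mulr_ge0|exact: addr_ge0].
  - exact: expR_ge0.
  - by apply: ler_pM; [exact: mulr_ge0|exact: addr_ge0|exact: ler_wpM2l|exact: lerD].
rewrite ler_pdivlMr//.
by have -> : n%:R * w0 ^+ 2 * n%:R = (n%:R * w0) ^+ 2 by ring.
Qed.

Lemma patch_sum_rel : exists2 eps : R, `|eps| <= sum_cst / main_min / n%:R &
  \sum_(f : pf | (fsum f <= m)%N) \prod_e patchc e (f e) * rho m (fsum f) * patch_weight p f =
  M * expR (- (n%:R * w0 / 2) - (n%:R * w0 / 2) ^+ 2) * (1 + eps).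
Proof.
set S := \sum_(f | _) _; set G := M * expR _.
have SG : `|S - G| <= sum_cst / (n%:R * sn).
  rewrite /sum_cst mulrDl; apply: le_trans (lerD patch_sum_replace patch_sum_main).
  by apply: le_trans (ler_normD _ _); rewrite addrA subrK.
have [w00 w0le] := andP w0b.
have nw0 : n%:R * w0 <= b by rewrite mulrC -ler_pdivlMr.
have nw00 : 0 <= n%:R * w0 by rewrite mulr_ge0.
have pi0 := pi_gt0 R.
have qp : 0 < q%:R / (2 * pi) :> R by rewrite divr_gt0// ?ltr0n// mulr_gt0.
have E0 : 0 < E by exact: lt_le_trans E1.
have mm0 : 0 < main_min.
  by rewrite /main_min mulr_gt0 ?expR_gt0// mulr_gt0// sqrtr_gt0 divr_gt0// mulr_gt0.
have Gm : main_min / sn <= G.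
  have -> : main_min / sn = q%:R / (2 * pi) * (Num.sqrt (2 * pi / E) / sn) *
     expR (- (b / 2) - (b / 2) ^+ 2) by rewrite /main_min; move: (q%:R / (2 * pi)) => ?; ring.
  apply: ler_pM.
  - apply: mulr_ge0; [exact: ltW|apply: divr_ge0; [exact: sqrtr_ge0|exact: ltW]].
  - exact: expR_ge0.
  - apply: ler_wpM2l; first exact: ltW.
    case/andP: (law_s2 L) => s2c s2E; have c0' := c0.
    have s20 : 0 < s2 by lra.
    rewrite /sn -sqrtrV ?(ltW nr)// -sqrtrM; last by rewrite divr_ge0// ?mulr_ge0// ltW.
    rewrite ler_wsqrtr// (invfM s2) mulrA; apply: ler_wpM2r; first by rewrite invr_ge0.
    apply: ler_wpM2l; first by rewrite mulr_ge0// ltW.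
    by rewrite lef_pV2 ?posrE.
  rewrite ler_expR; have h2 : n%:R * w0 / 2 <= b / 2 by rewrite ler_wpM2r.
  have h0 : 0 <= n%:R * w0 / 2 by rewrite mulr_ge0.
  have hs : (n%:R * w0 / 2) ^+ 2 <= (b / 2) ^+ 2.
    by apply: lerXn2r; rewrite ?nnegrE// (le_trans h0).
  by rewrite lerD// lerN2.
have G0 : 0 < G by apply: lt_le_trans Gm; rewrite divr_gt0.
exists ((S - G) / G); last by rewrite mulrDr mulr1 [G * _]mulrC divfK ?gt_eqF// addrC subrK.
rewrite normrM normfV (ger0_norm (ltW G0)) ler_pdivrMr//.
apply: (le_trans SG).
have c6 : 0 <= sum_cst.
  by have := le_trans (normr_ge0 _) SG; rewrite pmulr_lge0// invr_gt0 mulr_gt0.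
have -> : sum_cst / (n%:R * sn) = sum_cst / main_min / n%:R * (main_min / sn).
  have n1 := lt0r_neq0 nr; have s1 := lt0r_neq0 sn0; have k1' := lt0r_neq0 mm0.
  move: (sum_cst) (main_min) n1 s1 k1' => x k; move: (n%:R) (sn) => N s N1 s1 k1'.
  by field; rewrite N1 s1 k1'.
apply: ler_wpM2l => //; apply: divr_ge0 => //; apply: divr_ge0 => //; exact: ltW.
Qed.

End PatchSum.

(** * Degree conditions *)

Lemma sum_degree (D : set nat) n m (G : {set {set 'I_n}}) :
  G \in SG D n m -> (\sum_v degree G v = 2 * m)%N.
Proof.
rewrite inE => /and3P[/forallP G2 /eqP Gm _].
have -> : (\sum_v degree G v = \sum_v \sum_(e in G) (v \in e))%N.
  apply: eq_bigr => v _; rewrite /degree -sum1_card.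
  rewrite big_mkcond [RHS]big_mkcond /=; apply: eq_bigr => e _; rewrite inE.
  by case: (e \in G) => //; case: (v \in e).
rewrite exchange_big /= -Gm mulnC -sum_nat_const; apply: eq_bigr => e eG.
by have /implyP /(_ eG) /eqP <- := G2 e; rewrite -sum1_card [RHS]big_mkcond.
Qed.

Lemma degree_in (D : set nat) n m (G : {set {set 'I_n}}) v :
  G \in SG D n m -> D (degree G v).
Proof. by rewrite inE => /and3P[_ _ /forallP /(_ v) /set_mem]. Qed.

Lemma SG_eq0 (D : set nat) n m :
  (forall G, G \in SG D n m -> False) -> SG D n m = finset.set0.
Proof. by move=> H; apply/finset.setP => G; rewrite finset.in_set0; apply/negP => /H. Qed.

(** [2 m - r n] is the sum over the vertices of [degree - r], each a difference of elements of
    [D]. *)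
Lemma gcd_dvd_SG (D : set nat) (r p n m : nat) (G : {set {set 'I_n}}) :
  is_min D r -> is_gcd_diff D p -> G \in SG D n m ->
  (p%:Z %| (2 * m)%:Z - (r * n)%:Z)%Z.
Proof.
move=> [Dr _] [pD _] GS; rewrite -(sum_degree GS).
have -> : (r * n)%:Z = \sum_(v < n) r%:Z.
  by rewrite sumr_const card_ord PoszM mulrC -mulr_natl natz.
rewrite (big_morph Posz PoszD (erefl _)) -sumrB; apply: rpred_sum => v _.
exact: pD (degree_in v GS) Dr.
Qed.

Lemma min_le_SG (D : set nat) (r n m : nat) (G : {set {set 'I_n}}) :
  is_min D r -> G \in SG D n m -> (r * n <= 2 * m)%N.
Proof.
move=> [_ lbr] GS; rewrite -(sum_degree GS) mulnC -{1}[n]card_ord -sum_nat_const.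
by apply: leq_sum => v _; exact: lbr (degree_in v GS).
Qed.

Section MaxD.
Context {R : realType}.
Implicit Types (D : set nat).

Lemma SG_le_max D n m (G : {set {set 'I_n}}) : (0 < n)%N -> G \in SG D n m ->
  (((2 * m)%:R / n%:R : R)%:E <= maxD R D)%E.
Proof.
move=> n0 GS; rewrite /maxD; case: asboolP => [fD|_]; last by rewrite leey.
rewrite lee_fin ler_pdivrMr ?ltr0n// -natrM ler_nat -(sum_degree GS) mulnC.
rewrite -[X in (_ <= X * _)%N]card_ord -sum_nat_const; apply: leq_sum => v _; apply: leq_bigmax_seq => //.
by rewrite in_fset_set//; apply: mem_set; exact: degree_in GS.
Qed.

(** If no element exceeds [b], then [D] is bounded, hence finite, and its maximum is at most [b]. *)
Lemma lt_maxD D (b : R) : 0 <= b -> (b%:E < maxD R D)%E ->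
  exists2 d, D d & b < d%:R.
Proof.
move=> b0 bD; apply: contrapT => H.
have {}H d : D d -> (d <= Num.truncn b)%N.
  by move=> Dd; rewrite truncn_ge_nat// leNgt; apply/negP => bd; apply: H; exists d.
move: bD; rewrite /maxD; case: asboolP => [fD|]; last first.
  by case; apply: (@sub_finite_set _ _ `I_(Num.truncn b).+1); [exact: H|exact: finite_II].
rewrite lte_fin ltNge => /negP; apply; rewrite -truncn_ge_nat//.
by apply/bigmax_leqP_seq => d; rewrite in_fset_set// => /set_mem dD _; exact: H.
Qed.

End MaxD.

(** * Identification of the constants of the asymptotic formula *)

Lemma law_A_ge1 {R : realType} (r : nat) (z1 z2 : R) : 0 < z1 -> 0 <= z2 -> 1 <= law_A r z1 z2.
Proof.
move=> z10 z20; rewrite /law_A -[leLHS]mulr1; apply: ler_pM => //; first by rewrite lerDr.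
by rewrite lerDr divr_ge0 ?expR_ge0// divr_ge0// exprn_ge0// ltW.
Qed.

Lemma gauss_main_sqrt {R : realType} (q n : nat) (s2 : R) : (0 < n)%N -> 0 < s2 ->
  gauss_main q n s2 = q%:R / Num.sqrt (2 * pi * n%:R * s2).
Proof.
move=> n0 s20; rewrite /gauss_main.
have nr : 0 < n%:R :> R by rewrite ltr0n.
have p0 : 0 < 2 * pi :> R by rewrite mulr_gt0// pi_gt0.
have -> : 2 * pi * n%:R * s2 = 2 * pi * (s2 * n%:R) by ring.
have x0 : 0 < s2 * n%:R by exact: mulr_gt0.
move: (2 * pi) p0 (s2 * n%:R) x0 => P P0 x x0.
rewrite [in RHS]sqrtrM ?ltW// [in LHS]sqrtrM ?ltW// sqrtrV ?ltW//.
rewrite -{1}[P]sqr_sqrtr ?ltW//.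
have : Num.sqrt P != 0 by rewrite sqrtr_eq0 -ltNge.
have : Num.sqrt x != 0 by rewrite sqrtr_eq0 -ltNge.
by move: (Num.sqrt P) (Num.sqrt x) => u v v0 u0; field; rewrite u0 v0.
Qed.

Lemma derive1_phi {R : realType} (D : set nat) (z : R) : (exists d, D d) -> 0 < z ->
  z * derive1 (phi D) z = tvar D z.
Proof.
move=> Dn0 z0; rewrite derive1E; have H := is_derive_phi Dn0 z0.
by rewrite derive_val mulrC divfK// gt_eqF.
Qed.

Theorem theorem1 (R : realType) (D : set nat) (r p : nat)
    (hD : exists d1 d2 : nat, [/\ D d1, D d2 & d1 <> d2])
    (hr : is_min D r) (hp : is_gcd_diff D p) :
  (forall a b : R, r%:R < a -> a <= b -> (b%:E < maxD R D)%E ->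
    exists (C : R) (N : nat), forall n m : nat,
      (N <= n)%N -> (N <= m)%N ->
      a <= (2 * m)%:R / n%:R <= b ->
      (p%:Z %| (2 * m)%:Z - (r * n)%:Z)%Z ->
      exists zeta : R,
        unique (fun z : R => 0 < z /\ phi D z = (2 * m)%:R / n%:R) zeta /\
        exists eps : R, `|eps| <= C / n%:R /\
          #|SG D n m|%:R = main_term D p n m zeta * (1 + eps))
  /\
  (forall n m : nat,
    ~~ (p%:Z %| (2 * m)%:Z - (r * n)%:Z)%Z -> SG D n m = finset.set0)
  /\
  (forall n m : nat, (0 < n)%N ->
    (2 * m)%:R / n%:R < (r%:R : R) -> SG D n m = finset.set0)
  /\
  (forall n m : nat, (0 < n)%N ->
    (maxD R D < ((2 * m)%:R / n%:R)%:E)%E -> SG D n m = finset.set0).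
Proof.
split; last split; last split.
- case: hD => d1 [d2 [D1 D2 d12]] a b ra ab bD.
  have Dn0 : exists d, D d by exists d1.
  have p0 := gcd_diff_gt0 D1 D2 d12 hp.
  have a0 : 0 < a by exact: le_lt_trans ra.
  have b0 : 0 < b by exact: lt_le_trans ab.
  have [d0 D0 bd0] := lt_maxD (ltW b0) bD.
  have [z1 [z2 [z10 saddle]]] := saddle_exists Dn0 hr D1 D2 d12 D0 ra ab bd0.
  have z20 : 0 <= z2.
    have [|z /andP[zz1 zz2] _] := saddle a; first by rewrite lexx.
    exact: le_trans (ltW z10) (le_trans zz1 zz2).
  have [C [T0 [C0 gapC]]] := gap_controlled_gcd z2 z10 Dn0 D1 D2 d12 hp.
  set c := law_c z1 z2 C d1 d2; set E := law_E r z1 z2 a b; set A := law_A r z1 z2.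
  have c0 : 0 < c by exact: law_c_gt0.
  have E1 : 1 <= E by exact: law_E_ge1.
  have A1 : 1 <= A by exact: law_A_ge1.
  (* [2] gives [0 < n] and [1 < m], [T0] the range where the characteristic function is known to
     decay, and the last bound makes the majorizing weight [patch_base / n] at most [1]. *)
  exists (sum_cst p c E A a / main_min p E A a), (maxn 2 (maxn T0 (Num.truncn (patch_base A a)).+1)) => n m.
  rewrite !geq_max => /and3P[n2 _ nb] /and3P[m2 mT _] /andP[am mb] pdvd.
  have n0 : (0 < n)%N by exact: ltnW.
  have nr : 0 < n%:R :> R by rewrite ltr0n.
  have [|z z12 zu] := saddle ((2 * m)%:R / n%:R); first by rewrite am.
  have [[z0 phz] _] := zu.
  exists z; split => //.
  have amn : a * n%:R <= (2 * m)%:R by rewrite -ler_pdivlMr.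
  have rn2m : (r * n <= 2 * m)%N.
    rewrite -(ler_nat R) natrM; apply: le_trans amn; apply: ler_wpM2r => //; exact: ltW.
  have mcl : (2 * m = n * r %[mod p])%N.
    by apply/eqP; rewrite [(n * r)%N]mulnC eqn_mod_dvd//; move: pdvd; rewrite subzn.
  have L : lattice_law r p c E A n (tilt D z (SetD D z)) (2 * m).+1 (phi D z) (tvar D z) (tfac2 D z).
    apply: (lattice_law_tilt hr hp D1 D2 d12 z10 a0 C0 gapC z12 n0 _ amn).
      by apply: (leq_trans mT); rewrite leqW// leq_pmull.
    by rewrite phz mb andbT divr_ge0.
  have nbase : patch_base A a <= n%:R.
    by apply: le_trans (ltW (truncnS_gt _)) _; rewrite ler_nat.
  have mumE : (2 * m)%:R = n%:R * phi D z by rewrite phz mulrC divfK// gt_eqF.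
  have [eps eps_le sumE] := patch_sum_rel c0 E1 A1 p0 a0 n0 amn mumE mcl L m2 nbase.
  exists eps; split => //.
  have ZD0 : 0 < SetD D z by exact: SetD_gt0.
  rewrite (@graph_count_tilt R D n m z (SetD D z)) ?gt_eqF//.
  move: sumE; rewrite /patch_weight => ->.
  have s20 : 0 < tvar D z by case/andP: (law_s2 L) => + _; apply: lt_le_trans; rewrite mulr_gt0.
  (* The exponent [n w / 2] of the patch sum, taken at [w = tfac2 D z / (2 m)]. *)
  have -> : n%:R * (tfac2 D z / (2 * m)%:R) / 2 = W D n m z.
    rewrite /W -/(tfac2 D z) !natrM.
    have : m%:R != 0 :> R by rewrite pnatr_eq0 -lt0n; exact: ltnW.
    by move: (m%:R : R) => M M0; field.
  have -> : gauss_main p n (tvar D z) =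
      p%:R / Num.sqrt (2 * pi * n%:R * z * derive1 (phi D) z).
    by rewrite gauss_main_sqrt// -(derive1_phi Dn0 z0) mulrA.
  by rewrite /main_term [- W D n m z ^+ 2 - _]addrC !mulrA.
- by move=> n m /negP pn; apply: SG_eq0 => G GS; apply: pn; exact: gcd_dvd_SG GS.
- move=> n m n0; rewrite ltr_pdivrMr ?ltr0n// -natrM ltr_nat => lt.
  by apply: SG_eq0 => G /(min_le_SG hr); rewrite leqNgt lt.
- move=> n m n0 lt; apply: SG_eq0 => G GS.
  by have := SG_le_max (R := R) n0 GS; rewrite leNgt lt.
Qed.
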